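(* Let $G$ be a pseudo-outerplanar graph with maximum degree $\Delta(G)$, and let $L$ be a list assignment to the elements of $G$ (assigning to each $x\in V(G)\cup E(G)$ a set $L(x)$ of colors). If $|L(x)|\geq \max\{6,\Delta(G)+1\}$ for each $x\in V(G)\cup E(G)$, then $G$ has an $L$-total coloring.
   Context: All graphs are finite, simple and undirected. A graph is pseudo-outerplanar if each of its blocks has an embedding in the plane so that the vertices lie on a fixed circle and the edges lie inside the disk of this circle with each edge crossing at most one other edge. A total coloring of $G$ assigns colors to the vertices and edges so that any two adjacent vertices, any two adjacent edges (sharing an endpoint), and any vertex and an edge incident with it receive different colors. Given a list assignment $L$, an $L$-total coloring is a total coloring $\varphi$ with $\varphi(x)\in L(x)$ for every $x\in V(G)\cup E(G)$. *)

(* Defs.v *)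
From HB Require Import structures.
From mathcomp Require Import all_boot all_order all_algebra.
From mathcomp Require Import all_classical all_reals all_analysis.

Set Implicit Arguments.
Unset Strict Implicit.
Unset Printing Implicit Defensive.

Import Order.TTheory GRing.Theory Num.Theory.
Import numFieldNormedType.Exports.

Local Open Scope classical_set_scope.
Local Open Scope ring_scope.

(* A finite simple graph is a symmetric irreflexive relation [e] on a finite
   type; its edges are the pairs [set u; v] with [e u v]. *)

Definition edges (T : finType) (e : rel T) : {set {set T}} :=
  [set A : {set T} | [exists u, exists v, e u v && (A == [set u; v]%SET)]]%SET.

Definition edge (T : finType) (e : rel T) := {A : {set T} | A \in edges e}.

Definition max_degree (T : finType) (e : rel T) : nat :=
  \max_(v : T) #|[set w | e v w]%SET|.

Definition induced (T : finType) (e : rel T) (B : {set T}) : rel T :=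
  [rel u v | [&& u \in B, v \in B & e u v]].

(* This holds of the empty set, so that [nonseparable] accepts a
   single vertex. *)
Definition connected_on (T : finType) (e : rel T) (B : {set T}) : bool :=
  [forall u in B, forall v in B, connect (induced e B) u v].

Definition nonseparable (T : finType) (e : rel T) (B : {set T}) : bool :=
  [&& B != finset.set0, connected_on e B &
      [forall v in B, connected_on e (B :\ v)%SET]].

(* A block is a maximal connected subgraph without a cut vertex of its own.
   Adding an edge between two of its vertices preserves both properties, so it
   is an induced subgraph and is represented by its vertex set. *)
Definition block (T : finType) (e : rel T) (B : {set T}) : bool :=
  maxset (nonseparable e) B.

Definition on_circle (R : realType) (z : R * R) : Prop :=
  z.1 ^+ 2 + z.2 ^+ 2 = 1.

Definition in_disk (R : realType) (z : R * R) : Prop :=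
  z.1 ^+ 2 + z.2 ^+ 2 <= 1.

(* Two distinct edges cross when the interiors of their arcs share a point; as
   arcs avoid vertices except at their ends, these are exactly the common
   points that are not common endpoints. *)
Definition crosses (R : realType) (T : finType) (e : rel T)
    (arc : edge e -> R -> R * R) (a b : edge e) : Prop :=
  a <> b /\
  exists s t : R, [/\ 0 < s < 1, 0 < t < 1 & arc a s = arc b t].

(* [pos] places the vertices of B on the unit circle and [arc a], restricted to
   the interval [0, 1], is a simple arc representing the edge [a]. *)
Record circular_drawing (R : realType) (T : finType) (B : {set T}) (e : rel T)
    (pos : T -> R * R) (arc : edge e -> R -> R * R) : Prop := CircularDrawing {
  pos_circle : forall v, v \in B -> on_circle (pos v);
  pos_inj : {in B &, injective pos};
  arc_continuous : forall a, {within `[0, 1]%classic, continuous (arc a)};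
  arc_inj : forall a, {in `[0, 1] &, injective (arc a)};
  arc_ends : forall a, exists u v,
    [/\ val a = [set u; v]%SET, arc a 0 = pos u & arc a 1 = pos v];
  arc_avoids : forall a t v, 0 < t < 1 -> v \in B -> arc a t <> pos v;
  arc_disk : forall a t, 0 <= t <= 1 -> in_disk (arc a t);
  arc_crossing : forall a b b', crosses arc a b -> crosses arc a b' -> b = b'
}.

Definition pseudo_outerplanar (R : realType) (T : finType) (e : rel T) : Prop :=
  forall B : {set T}, block e B ->
    exists (pos : T -> R * R) (arc : edge (induced e B) -> R -> R * R),
      circular_drawing B pos arc.

Definition element (T : finType) (e : rel T) : Type := (T + edge e)%type.

Definition conflict (T : finType) (e : rel T) (x y : element e) : bool :=
  match x, y with
  | inl u, inl v => e u v
  | inl u, inr a => u \in val a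
  | inr a, inl u => u \in val a
  | inr a, inr b => (a != b) && ~~ [disjoint val a & val b]
  end.

Definition total_coloring (T : finType) (e : rel T) (C : Type)
    (phi : element e -> C) : Prop :=
  forall x y : element e, conflict x y -> phi x <> phi y.

Definition list_total_coloring (T : finType) (e : rel T) (C : Type)
    (L : element e -> set C) (phi : element e -> C) : Prop :=
  total_coloring phi /\ forall x, L x (phi x).

(* Main.v *)
(* Two arcs in the disk whose ends interleave on the circle meet, so a drawing of
   a block is a cyclic order of its vertices in which each edge is crossed by at
   most one other edge.  Orders of the blocks are concatenated at cut vertices, so
   a minimal counterexample G also has such an order.

   Erase the colours of a few elements of G.  By the Combinatorial Nullstellensatz
   they can be coloured again from the remaining lists if the product of
   differences x_A - x_B over conflicting pairs has a nonzero coefficient at a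
   monomial with small exponents.  This excludes an edge uv with d(u) <= 2 and
   d(u) + d(v) <= k, two 2-vertices with the same neighbours, and so on.  It also
   shows that a "gadget", i.e. two adjacent 3-vertices u, v with common neighbours
   x, y, forces k = 6 and d(x) = d(y) = 5.  One configuration has a vanishing
   coefficient and is coloured by hand.

   The ends of an innermost crossing that is not between two edges of a gadget
   bound three gaps, each of which can only contain one 2-vertex or one gadget, and
   all these cases are excluded.  So all crossings are inside gadgets.  Between the
   ends of an innermost chord there is then no vertex of degree at least 3 outside
   the middles of gadgets, and on each side such a vertex has at most one neighbour
   of its kind, which bounds its degree and makes G reducible. *)

(* A vertex u counts as the degenerate edge uu. Every element uv, degenerate or not, then conflicts
   with at most d(u) + d(v) others, so one formula bounds all lists that remain after erasing: k +
   (conflicts inside the erased set) - d(u) - d(v). A reducible configuration thus becomes a finite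
   certificate, an exponent vector whose coefficient is computed. A gadget with k = 6 and ends of
   degree 5 is not excluded by itself. This is why the structural statements tolerate crossings
   inside gadgets and exclude only vertices that are not middles of gadgets. The order is made
   global before minimality is used: in a single block a cut vertex would have uncontrolled
   neighbours outside, whereas after gluing no vertex is exceptional. That interleaved arcs meet is
   shown without the Jordan curve theorem: ratios of distances to tangents at the four ends map the
   disk injectively into a square in which the arcs join opposite sides, and there a labelled grid
   gives a discrete winding number argument. *)
Require Import Defs.
From mathcomp Require Import all_boot all_order all_algebra.
From mathcomp Require Import all_classical all_reals all_analysis.
From mathcomp Require Import zify ring lra.

Set Implicit Arguments.
Unset Strict Implicit.
Unset Printing Implicit Defensive.

Local Open Scope set_scope.
(* [charge] also defines a constant of this name. *)
Local Notation induced := Defs.induced.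

(** * The Alon-Tarsi criterion *)

Section AlonTarsi.
Import Order.TTheory GRing.Theory Num.Theory.
Local Open Scope ring_scope.

(** The weights form the last column of an inverse Vandermonde matrix. Summing against them reads
    off the coefficient of degree [t] of a polynomial of degree at most [t] from its values on
    [s]. *)
Lemma moment_weights (F : fieldType) (t : nat) (s : seq F) :
  uniq s -> size s = t.+1 ->
  exists w : F -> F,
    forall m, (m <= t)%N -> \sum_(c <- s) w c * c ^+ m = (m == t)%:R.
Proof.
move=> s_uniq s_size.
pose V := Vandermonde t.+1 (\row_(j < t.+1) s`_j).
have V_unit : V \in unitmx.
  rewrite unitmxE det_Vandermonde unitfE.
  apply/prodf_neq0 => i _; apply/prodf_neq0 => j i_lt_j.
  by rewrite !mxE subr_eq0 nth_uniq ?s_size // gtn_eqF.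
exists (fun c => invmx V (inord (index c s)) ord_max) => m m_le.
have /matrixP /(_ (inord m) ord_max) := mulmxV V_unit.
rewrite !mxE -val_eqE /= inordK ?ltnS // => <-.
rewrite (big_nth 0) big_mkord s_size; apply: eq_bigr => j _.
rewrite index_uniq ?s_size // inord_val !mxE inordK ?ltnS //.
by rewrite mulrC.
Qed.

Definition decr_nth (r : seq nat) (a : nat) : seq nat :=
  set_nth 0%N r a (nth 0%N r a).-1.

(** The coefficient of the monomial with exponents [r] in the product of x_a - x_b over the pairs
    (a, b) of [E]; exponents beyond the end of [r] are 0. *)
Fixpoint graph_coef (E : seq (nat * nat)) (r : seq nat) : int :=
  if E is (a, b) :: E' then
    (if (0 < nth 0 r a)%N then graph_coef E' (decr_nth r a) else 0)
    - (if (0 < nth 0 r b)%N then graph_coef E' (decr_nth r b) else 0)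
  else (all (eq_op 0%N) r)%:R.

Lemma sumn_ord (r : seq nat) : sumn r = (\sum_(i < size r) nth 0 r i)%N.
Proof. by rewrite sumnE (big_nth 0%N) big_mkord. Qed.

Section Functional.
Variables (n N : nat) (w : 'I_n -> 'I_N -> rat) (t : seq nat).
Hypothesis t_size : size t = n.
Hypothesis w_moment : forall (i : 'I_n) m, (m <= nth 0 t i)%N ->
  \sum_(c < N) w i c * c%:R ^+ m = (m == nth 0 t i)%N%:R.

(** The product of the moment functionals, applied to the monomial with exponents [d] times the
    graph polynomial. It is a weighted sum over a grid, so a nonzero value yields a point of nonzero
    weight at which no difference vanishes. *)
Definition graph_functional (E : seq ('I_n * 'I_n)) (d : 'I_n -> nat) : rat :=
  \sum_(s : {ffun 'I_n -> 'I_N})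
    (\prod_i (w i (s i) * (s i)%:R ^+ d i)) *
    \prod_(p <- E) ((s p.1)%:R - (s p.2)%:R).

Definition incr (d : 'I_n -> nat) (a i : 'I_n) : nat := (d i + (i == a))%N.

Lemma graph_functional_nil d :
  graph_functional [::] d = \prod_i \sum_(c < N) w i c * c%:R ^+ d i.
Proof.
rewrite bigA_distr_bigA; apply: eq_bigr => s _.
by rewrite big_nil mulr1.
Qed.

Lemma graph_functional_cons a b E d :
  graph_functional ((a, b) :: E) d =
  graph_functional E (incr d a) - graph_functional E (incr d b).
Proof.
have incrE (s : {ffun 'I_n -> 'I_N}) c :
    \prod_i (w i (s i) * (s i)%:R ^+ incr d c i) =
    (s c)%:R * \prod_i (w i (s i) * (s i)%:R ^+ d i).
  rewrite (bigD1 c) // [in RHS](bigD1 c) //= /incr eqxx addn1 exprS.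
  rewrite !mulrA; congr (_ * _); first by rewrite -[in RHS]mulrA mulrCA mulrA.
  by apply: eq_bigr => i /negPf ->; rewrite addn0.
rewrite /graph_functional -sumrB; apply: eq_bigr => s _.
rewrite !incrE big_cons /= -mulrBl -[in RHS]mulrBl mulrA; congr (_ * _).
exact: mulrC.
Qed.

Lemma sum_incr d a : (\sum_i incr d a i = (\sum_i d i).+1)%N.
Proof.
by rewrite big_split /= -addn1; congr addn; rewrite (bigD1 a) //= eqxx big1 // => i /negPf ->.
Qed.

(* A monomial of the right total degree other than the target has an exponent
   below its target, and the corresponding moment vanishes. *)
Lemma graph_functional_overflow E d (j : 'I_n) :
  (\sum_i d i + size E = sumn t)%N -> (nth 0 t j < d j)%N ->
  graph_functional E d = 0.
Proof.
elim: E d => [|[a b] E IH] d /=.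
  rewrite addn0 => d_sum d_gt; rewrite graph_functional_nil.
  have [i d_lt] : exists i : 'I_n, (d i < nth 0 t i)%N.
    apply/existsP; apply: contraLR d_gt => /existsPn d_ge.
    rewrite -leqNgt; move: d_sum; rewrite sumn_ord t_size.
    rewrite (bigD1 j) //= [in RHS](bigD1 j) //= => d_sum.
    have: (\sum_(i < n | i != j) nth 0 t i <= \sum_(i < n | i != j) d i)%N.
      by apply: leq_sum => i _; rewrite leqNgt d_ge.
    by move=> le; rewrite -(leq_add2r (\sum_(i < n | i != j) d i)) d_sum leq_add2l.
  apply/eqP; rewrite prodf_seq_eq0; apply/hasP; exists i; first exact: mem_index_enum.
  by rewrite w_moment ?(ltnW d_lt) // ltn_eqF.
rewrite addnS => d_sum d_gt; rewrite graph_functional_cons.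
by rewrite !IH ?subr0 ?sum_incr ?addSn // /incr ltn_addr.
Qed.

(** The factors of [E] move one by one into the monomial, and [r] records what [d] still lacks from
    the target [t]. A step at a vertex where [r] is exhausted overflows and contributes 0, as in
    [graph_coef]. *)
Lemma graph_functionalE E d r :
  size r = n -> (forall i : 'I_n, d i + nth 0 r i = nth 0 t i)%N ->
  size E = sumn r ->
  graph_functional E d =
  (graph_coef [seq (val p.1, val p.2) | p <- E] r)%:~R.
Proof.
elim: E d r => [|[a b] E IH] d r r_size dr E_size /=.
  have r0 : all (eq_op 0%N) r.
    apply/(all_nthP 0%N) => i i_lt; apply/eqP/esym/eqP.
    rewrite -leqn0 [leqRHS]E_size sumn_ord.
    by rewrite (bigD1 (Ordinal i_lt)) //= leq_addr.
  rewrite r0 graph_functional_nil big1 // => i _.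
  have d_eq : d i = nth 0%N t i.
    by rewrite -dr -[nth _ r i](eqP (all_nthP 0%N r0 i _)) ?addn0 ?r_size.
  by rewrite w_moment ?d_eq ?eqxx.
have sum_t : (\sum_i d i + (size E).+1 = sumn t)%N.
  have <- : (\sum_i d i + sumn r = sumn t)%N.
    rewrite !sumn_ord r_size t_size -big_split.
    by apply: eq_bigr => i _; rewrite -dr.
  by rewrite -E_size.
have step c : graph_functional E (incr d c) =
    (if (0 < nth 0 r c)%N
     then graph_coef [seq (val p.1, val p.2) | p <- E] (decr_nth r c) else 0)%:~R.
  case: posnP => [r0 | r_gt0].
    apply: (@graph_functional_overflow _ _ c); first by rewrite sum_incr addSnnS.
    by rewrite /incr eqxx addn1 -dr r0 addn0.
  apply: IH.
  - by rewrite size_set_nth r_size; apply/maxn_idPr.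
  - move=> i; rewrite nth_set_nth /= val_eqE -(dr i) /incr.
    by case: eqVneq => [->|_]; rewrite ?addn0 // addn1 addSn -addnS prednK.
  - apply: succn_inj; rewrite -[LHS]/(size ((a, b) :: E)) E_size /decr_nth.
    rewrite !sumn_ord size_set_nth (maxn_idPr _) ?r_size //.
    rewrite (bigD1 c) // [in RHS](bigD1 c) //= nth_set_nth /= eqxx.
    rewrite -addSn prednK //; congr (_ + _)%N; apply: eq_bigr => i i_neq.
    by rewrite nth_set_nth /= (negPf (_ : val i != val c)).
by rewrite graph_functional_cons !step -rmorphB.
Qed.

End Functional.

Lemma list_coloring (C : eqType) (E : seq (nat * nat)) (t : seq nat)
    (L : nat -> seq C) :
  (0 < size t)%N ->
  all (fun p => (p.1 < size t) && (p.2 < size t))%N E ->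
  sumn t = size E -> graph_coef E t != 0 ->
  (forall i, (i < size t)%N -> (nth 0%N t i < size (undup (L i)))%N) ->
  exists s : nat -> C,
    (forall i, (i < size t)%N -> s i \in L i) /\
    (forall p, p \in E -> s p.1 <> s p.2).
Proof.
move=> t_gt0 E_lt E_size coef_neq0 L_size.
pose n := size t.
have [x0 _] : exists x0, x0 \in L 0.
  by have := L_size 0%N t_gt0; case: (L 0%N) => [|x0 l] // _; exists x0; rewrite mem_head.
(* Indices in [P] turn the colours into distinct rational numbers. *)
pose P := undup (flatten [seq L i | i <- iota 0 n]).
(* One more colour than the exponent is kept, the number of points that [moment_weights] asks
   for. *)
pose K i := take (nth 0%N t i).+1 (undup (L i)).
have K_uniq i : uniq (K i) by rewrite take_uniq ?undup_uniq.
have KL i c : c \in K i -> c \in L i by move=> /mem_take; rewrite mem_undup.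
have KP (i : 'I_n) c : c \in K i -> c \in P.
  move=> /KL c_in; rewrite mem_undup; apply/flatten_mapP.
  by exists (i : nat); rewrite ?mem_iota /=.
have P_uniq : uniq P by rewrite undup_uniq.
have weights (i : 'I_n) : exists w : 'I_(size P) -> rat,
    (forall c, w c != 0 -> nth x0 P c \in K i) /\
    forall m, (m <= nth 0%N t i)%N ->
      \sum_(c < size P) w c * c%:R ^+ m = (m == nth 0%N t i)%N%:R.
  have [w w_moment] : exists w : rat -> rat, forall m, (m <= nth 0%N t i)%N ->
      \sum_(c <- [seq (index c P)%:R | c <- K i]) w c * c ^+ m =
      (m == nth 0%N t i)%N%:R.
    apply: moment_weights.
      rewrite map_inj_in_uniq ?K_uniq // => c c' /KP c_in /KP c'_in /eqP.
      by rewrite eqr_nat => /eqP /index_inj -> //.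
    by rewrite size_map size_takel // L_size.
  (* Weight 0 outside [K i] makes every point of nonzero weight a choice from the lists. *)
  exists (fun c => if nth x0 P c \in K i then w c%:R else 0); split.
    by move=> c; case: ifP => //; rewrite eqxx.
  move=> m /w_moment <-; rewrite big_map.
  have K_perm : perm_eq (K i) [seq c <- P | c \in K i].
    apply: uniq_perm; rewrite ?filter_uniq // => c; rewrite mem_filter.
    by case c_in: (c \in K i) => //=; rewrite (KP i).
  rewrite (perm_big _ K_perm) big_filter (big_nth x0) big_mkord [RHS]big_mkcond /=.
  apply: eq_bigr => c _; rewrite index_uniq //.
  by case: ifP; rewrite ?mul0r.
pose w i := projT1 (cid (weights i)).
have [w_supp w_moment] : (forall i c, w i c != 0 -> nth x0 P c \in K i) /\
    (forall (i : 'I_n) m, (m <= nth 0%N t i)%N ->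
      \sum_(c < size P) w i c * c%:R ^+ m = (m == nth 0%N t i)%N%:R).
  by split=> i; rewrite /w; case: cid => ? [].
have n_gt0 : (0 < n)%N by [].
pose E' := [seq (insubd (Ordinal n_gt0) p.1, insubd (Ordinal n_gt0) p.2) | p <- E].
have EE' : [seq (val p.1, val p.2) | p <- E'] = E.
  rewrite -map_comp -[RHS]map_id; apply/eq_in_map => -[a b] /(allP E_lt) /andP[/= a_lt b_lt].
  by rewrite !val_insubd a_lt b_lt.
have := @graph_functionalE n (size P) w t erefl w_moment E' (fun=> 0%N) t erefl.
rewrite EE' size_map => /(_ (fun=> erefl) (esym E_size)) coefE.
have : graph_functional w E' (fun=> 0%N) != 0 by rewrite coefE intr_eq0.
rewrite /graph_functional.
case: (boolP [exists s : {ffun 'I_n -> 'I_(size P)},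
   (\prod_i (w i (s i) * (s i)%:R ^+ 0)) *
    \prod_(p <- E') ((s p.1)%:R - (s p.2)%:R) != 0]); last first.
  move=> /existsPn all0; rewrite big1 ?eqxx // => s _.
  by apply/eqP; have := all0 s; rewrite negbK.
move=> /existsP[s]; rewrite mulf_eq0 negb_or => /andP[w_neq0 d_neq0] _.
have w_nz i : w i (s i) != 0.
  by move/prodf_neq0: w_neq0 => /(_ i isT); rewrite expr0 mulr1.
exists (fun i => nth x0 P (s (insubd (Ordinal n_gt0) i))); split.
  move=> i i_lt; apply: KL.
  by have := w_supp _ _ (w_nz (insubd (Ordinal n_gt0) i)); rewrite val_insubd i_lt.
move=> p p_in /eqP; rewrite nth_uniq // => /eqP s_eq.
move: d_neq0; rewrite prodf_seq_neq0 => /allP.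
move=> /(_ (insubd (Ordinal n_gt0) p.1, insubd (Ordinal n_gt0) p.2)).
by rewrite (map_f (fun p => (insubd _ p.1, insubd _ p.2))) // /= s_eq subrr eqxx => /(_ isT).
Qed.

(** * Computing the coefficient by sparse expansion *)

Fixpoint lex_lt (r r' : seq nat) : bool :=
  match r, r' with
  | a :: l, b :: l' => (a < b)%N || ((a == b) && lex_lt l l')
  | [::], _ :: _ => true
  | _, _ => false
  end.

(** A merge of lexicographically sorted sums, in which like terms meet and cancel. The expansion
    stays small enough to compute, whereas the recursion of [graph_coef] branches at every pair. *)
Fixpoint add_terms (l1 : seq (seq nat * int)) :
    seq (seq nat * int) -> seq (seq nat * int) :=
  if l1 is x1 :: l1' then
    fix add_terms1 l2 :=
      if l2 is x2 :: l2' then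
        if x1.1 == x2.1 then
          let c := x1.2 + x2.2 in
          if c == 0 then add_terms l1' l2' else (x1.1, c) :: add_terms l1' l2'
        else if lex_lt x1.1 x2.1 then x1 :: add_terms l1' l2
        else x2 :: add_terms1 l2'
      else l1
  else id.

(** When [drop] is set, [a] has no later edge, so only an exponent that falls to 0 can still
    contribute. *)
Definition decr_terms (sgn : int -> int) (a : nat) (drop : bool)
    (l : seq (seq nat * int)) : seq (seq nat * int) :=
  pmap (fun x => let k := nth 0%N x.1 a in
     if (0 < k)%N && (drop ==> (k == 1%N))
     then Some (decr_nth x.1 a, sgn x.2) else None) l.

Definition in_edge (a : nat) (p : nat * nat) := (a == p.1) || (a == p.2).

(* Terms in which a vertex without remaining edges keeps a positive exponent
   are discarded. *)
Fixpoint expand (E : seq (nat * nat)) (l : seq (seq nat * int)) : int :=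
  if E is (a, b) :: E' then
    let a_done := ~~ has (in_edge a) E' in
    let b_done := ~~ has (in_edge b) E' in
    let l1 := decr_terms id a a_done l in
    let l2 := decr_terms -%R b b_done l in
    expand E' [seq x <- add_terms l1 l2 |
      (a_done ==> (nth 0%N x.1 a == 0%N)) && (b_done ==> (nth 0%N x.1 b == 0%N))]
  else foldr (fun x s => if all (eq_op 0%N) x.1 then x.2 + s else s) 0 l.

Lemma graph_coef_unused E r a :
  ~~ has (in_edge a) E -> (0 < nth 0 r a)%N -> graph_coef E r = 0.
Proof.
elim: E r => [|[b c] E IH] r /=.
  move=> _ r_gt0; case: allP => // r0.
  have a_lt : (a < size r)%N.
    by rewrite ltnNge; apply/negP => /(nth_default 0%N) r0'; rewrite r0' in r_gt0.
  by have := r0 _ (mem_nth 0%N a_lt); rewrite eq_sym => /eqP r0'; rewrite r0' in r_gt0.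
rewrite !negb_or /in_edge /= => /andP[/andP[ab ac] a_notin] r_gt0.
by rewrite !IH ?if_same ?subrr // /decr_nth nth_set_nth /= ?(negPf ab) ?(negPf ac).
Qed.

Lemma sum_add_terms (f : seq nat -> int) l1 l2 :
  \sum_(x <- add_terms l1 l2) x.2 * f x.1 =
  \sum_(x <- l1) x.2 * f x.1 + \sum_(x <- l2) x.2 * f x.1.
Proof.
elim: l1 l2 => [|x1 l1 IH1] l2; first by rewrite big_nil add0r.
elim: l2 => [|x2 l2 IH2]; first by rewrite [in X in _ + X]big_nil addr0.
rewrite [add_terms _ _]/=.
case: eqVneq => [x12|_].
  have -> l : \sum_(x <- l) x.2 * f x.1 = \sum_(x <- l) x.2 * f x.1 by [].
  rewrite !big_cons addrACA x12 -mulrDl -IH1.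
  by case: eqVneq => [->|_]; rewrite ?mul0r ?add0r // big_cons /= -x12.
case: ifP => _; first by rewrite [LHS]big_cons IH1 [in RHS]big_cons addrA.
by rewrite [LHS]big_cons IH2 [in RHS](big_cons _ _ x2) addrCA.
Qed.

Lemma sum_decr_terms E (sgn : int -> int) a l (s : int) :
  (forall c, sgn c = s * c) ->
  \sum_(x <- decr_terms sgn a (~~ has (in_edge a) E) l) x.2 * graph_coef E x.1 =
  s * \sum_(x <- l) x.2 * (if (0 < nth 0 x.1 a)%N
                          then graph_coef E (decr_nth x.1 a) else 0).
Proof.
move=> sgnE; elim: l => [|x l IH]; first by rewrite !big_nil mulr0.
rewrite big_cons mulrDr -IH /=.
case: (posnP (nth 0%N x.1 a)) => [->|r_gt0] /=; first by rewrite !mulr0 add0r.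
case: implyP => [_|keep]; first by rewrite /oapp big_cons sgnE mulrA.
rewrite (@graph_coef_unused _ _ a) ?mulr0 ?add0r //.
  by case: (has _ _) keep => // -[].
rewrite /decr_nth nth_set_nth /= eqxx -subn1 subn_gt0 ltn_neqAle eq_sym r_gt0 andbT.
by apply/eqP => r1; apply: keep; rewrite r1.
Qed.

Lemma expandE E l :
  expand E l = \sum_(x <- l) x.2 * graph_coef E x.1.
Proof.
elim: E l => [|[a b] E IH] l /=.
  elim: l => [|x l IH] /=; first by rewrite big_nil.
  by rewrite big_cons IH; case: all; rewrite ?mulr1 ?mulr0 ?add0r.
rewrite IH big_filter big_mkcond /=.
rewrite (eq_bigr (fun x => x.2 * graph_coef E x.1)) => [|x _]; last first.
  case: ifPn => //; rewrite negb_and !negb_imply -!lt0n.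
  by case/orP => /andP[aE gt0]; rewrite (graph_coef_unused aE gt0) mulr0.
rewrite sum_add_terms (@sum_decr_terms _ _ _ _ 1); last by move=> c; rewrite mul1r.
rewrite (@sum_decr_terms _ _ _ _ (-1)); last by move=> c; rewrite mulN1r.
rewrite mul1r mulN1r -sumrB; apply: eq_bigr => x _.
by rewrite mulrBr.
Qed.

Lemma expand_coef E t : expand E [:: (t, 1)] = graph_coef E t.
Proof. by rewrite expandE big_seq1 mul1r. Qed.

End AlonTarsi.

(** * Recolouring elements of a graph *)

Section TotalColoring.
Variables (T : finType) (C : eqType).
Implicit Types (e : rel T) (A B : {set T}) (u v w : T).
Implicit Types (L : {set T} -> seq C) (D : {set {set T}}) (phi : {set T} -> C).

Definition deg e u := #|[set w | e u w]|.

(* A vertex u is represented by the singleton [set u; u], an edge uv by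
   [set u; v]. *)
Definition elem u v : {set T} := [set u; v].

Definition elements e : {set {set T}} :=
  edges e :|: [set elem u u | u in T].

(* Disjoint elements have a union of two vertices only if both are vertices. *)
Definition clash e A B : bool :=
  (A != B) && ((A :&: B != finset.set0) || (A :|: B \in edges e)).

Definition partial_coloring e L D phi :=
  (forall A, A \in elements e -> A \notin D -> phi A \in L A) /\
  (forall A B, A \in elements e -> B \in elements e -> A \notin D -> B \notin D ->
     clash e A B -> phi A <> phi B).

Definition colorable e L := exists phi, partial_coloring e L finset.set0 phi.

Definition residual e L D phi A : seq C :=
  [seq c <- L A | [forall B, [&& B \in elements e, B \notin D & clash e A B]
                             ==> (phi B != c)]].

Definition clashes e A := [set B in elements e | clash e A B].

Lemma elemC u v : elem u v = elem v u.
Proof. exact: finset.setUC. Qed.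

Lemma edgesP e A : reflect (exists u v, e u v /\ A = elem u v) (A \in edges e).
Proof.
rewrite finset.inE; apply: (iffP existsP) => [[u /existsP[v /andP[euv /eqP ->]]]|].
  by exists u, v.
by move=> [u [v [euv ->]]]; exists u; apply/existsP; exists v; rewrite euv eqxx.
Qed.

Lemma elementsP e A :
  reflect (exists u v, (u == v) || e u v /\ A = elem u v) (A \in elements e).
Proof.
apply: (iffP finset.setUP) => [[/edgesP[u [v [euv ->]]]|/imsetP[u _ ->]]|].
- by exists u, v; rewrite euv orbT.
- by exists u, u; rewrite eqxx.
- case=> u [v [/orP[/eqP ->|euv] ->]]; first by right; apply: imset_f.
  by left; apply/edgesP; exists u, v.
Qed.

Lemma elem_in u v w : (w \in elem u v) = (w == u) || (w == v).
Proof. by rewrite !finset.inE. Qed.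

Lemma vertex_element e u : elem u u \in elements e.
Proof. by apply/elementsP; exists u, u; rewrite eqxx. Qed.

Lemma edge_element e u v : e u v -> elem u v \in elements e.
Proof. by move=> euv; apply/elementsP; exists u, v; rewrite euv orbT. Qed.

Lemma clashC e A B : clash e A B = clash e B A.
Proof. by rewrite /clash eq_sym finset.setIC finset.setUC. Qed.

Lemma clash_share e A B w : A != B -> w \in A -> w \in B -> clash e A B.
Proof.
move=> AB wA wB; rewrite /clash AB; apply/orP; left; apply/set0Pn; exists w.
by rewrite finset.inE wA.
Qed.

Lemma clash_adjacent e u v : irreflexive e -> e u v -> clash e (elem u u) (elem v v).
Proof.
move=> e_irr euv; rewrite /clash /elem !finset.setUid; apply/andP; split.
  by apply: contraTneq euv => /finset.set1_inj ->; rewrite e_irr.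
by apply/orP; right; apply/edgesP; exists u, v.
Qed.

Lemma clash_cases e a b c d : symmetric e ->
  clash e (elem a b) (elem c d) ->
  [|| a == c, a == d, b == c | b == d] || [&& a == b, c == d & e a c].
Proof.
move=> e_sym /andP[_ /orP[/set0Pn[w] | /edgesP[u [v [euv AB]]]]].
  rewrite finset.inE !elem_in => /andP[/orP[/eqP ->|/eqP ->] /orP[]->];
  by rewrite ?orbT.
apply/orP; case: (boolP (_ || _)) => // ; first by left.
rewrite !negb_or => /and4P[ac ad bc bd]; right.
have disj : elem a b :&: elem c d = finset.set0.
  apply/setP => w; rewrite !finset.inE; apply/negbTE; rewrite negb_and !negb_or.
  by have [->|] := eqVneq w a; [rewrite ac ad | have [->|] := eqVneq w b; rewrite ?bc ?bd].
have := cardsUI (elem a b) (elem c d); rewrite AB disj cards0 !cards2 => card_eq.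
have [ab cd] : a == b /\ c == d.
  by move: card_eq; case: (u == v); case: (a == b); case: (c == d).
rewrite ab cd; move: AB; rewrite -(eqP ab) -(eqP cd) /elem !finset.setUid => /setP AB.
have := AB u; have := AB v; have := AB a; have := AB c; rewrite !finset.inE !eqxx ?orbT /=.
move=> /esym/orP[]/eqP cE /esym/orP[]/eqP aE; move: ac; rewrite cE aE ?eqxx //=.
by rewrite e_sym.
Qed.

(** A vertex conflicts with its d(u) neighbours and d(u) edges. An edge conflicts with d(u) - 1 and
    d(v) - 1 other edges and with its two ends. Both counts give the same formula. *)
Lemma card_clashes e u v : symmetric e -> irreflexive e ->
  (u == v) || e u v -> #|clashes e (elem u v)| <= deg e u + deg e v.
Proof.
move=> e_sym e_irr /orP[/eqP <-|euv].
  have sub : clashes e (elem u u) \subset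
     (fun w => elem w w) @: [set w | e u w] :|: elem u @: [set w | e u w].
    apply/fintype.subsetP => B; rewrite finset.inE => /andP[/elementsP[a [b [ab ->]]] clash_B].
    have neq := proj1 (andP clash_B).
    apply/finset.setUP; have /orP[share|/and3P[_ /eqP <- eua]] := clash_cases e_sym clash_B; last first.
      by left; apply: (imset_f (fun w => elem w w)); rewrite finset.inE.
    right; have {}share : (u == a) || (u == b) by move: share; case: (u == a); case: (u == b).
    move: neq ab; case/orP: share => /eqP <-.
      by case: (eqVneq u b) => [<-|_ _ /= eub]; rewrite ?eqxx //; apply: imset_f; rewrite finset.inE.
    rewrite [elem a u]elemC eq_sym (eq_sym a) (e_sym a).
    case: (eqVneq u a) => [<-|_ _ /= eua]; rewrite ?eqxx //.
    by apply: imset_f; rewrite finset.inE.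
  apply: leq_trans (subset_leq_card sub) _; apply: leq_trans (leq_card_setU _ _) _.
  by apply: leq_add; apply: leq_imset_card.
have evu : e v u by rewrite e_sym.
have sub : clashes e (elem u v) \subset
    (elem u @: ([set w | e u w] :\ v) :|: elem v @: ([set w | e v w] :\ u))
    :|: [set elem u u; elem v v].
  apply/fintype.subsetP => B; rewrite finset.inE => /andP[/elementsP[a [b [ab ->]]] clash_B].
  have neq := proj1 (andP clash_B).
  have /orP[share|/and3P[/eqP uv]] := clash_cases e_sym clash_B; last first.
    by rewrite uv e_irr in euv.
  have {share} [x [y [AB xy /orP[]/eqP xE]]] : exists x y,
      [/\ elem a b = elem x y, (x == y) || e x y & (x == u) || (x == v)].
    case/or4P: share => /eqP E; [exists a, b | exists b, a | exists a, b | exists b, a];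
    by split; rewrite ?[elem b a]elemC ?(eq_sym b) ?(e_sym b) // -E eqxx ?orbT.
  - move: neq xy; rewrite AB xE !finset.inE.
    have [<-|uy neq /= euy] := eqVneq u y; first by rewrite eqxx ?orbT.
    apply/orP; left; apply/orP; left; apply: imset_f.
    by rewrite !finset.inE euy andbT; apply: contraNneq neq => ->.
  - move: neq xy; rewrite AB xE !finset.inE.
    have [<-|vy neq /= evy] := eqVneq v y; first by rewrite eqxx ?orbT.
    apply/orP; left; apply/orP; right; apply: imset_f.
    by rewrite !finset.inE evy andbT; apply: contraNneq neq => ->; rewrite elemC.
apply: leq_trans (subset_leq_card sub) _.
have card_pred (x y : T) : e x y -> (#|[set w | e x w] :\ y|).+1 = deg e x.
  by move=> exy; rewrite /deg (cardsD1 y [set w | e x w]) finset.inE exy.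
apply: leq_trans (leq_card_setU _ _) _.
apply: leq_trans (leq_add (leq_card_setU _ _) (leqnn _)) _.
rewrite -(card_pred u v) // -(card_pred v u) // addSn addnS cards2.
rewrite -addn2; apply: leq_add; last by case: eqP.
by apply: leq_add; apply: leq_imset_card.
Qed.

Lemma residualP e L D phi A c :
  reflect (c \in L A /\ forall B, B \in elements e -> B \notin D -> clash e A B ->
             phi B <> c)
          (c \in residual e L D phi A).
Proof.
rewrite mem_filter andbC; apply: (iffP andP) => -[cL ok]; split=> //.
  move=> B Be BD AB; apply/eqP; have /forallP/(_ B) := ok.
  by rewrite Be BD AB.
apply/forallP => B; apply/implyP => /and3P[Be BD AB]; apply/eqP; exact: ok.
Qed.

Lemma size_residual e L D phi A :
  size (undup (L A)) <=
  size (undup (residual e L D phi A)) + #|clashes e A :\: D|.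
Proof.
pose s := [seq phi B | B <- enum (clashes e A :\: D)].
apply: (@leq_trans (size (undup (residual e L D phi A) ++ s))); last first.
  by rewrite size_cat size_map -cardE.
apply: uniq_leq_size => [|c]; first exact: undup_uniq.
rewrite !mem_undup mem_cat mem_undup => cL.
case: (boolP (c \in residual _ _ _ _ _)) => //= c_res.
apply/mapP; apply: contraNP c_res => no_B; apply/residualP; split=> // B Be BD AB phiB.
apply: no_B; exists B => //.
by rewrite mem_enum finset.in_setD BD finset.in_set Be.
Qed.

Lemma extend_selection e L phi (U : seq {set T}) (s : nat -> C) :
  uniq U -> partial_coloring e L [set A in U] phi ->
  (forall i, i < size U -> s i \in residual e L [set A in U] phi (nth finset.set0 U i)) ->
  (forall i j, i < j < size U ->
     clash e (nth finset.set0 U i) (nth finset.set0 U j) -> s i <> s j) ->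
  colorable e L.
Proof.
move=> U_uniq [phiL phiN] s_res s_clash.
have inU A : (A \notin [set A in U]) = (A \notin U) by rewrite finset.in_set.
pose psi A := if A \in U then s (index A U) else phi A.
have psiU A : A \in U -> psi A \in residual e L [set A in U] phi A.
  by move=> AU; rewrite /psi AU; have := s_res (index A U); rewrite index_mem nth_index // => ->.
have psiN A : A \notin U -> psi A = phi A by rewrite /psi => /negPf ->.
exists psi; split=> [A Ae _|A B Ae Be _ _].
  case: (boolP (A \in U)) => AU; first by have /residualP[] := psiU _ AU.
  by rewrite psiN //; apply: phiL; rewrite ?inU.
case: (boolP (A \in U)) => AU; case: (boolP (B \in U)) => BU.
- wlog lt : A B Ae Be AU BU / index A U < index B U.
    move=> IH AB; case: (ltngtP (index A U) (index B U)) => [lt|lt|].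
    + by apply: IH.
    + by move/esym; apply: IH => //; rewrite clashC.
    + by move=> eq; have E' := index_inj A AU BU eq; move: AB; rewrite /clash E' ?eqxx.
  move=> AB; rewrite /psi AU BU; apply: s_clash.
  + by rewrite lt index_mem.
  + by rewrite !nth_index.
- move=> AB; have /residualP[_ ok] := psiU _ AU.
  by rewrite (psiN _ BU); apply/nesym/ok; rewrite ?inU.
- move=> AB; have /residualP[_ ok] := psiU _ BU.
  by rewrite (psiN _ AU); apply/ok; rewrite ?inU // clashC.
- by move=> AB; rewrite !psiN //; apply: phiN; rewrite ?inU.
Qed.

Lemma extend_coloring e L phi (U : seq {set T}) (E : seq (nat * nat)) (t : seq nat) :
  uniq U -> 0 < size U ->
  partial_coloring e L [set A in U] phi ->
  size t = size U -> all (fun p => (p.1 < size t) && (p.2 < size t)) E ->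
  sumn t = size E -> graph_coef E t != 0%R ->
  (forall i j, i < j < size U -> clash e (nth finset.set0 U i) (nth finset.set0 U j) ->
     (i, j) \in E) ->
  (forall i, i < size U ->
     nth 0 t i < size (undup (residual e L [set A in U] phi (nth finset.set0 U i)))) ->
  colorable e L.
Proof.
move=> U_uniq U_gt0 phi_part t_size E_lt E_size coef E_clash t_res.
have [] := @list_coloring C E t
  (fun i => residual e L [set A in U] phi (nth finset.set0 U i)) _ E_lt E_size coef _.
- by rewrite t_size.
- by rewrite t_size.
rewrite t_size => s [s_res s_E]; apply: (extend_selection U_uniq phi_part s_res).
by move=> i j ij /(E_clash _ _ ij) /s_E.
Qed.

End TotalColoring.

(** * Symbolic configurations and minimal counterexamples *)

Definition mem_sym (s : seq (nat * nat)) (a b : nat) := ((a, b) \in s) || ((b, a) \in s).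

Definition symb_clash (adj : seq (nat * nat)) (p q : nat * nat) : bool :=
  (p != q) &&
  ([|| p.1 == q.1, p.1 == q.2, p.2 == q.1 | p.2 == q.2] ||
   [&& p.1 == p.2, q.1 == q.2 & mem_sym adj p.1 q.1]).

Definition symb_edges adj (U : seq (nat * nat)) : seq (nat * nat) :=
  [seq p <- [seq (i, j) | i <- iota 0 (size U), j <- iota 0 (size U)] |
    (p.1 < p.2) && symb_clash adj (nth (0, 0) U p.1) (nth (0, 0) U p.2)].

Definition symb_deg adj (U : seq (nat * nat)) (p : nat * nat) : nat :=
  count (symb_clash adj p) U.

(* [U] lists the elements to recolour: (a, a) is the a-th named vertex and
   (a, b), with a < b, an edge. *)
Definition symb_config (m : nat) (adj nonadj U : seq (nat * nat)) : bool :=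
  [&& uniq U, all (fun p => p.1 <= p.2 < m) U, has (fun p => p.1 != p.2) U,
      all (fun p => (p.1 == p.2) ||
             mem_sym adj p.1 p.2 && (((p.1, p.1) \in U) || ((p.2, p.2) \in U))) U &
      all (fun p => all (fun q => [&& p.1 == p.2, q.1 == q.2 & p.1 != q.1] ==>
             mem_sym adj p.1 q.1 || mem_sym nonadj p.1 q.1) U) U].

(** The exponents [t] are the certificate. The graph polynomial is homogeneous, so they have to sum
    to the number of conflicts. *)
Definition symb_reducible (m : nat) (adj nonadj U : seq (nat * nat)) (t : seq nat) : bool :=
  [&& symb_config m adj nonadj U, size t == size U, sumn t == size (symb_edges adj U) &
      expand (symb_edges adj U) [:: (t, 1%R)] != 0%R].

Section Critical.
Variables (T : finType) (C : eqType).
Implicit Types (e : rel T) (A B : {set T}) (u v w : T).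
Implicit Types (L : {set T} -> seq C) (D : {set {set T}}) (phi : {set T} -> C).

(** Minimality concerns edges only: subgraphs keep all vertices, the lists and [k], so an order of
    the vertices serves all of them. *)
Record critical e L (k : nat) : Prop := Critical {
  crit_sym : symmetric e;
  crit_irr : irreflexive e;
  crit_k : 6 <= k;
  crit_deg : forall u, deg e u < k;
  crit_list : forall A, A \in elements e -> k <= size (undup (L A));
  crit_min : forall e', symmetric e' -> subrel e' e ->
    (exists u v, e u v && ~~ e' u v) -> colorable e' L;
  crit_not : ~ colorable e L
}.

(** Deleting an edge cancels the conflict between its ends. A colouring of the smaller graph is
    therefore usable in [e] only if one end of every deleted edge is erased too. *)
Lemma delete_coloring e L k D : critical e L k ->
  (exists u v, e u v /\ elem u v \in D) ->
  (forall u v, e u v -> elem u v \in D -> (elem u u \in D) || (elem v v \in D)) ->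
  exists phi, partial_coloring e L D phi.
Proof.
move=> crit [u0 [v0 [e0 D0]]] D_cover; have e_sym := crit_sym crit.
pose e' := [rel u v | e u v && (elem u v \notin D)].
have e'_sym : symmetric e' by move=> u v; rewrite /= e_sym elemC.
have [] := @crit_min _ _ _ crit e' e'_sym.
- by move=> u v /andP[].
- by exists u0, v0; rewrite /= e0 D0.
move=> phi [phiL phiN]; exists phi.
have sub A : A \in elements e -> A \notin D -> A \in elements e'.
  case/elementsP => u [v [/orP[/eqP ->|euv] ->]] AD; first exact: vertex_element.
  by apply: edge_element; rewrite /= euv.
split=> [A Ae AD | A B Ae Be AD BD AB].
  by apply: phiL; [exact: sub | rewrite finset.in_set0].
apply: phiN; rewrite ?finset.in_set0 //; try exact: sub.
have neq : A != B by case/andP: AB.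
case/elementsP: Ae neq AB AD => a [b [_ ->]]; case/elementsP: Be BD => c [d [_ ->]] BD neq AB AD.
case/orP: (clash_cases e_sym AB) => [|/and3P[/eqP ab /eqP cd eac]].
  by case/or4P => /eqP E; [apply: (@clash_share _ _ _ _ a) | apply: (@clash_share _ _ _ _ a)
    | apply: (@clash_share _ _ _ _ b) | apply: (@clash_share _ _ _ _ b)];
    rewrite // ?elem_in ?E ?eqxx ?orbT.
rewrite -ab -cd in AD BD *; apply: clash_adjacent; first by move=> x; rewrite /= (crit_irr crit).
rewrite /= eac; apply/negP => /(D_cover _ _ eac).
by rewrite (negPf AD) (negPf BD).
Qed.

Lemma elem_inj a b c d : elem a b = elem c d :> {set T} ->
  (a = c /\ b = d) \/ (a = d /\ b = c).
Proof.
move=> /setP E; have := E a; have := E b; have := E c; have := E d.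
rewrite !elem_in !eqxx ?orbT /=.
move=> /orP[]/eqP ? /orP[]/eqP ? /esym/orP[]/eqP ? /esym/orP[]/eqP ?;
  by [left; split; congruence | right; split; congruence].
Qed.

Section Configuration.
Variables (e : rel T) (L : {set T} -> seq C) (k : nat).
Hypothesis crit : critical e L k.
Variables (x0 : T) (v : seq T) (adj nonadj U : seq (nat * nat)).
Hypotheses (v_uniq : uniq v)
  (adj_e : all (fun p => e (nth x0 v p.1) (nth x0 v p.2)) adj)
  (nonadj_e : all (fun p => ~~ e (nth x0 v p.1) (nth x0 v p.2)) nonadj)
  (U_config : symb_config (size v) adj nonadj U).

Let e_sym : symmetric e := crit_sym crit.
Let e_irr : irreflexive e := crit_irr crit.
Let x i := nth x0 v i.

Definition config_elem (p : nat * nat) : {set T} := elem (nth x0 v p.1) (nth x0 v p.2).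

Let U_uniq : uniq U. Proof. by case/and5P: U_config. Qed.
Let U_le p : p \in U -> p.1 <= p.2 < size v.
Proof. by case/and5P: U_config => _ /allP U_le _ _ _ /U_le. Qed.
Let U_adj p : p \in U ->
  (p.1 == p.2) || mem_sym adj p.1 p.2 && (((p.1, p.1) \in U) || ((p.2, p.2) \in U)).
Proof. by case/and5P: U_config => _ _ _ /allP U_adj _ /U_adj. Qed.

Let x_eq i j : i < size v -> j < size v -> (x i == x j) = (i == j).
Proof. by move=> i_lt j_lt; rewrite nth_uniq. Qed.

Let U_lt p : p \in U -> p.1 < size v /\ p.2 < size v.
Proof. by move=> /U_le/andP[le lt]; split=> //; apply: leq_ltn_trans lt. Qed.

Lemma config_elem_inj : {in U &, injective config_elem}.
Proof.
move=> [a b] [c d] pU qU /elem_inj E.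
have [/= a_lt b_lt] := U_lt pU; have [/= c_lt d_lt] := U_lt qU.
have /andP[/= ab _] := U_le pU; have /andP[/= cd _] := U_le qU.
have {E} [[/eqP + /eqP]|[/eqP + /eqP]] := E; rewrite /= !x_eq // => /eqP E1 /eqP E2.
  by rewrite E1 E2.
have {}ab : a = b by apply/eqP; rewrite eqn_leq ab E1 E2.
by rewrite E1 E2 in ab *; rewrite ab.
Qed.

Let adjP a b : mem_sym adj a b -> e (x a) (x b).
Proof. by case/orP => /(allP adj_e) //=; rewrite e_sym. Qed.

Lemma config_clash p q : p \in U -> q \in U ->
  clash e (config_elem p) (config_elem q) = symb_clash adj p q.
Proof.
move=> pU qU; have [p1 p2] := U_lt pU; have [q1 q2] := U_lt qU.
apply/idP/idP => [pq|/andP[neq]].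
  have neq : p != q by apply: contraTneq pq => ->; rewrite /clash eqxx.
  rewrite /symb_clash neq /=; have := clash_cases e_sym pq; rewrite !x_eq //.
  case/orP => [->//|/and3P[pv qv epq]] /=; apply/orP.
  case: (eqVneq p.1 q.1) => [|neq1] /=; first by left.
  right; rewrite pv qv /=.
  have /allP/(_ _ qU)/implyP : all (fun q => [&& p.1 == p.2, q.1 == q.2 & p.1 != q.1] ==>
      mem_sym adj p.1 q.1 || mem_sym nonadj p.1 q.1) U.
    by case/and5P: U_config => _ _ _ _ /allP/(_ _ pU).
  rewrite pv qv neq1 => /(_ isT).
  case/orP => // nonadj_pq; move: epq.
  by case/orP: nonadj_pq => /(allP nonadj_e) /= /negPf; rewrite -?(e_sym (x p.1)) => ->.
have neq_el : config_elem p != config_elem q.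
  by apply: contraNneq neq => /(config_elem_inj pU qU) ->.
case/orP => [|/and3P[/eqP pv /eqP qv /adjP epq]].
  by case/or4P => /eqP E; [apply: (@clash_share _ _ _ _ (x p.1))
    | apply: (@clash_share _ _ _ _ (x p.1)) | apply: (@clash_share _ _ _ _ (x p.2))
    | apply: (@clash_share _ _ _ _ (x p.2))];
    rewrite // elem_in E ?eqxx ?orbT.
by rewrite /config_elem -pv -qv; apply: clash_adjacent.
Qed.

Let D := [set A in map config_elem U].

Let inD p : p \in U -> config_elem p \in D.
Proof. by move=> pU; rewrite finset.in_set map_f. Qed.

Let U_el A : A \in map config_elem U -> A \in elements e.
Proof.
case/mapP => p /U_adj/orP[/eqP E|/andP[/adjP epq _]] ->; last exact: edge_element.
by rewrite /config_elem E vertex_element.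
Qed.

Lemma config_uniq : uniq (map config_elem U).
Proof. by rewrite map_inj_in_uniq //; apply: config_elem_inj. Qed.

Lemma config_coloring : exists phi, partial_coloring e L D phi.
Proof.
apply: (delete_coloring crit).
  have /hasP[p pU neq] : has (fun p => p.1 != p.2) U by case/and5P: U_config.
  exists (x p.1), (x p.2); split; last exact: inD.
  by have := U_adj pU; rewrite (negPf neq) => /andP[/adjP].
move=> a b eab; rewrite finset.in_set => /mapP[p pU ab].
case/orP: (U_adj pU) => [/eqP E|/andP[_ pp]].
  by move: ab; rewrite /config_elem E => /elem_inj [][ab ab']; move: eab; rewrite ab ab' ?e_irr.
have {}pp : (config_elem (p.1, p.1) \in D) || (config_elem (p.2, p.2) \in D).
  by case/orP: pp => /inD ->; rewrite ?orbT.
by case: (elem_inj ab) => -[-> ->]; rewrite // orbC.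
Qed.

(** Conflicting elements listed in [U] are erased and forbid nothing; each of the others forbids at
    most one colour. *)
Lemma config_residual phi p : p \in U ->
  k + symb_deg adj U p <=
  size (undup (residual e L D phi (config_elem p))) + (deg e (x p.1) + deg e (x p.2)).
Proof.
move=> pU.
have pe : (x p.1 == x p.2) || e (x p.1) (x p.2).
  by case/orP: (U_adj pU) => [/eqP ->|/andP[/adjP ->]]; rewrite ?eqxx ?orbT.
have big := @crit_list _ _ _ crit (config_elem p) (U_el (map_f config_elem pU)).
have := card_clashes e_sym e_irr pe.
have := size_residual e L D phi (config_elem p).
have -> : #|clashes e (elem (x p.1) (x p.2))| =
   #|clashes e (config_elem p) :&: D| + #|clashes e (config_elem p) :\: D| by rewrite cardsID.
have : symb_deg adj U p <= #|clashes e (config_elem p) :&: D|.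
  rewrite /symb_deg -size_filter.
  have -> : size [seq q <- U | symb_clash adj p q] =
      size (map config_elem [seq q <- U | symb_clash adj p q]) by rewrite size_map.
  rewrite cardE; apply: uniq_leq_size => [|A /mapP[q]].
    rewrite map_inj_in_uniq ?filter_uniq // => a b.
    by rewrite !mem_filter => /andP[_ aU] /andP[_ bU]; apply: config_elem_inj.
  rewrite mem_filter => /andP[pq qU] ->; rewrite mem_enum finset.in_setI inD //.
  by rewrite andbT finset.in_set U_el ?map_f // config_clash.
move: big; move: (#|_ :&: D|) (#|_ :\: D|) (symb_deg _ _ _) => a b c.
move: (deg _ (x p.1)) (deg _ (x p.2)) (size _) (size _) => d d' g h.
lia.
Qed.

Lemma mem_symb_edges i j : ((i, j) \in symb_edges adj U) =
  [&& i < j, i < size U, j < size U & symb_clash adj (nth (0, 0) U i) (nth (0, 0) U j)].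
Proof.
rewrite mem_filter /= -andbA; congr (_ && _); rewrite andbC [RHS]andbA; congr (_ && _).
apply/allpairsP/andP => [[[a b] [/=]]|[i_lt j_lt]].
  by rewrite !mem_iota => + + [-> ->].
by exists (i, j); rewrite !mem_iota.
Qed.

Lemma config_elem_nth i : i < size U ->
  nth finset.set0 (map config_elem U) i = config_elem (nth (0, 0) U i).
Proof. by move=> i_lt; rewrite (nth_map (0, 0)). Qed.

Lemma clash_symb_edges i j : i < j < size (map config_elem U) ->
  clash e (nth finset.set0 (map config_elem U) i) (nth finset.set0 (map config_elem U) j) ->
  (i, j) \in symb_edges adj U.
Proof.
rewrite size_map => /andP[ij j_lt]; have i_lt := ltn_trans ij j_lt.
by rewrite !config_elem_nth // config_clash ?mem_nth // mem_symb_edges ij i_lt j_lt.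
Qed.

End Configuration.

Lemma reducible e L k (x0 : T) (v : seq T) adj nonadj U t :
  critical e L k -> uniq v ->
  all (fun p => e (nth x0 v p.1) (nth x0 v p.2)) adj ->
  all (fun p => ~~ e (nth x0 v p.1) (nth x0 v p.2)) nonadj ->
  symb_reducible (size v) adj nonadj U t ->
  (forall i, i < size U -> let p := nth (0, 0) U i in
     nth 0 t i + (deg e (nth x0 v p.1) + deg e (nth x0 v p.2)) <
     k + symb_deg adj U p) ->
  False.
Proof.
move=> crit v_uniq adj_e nonadj_e.
case/and4P => U_config /eqP t_size /eqP t_sum t_coef t_lt.
apply: (crit_not crit).
have [phi phi_part] := config_coloring crit adj_e U_config.
apply: (@extend_coloring _ _ e L phi (map (config_elem x0 v) U) (symb_edges adj U) t) => //.
- exact: (config_uniq _ v_uniq U_config).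
- by case/and5P: U_config => _ _; case: (U).
- by rewrite size_map.
- by apply/allP => -[i j]; rewrite mem_symb_edges t_size /= => /and4P[_ -> ->].
- by rewrite -expand_coef.
- exact: (clash_symb_edges crit v_uniq adj_e nonadj_e U_config).
- move=> i; rewrite size_map => i_lt; rewrite config_elem_nth //.
  have := config_residual crit v_uniq adj_e nonadj_e U_config phi (mem_nth (0, 0) i_lt).
  have := t_lt i i_lt => /=.
  move: (symb_deg _ _ _) (size (undup _)) (nth 0 t i) => a b c.
  move: (deg _ _) (deg _ _) => d d'; lia.
Qed.

End Critical.

(** * Reducible configurations *)

Section Reductions.
Variables (T : finType) (C : eqType).
Implicit Types (e : rel T) (u v w x y : T).

Lemma nbr2 e u x y w : deg e u = 2 -> x != y -> e u x -> e u y -> e u w ->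
  w \in [:: x; y].
Proof.
move=> du xy ux uy uw.
have sub : [set x; y] \subset [set s | e u s].
  by apply/fintype.subsetP => s; rewrite !finset.inE => /orP[]/eqP ->.
have /eqP/setP/(_ w) : [set x; y] == [set s | e u s].
  by rewrite eqEcard sub /= -/(deg e u) du cards2 xy.
by rewrite !finset.inE uw.
Qed.

Lemma nbr3 e u x y z w : deg e u = 3 -> uniq [:: x; y; z] ->
  e u x -> e u y -> e u z -> e u w -> w \in [:: x; y; z].
Proof.
move=> du; rewrite /= !inE negb_or !andbT => /andP[/andP[xy xz] yz] ux uy uz uw.
have sub : [set x; y; z] \subset [set s | e u s].
  by apply/fintype.subsetP => s; rewrite !finset.inE => /orP[/orP[]|]/eqP ->.
have card3 : #|[set x; y; z]| = 3.
  by rewrite finset.setUC cardsU1 cards2 !finset.inE negb_or ![z == _]eq_sym xz yz xy.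
have /eqP/setP/(_ w) : [set x; y; z] == [set s | e u s].
  by rewrite eqEcard sub /= -/(deg e u) du card3.
by rewrite !finset.inE uw orbA.
Qed.

(** The arguments are listed in the order in which they will lie on the circle, where the edges xv
    and uy cross. The record itself is symmetric in x and y and in u and v. *)
Record gadget e x u v y : Prop := Gadget {
  gad_uniq : uniq [:: u; v; x; y];
  gad_uv : e u v; gad_ux : e u x; gad_uy : e u y; gad_vx : e v x; gad_vy : e v y;
  gad_du : deg e u = 3; gad_dv : deg e v = 3
}.

Lemma gadget_swap e x u v y : gadget e x u v y -> gadget e y u v x.
Proof.
move=> [uq uv ux uy vx vy du dv]; split=> //.
by move: uq; rewrite /= !inE !negb_or (eq_sym y) => /and4P[/and3P[-> -> ->] /andP[-> ->] ->].
Qed.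

Variables (e : rel T) (L : {set T} -> seq C) (k : nat).
Hypothesis crit : critical e L k.

Let e_sym : symmetric e := crit_sym crit.
Let e_irr : irreflexive e := crit_irr crit.
Let k6 : 6 <= k := crit_k crit.
Let deg_lt u : deg e u < k := crit_deg crit u.

Lemma edge_neq u v : e u v -> u != v.
Proof. by apply: contraTneq => ->; rewrite e_irr. Qed.

(** Erase u and uv. The edge sees at most k - 1 coloured elements; afterwards u sees at most 4,
    fewer than its k colours. *)
Lemma edge_deg u v : e u v -> deg e u <= 2 -> k < deg e u + deg e v.
Proof.
move=> euv du; rewrite ltnNge; apply/negP => le_k.
have uq : uniq [:: u; v] by rewrite /= inE (edge_neq euv).
have adj_e : all (fun p => e (nth u [:: u; v] p.1) (nth u [:: u; v] p.2)) [:: (0, 1)].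
  by rewrite /= euv.
apply: (reducible crit uq adj_e (erefl : all _ [::])
          (U := [:: (0, 0); (0, 1)]) (t := [:: 1; 0])); first by vm_compute.
by case=> [|[|//]] _ /=; rewrite /symb_deg /=; lia.
Qed.

Lemma edge_deg2 u v : e u v -> deg e u <= 2 -> 5 <= deg e v.
Proof. by move=> euv du; have := edge_deg euv du; move: k6; lia. Qed.

Lemma edge_deg_ge2 u v : e u v -> 2 <= deg e u.
Proof.
move=> euv; rewrite ltnNge; apply/negP => du.
by have := edge_deg euv (leqW du); have := deg_lt v; lia.
Qed.

(** The edges of the 4-cycle u v a b keep two colours each even if v and b have degree k - 1, and
    even cycles are 2-choosable. The vertices u and a see only four elements and come last. *)
Lemma no_double_2path u v a b : u != a -> v != b -> e u v -> e u b -> e a v -> e a b ->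
  deg e u = 2 -> deg e a = 2 -> False.
Proof.
move=> ua vb uv ub av ab du da.
have n_ua : ~~ e u a.
  by apply/negP => /edge_deg2; rewrite du da => /(_ isT).
have uq : uniq [:: u; v; a; b].
  rewrite /= !inE !negb_or ua vb (edge_neq uv) (edge_neq ub) (edge_neq ab).
  by rewrite eq_sym (edge_neq av).
have adj_e : all (fun p => e (nth u [:: u; v; a; b] p.1) (nth u [:: u; v; a; b] p.2))
    [:: (0, 1); (0, 3); (1, 2); (2, 3)] by rewrite /= uv ub e_sym av ab.
have nonadj_e : all (fun p => ~~ e (nth u [:: u; v; a; b] p.1) (nth u [:: u; v; a; b] p.2))
    [:: (0, 2)] by rewrite /= n_ua.
apply: (reducible crit uq adj_e nonadj_e
          (U := [:: (0, 0); (0, 1); (0, 3); (2, 2); (1, 2); (2, 3)])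
          (t := [:: 2; 1; 1; 2; 1; 1])); first by vm_compute.
move: (deg_lt v) (deg_lt b) k6 du da; clear => db dv k6 du da.
by case=> [|[|[|[|[|[|//]]]]]] _ /=; rewrite /symb_deg /=; lia.
Qed.

(** Both certificates erase the two middles and all five edges. The first works when d(x) is at most
    k - 2, the second when k is at least 7. *)
Lemma gadget_ends x u v y : gadget e x u v y -> k = 6 /\ deg e x = 5.
Proof.
move=> [uq uv ux uy vx vy du dv].
have adj_e : all (fun p => e (nth u [:: u; v; x; y] p.1) (nth u [:: u; v; x; y] p.2))
  [:: (0, 1); (0, 2); (0, 3); (1, 2); (1, 3)] by rewrite /= uv ux uy vx vy.
have dx_lt := deg_lt x; have dy_lt := deg_lt y.
have dx : k <= deg e x + 1.
  rewrite leqNgt; apply/negP => dx.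
  apply: (reducible crit uq adj_e (erefl : all _ [::])
     (U := [:: (0, 0); (0, 2); (1, 1); (0, 3); (1, 2); (1, 3); (0, 1)])
     (t := [:: 2; 2; 3; 0; 2; 1; 5])); first by vm_compute.
  move: k6 du dv dx dx_lt dy_lt; clear => k6 du dv dx dx_lt dy_lt.
  by case=> [|[|[|[|[|[|[|//]]]]]]] _ /=; rewrite /symb_deg /=; lia.
have k_le : k <= 6.
  rewrite leqNgt; apply/negP => k7.
  apply: (reducible crit uq adj_e (erefl : all _ [::])
     (U := [:: (0, 0); (0, 2); (1, 1); (0, 3); (1, 2); (1, 3); (0, 1)])
     (t := [:: 2; 1; 4; 1; 1; 1; 5])); first by vm_compute.
  move: k7 du dv dx_lt dy_lt; clear => k7 du dv dx_lt dy_lt.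
  by case=> [|[|[|[|[|[|[|//]]]]]]] _ /=; rewrite /symb_deg /=; lia.
by move: k6; lia.
Qed.


(** With k = 6 and numerical degree bounds [d], the inequalities on list sizes become part of the
    computation. *)
Lemma reducible6 (x0 : T) (v : seq T) adj nonadj U t (d : seq nat) :
  k = 6 -> uniq v ->
  all (fun p => e (nth x0 v p.1) (nth x0 v p.2)) adj ->
  all (fun p => ~~ e (nth x0 v p.1) (nth x0 v p.2)) nonadj ->
  all (fun i => deg e (nth x0 v i) <= nth 0 d i) (iota 0 (size v)) ->
  symb_reducible (size v) adj nonadj U t &&
  all (fun i => let p := nth (0, 0) U i in
         nth 0 t i + (nth 0 d p.1 + nth 0 d p.2) < 6 + symb_deg adj U p)
      (iota 0 (size U)) ->
  False.
Proof.
move=> k_eq v_uniq adj_e nonadj_e d_le /andP[red t_lt].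
apply: (reducible crit v_uniq adj_e nonadj_e red).
move=> i i_lt; set p := nth _ U i.
have := allP t_lt i; rewrite mem_iota => /(_ i_lt) t_lt_i; rewrite k_eq /=.
apply: leq_ltn_trans t_lt_i; rewrite -/p.
have pU : p \in U by rewrite mem_nth.
have [p1 p2] : p.1 < size v /\ p.2 < size v.
  have /andP[/and3P[_ /allP/(_ _ pU)/andP[p12 p2] _] _] := red; split=> //.
  exact: leq_ltn_trans p2.
by rewrite leq_add2l; apply: leq_add; apply: (allP d_le); rewrite mem_iota.
Qed.

Lemma gadget_nbr x u v y w : gadget e x u v y -> e u w -> w \in [:: v; x; y].
Proof.
move=> [uq uv ux uy vx vy du dv]; apply: nbr3 => //.
by move: uq; rewrite cons_uniq => /andP[].
Qed.

Lemma gadget_flip x u v y : gadget e x u v y -> gadget e x v u y.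
Proof.
move=> [uq uv ux uy vx vy du dv]; split=> //; last by rewrite e_sym.
by move: uq; rewrite /= !inE !negb_or (eq_sym v u) => /and4P[/and3P[-> -> ->] /andP[-> ->] ->].
Qed.

Lemma gadget_nonadj x u v y w : gadget e x u v y -> w \notin [:: v; x; y] -> ~~ e u w.
Proof. by move=> gad; apply: contra; apply: gadget_nbr gad. Qed.

Lemma deg_neq a b : deg e a != deg e b -> a != b.
Proof. by apply: contraNneq => ->. Qed.

Lemma gadget_no_2nbr t u v y w : gadget e t u v y -> e t w -> deg e w = 2 -> False.
Proof.
move=> gad tw dw; have [k_eq dt] := gadget_ends gad.
have [_ dy] := gadget_ends (gadget_swap gad).
have gad' := gadget_flip gad; have [uq uv ut uy vt vy du dv] := gad.
have w_neq : all (fun s => w != s) [:: u; v; t; y].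
  by apply/allP => s; rewrite !inE => /or4P[]/eqP ->; apply: deg_neq; rewrite dw ?du ?dv ?dt ?dy.
have uq5 : uniq [:: w; u; v; t; y].
  by rewrite cons_uniq uq andbT; apply/negP => /(allP w_neq); rewrite eqxx.
have := w_neq; rewrite /= andbT => /and4P[wu wv wt wy].
apply: (@reducible6 t [:: w; u; v; t; y] [:: (1, 2); (1, 3); (1, 4); (2, 3); (2, 4); (0, 3)]
  [:: (0, 1); (0, 2)]
  [:: (0, 0); (0, 3); (3, 3); (1, 1); (1, 3); (1, 4); (2, 4); (2, 2); (2, 3); (1, 2)]
  [:: 2; 1; 1; 3; 3; 1; 1; 4; 3; 5] [:: 2; 3; 3; 5; 5] k_eq uq5).
- by rewrite /= uv ut uy vt vy e_sym tw.
- rewrite /= ![e w _]e_sym (gadget_nonadj gad) ?(gadget_nonadj gad') //;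
  by rewrite !inE !negb_or ?wu ?wv wt wy.
- by rewrite /= dt du dv dy dw.
- by vm_compute.
Qed.

Lemma uniq_deg_cat (s1 s2 : seq T) m n : m != n -> uniq s1 -> uniq s2 ->
  all (fun x => deg e x == m) s1 -> all (fun x => deg e x == n) s2 -> uniq (s1 ++ s2).
Proof.
move=> mn u1 u2 /allP d1 /allP d2; rewrite cat_uniq u1 u2 andbT.
by apply/hasPn => x x2; apply: contra mn => x1; rewrite -(eqP (d1 _ x1)) (eqP (d2 _ x2)).
Qed.

(** The neighbourhoods of the four middles are completely known, so two distinct gadgets at [t] have
    disjoint, mutually nonadjacent pairs of middles. This fixes the conflict graph of the joint
    configuration. *)
Lemma gadget_end_unique t u v y a b z :
  gadget e t u v y -> gadget e t a b z -> a \in [:: u; v].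
Proof.
move=> gad1 gad2; apply/negPn/negP; rewrite !inE negb_or => /andP[au av].
have [k_eq dt] := gadget_ends gad1.
have [_ dy] := gadget_ends (gadget_swap gad1); have [_ dz] := gadget_ends (gadget_swap gad2).
have gad1' := gadget_flip gad1; have gad2' := gadget_flip gad2.
have [uq1 uv ut uy vt vy du dv] := gad1; have [uq2 ab at' az bt bz da db] := gad2.
have neq35 x w : deg e x = 5 -> deg e w = 3 -> w != x.
  by move=> dx dw; apply: deg_neq; rewrite dx dw.
have [at_ ay] := (neq35 t a dt da, neq35 y a dy da).
have [bt_ bY] := (neq35 t b dt db, neq35 y b dy db).
have bu : b != u.
  apply: contraNneq av => bu; move: ab; rewrite e_sym bu => /(gadget_nbr gad1).
  by rewrite !inE (negPf at_) (negPf ay) !orbF.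
have bv : b != v.
  apply: contraNneq au => bv; move: ab; rewrite e_sym bv => /(gadget_nbr gad1').
  by rewrite !inE (negPf at_) (negPf ay) !orbF.
have nua : ~~ e u a by apply: (gadget_nonadj gad1); rewrite !inE !negb_or av at_ ay.
have nub : ~~ e u b by apply: (gadget_nonadj gad1); rewrite !inE !negb_or bv bt_ bY.
have nva : ~~ e v a by apply: (gadget_nonadj gad1'); rewrite !inE !negb_or au at_ ay.
have nvb : ~~ e v b by apply: (gadget_nonadj gad1'); rewrite !inE !negb_or bu bt_ bY.
have uq3 : uniq [:: u; v; a; b].
  rewrite /= !inE !negb_or ![_ == a]eq_sym ![_ == b]eq_sym au av bu bv (edge_neq uv).
  by rewrite eq_sym (edge_neq ab).
have ty : t != y by move: uq1; rewrite /= !inE => /and4P[].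
have tz : t != z by move: uq2; rewrite /= !inE => /and4P[].
have all3 : all (fun x => deg e x == 3) [:: u; v; a; b] by rewrite /= du dv da db.
(* Gadgets that share both ends have a different conflict graph and need their own certificate. *)
have [yz|yz] := eqVneq y z.
  rewrite -{z dz tz}yz in gad2 gad2' uq2 az bz.
  have uq6 : uniq ([:: t; y] ++ [:: u; v; a; b]).
    by apply: (@uniq_deg_cat _ _ 5 3); rewrite //= ?inE ?ty ?dt ?dy.
  apply: (@reducible6 t _
    [:: (2, 3); (0, 2); (1, 2); (0, 3); (1, 3); (4, 5); (0, 4); (0, 5); (1, 4); (1, 5)]
    [:: (2, 4); (2, 5); (3, 4); (3, 5)]
    [:: (2, 2); (3, 3); (2, 3); (1, 2); (1, 3); (0, 2); (0, 3); (1, 4); (0, 4);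
        (4, 4); (5, 5); (4, 5); (1, 5); (0, 5); (0, 0)]
    [:: 4; 4; 4; 0; 3; 2; 2; 2; 4; 3; 4; 5; 3; 4; 2] [:: 5; 5; 3; 3; 3; 3] k_eq uq6).
  - by rewrite /= uv ab ![e t _]e_sym ut vt at' bt ![e y _]e_sym uy vy az bz.
  - by rewrite /= nua nub nva nvb.
  - by rewrite /= dt du dv dy da db.
  - by vm_compute.
have uq7 : uniq ([:: z; t; y] ++ [:: u; v; a; b]).
  by apply: (@uniq_deg_cat _ _ 5 3); rewrite //= ?inE ?negb_or ?ty ?[z == _]eq_sym ?tz ?yz ?dt ?dy ?dz.
apply: (@reducible6 t _
    [:: (3, 4); (1, 3); (2, 3); (1, 4); (2, 4); (5, 6); (1, 5); (1, 6); (0, 5); (0, 6)]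
    [:: (3, 5); (3, 6); (4, 5); (4, 6)]
    [:: (2, 3); (2, 4); (3, 4); (3, 3); (4, 4); (1, 3); (1, 4); (1, 1); (5, 5); (1, 5);
        (0, 5); (0, 6); (6, 6); (5, 6); (1, 6)]
    [:: 0; 1; 5; 3; 4; 1; 4; 2; 4; 4; 1; 1; 3; 5; 4] [:: 5; 5; 5; 3; 3; 3; 3] k_eq uq7).
- by rewrite /= uv ab ![e t _]e_sym ut vt at' bt ![e z _]e_sym az bz ![e y _]e_sym uy vy.
- by rewrite /= nua nub nva nvb.
- by rewrite /= dt du dv dy da db dz.
- by vm_compute.
Qed.

Lemma deg_le5 x : k = 6 -> deg e x <= 5.
Proof. by move=> k_eq; have := deg_lt x; rewrite k_eq. Qed.

(* In the next three lemmas the edges ij and cl cross, and each of the gaps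
   between i, c, j, l is empty or holds a gadget or a 2-vertex. *)
Lemma crossing_gadget i c j l u v : gadget e i u v c -> uniq [:: i; c; j; l; u; v] ->
  e i c -> e i j -> e c j -> e c l -> e j l -> deg e j = 3 -> False.
Proof.
move=> gad uq6 ic ij cj cl jl dj; have [k_eq di] := gadget_ends gad.
have [_ dc] := gadget_ends (gadget_swap gad); have gad' := gadget_flip gad.
have [uq uv ui uc vi vc du dv] := gad.
have njuv : ~~ e u j /\ ~~ e v j.
  move: uq6; rewrite /= !inE !negb_or => /and5P[/and5P[_ ij' _ _ _] /and4P[cj' _ _ _] /and3P[_ ju jv] _ _].
  by rewrite (gadget_nonadj gad) ?(gadget_nonadj gad') // !inE !negb_or ?ju ?jv ![j == _]eq_sym ij' cj'.
have {njuv} [nuj nvj] := njuv.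
apply: (@reducible6 i _
  [:: (4, 5); (0, 4); (1, 4); (0, 5); (1, 5); (0, 1); (1, 2); (1, 3); (0, 2); (2, 3)]
  [:: (2, 4); (2, 5)]
  [:: (2, 2); (2, 3); (0, 2); (1, 3); (0, 1); (1, 2); (0, 4); (1, 4); (4, 4); (5, 5);
      (0, 5); (4, 5); (1, 1); (1, 5)]
  [:: 3; 0; 3; 1; 1; 5; 3; 5; 4; 3; 3; 5; 3; 5] [:: 5; 5; 3; 5; 3; 3] k_eq uq6).
- by rewrite /= uv ic ij cj cl jl ![e i _]e_sym ![e c _]e_sym ui uc vi vc.
- by rewrite /= ![e j _]e_sym nuj nvj.
- by rewrite /= di dc dj du dv deg_le5.
- by vm_compute.
Qed.

Lemma crossing_two_gadgets i c j l u v a b :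
  gadget e i u v c -> gadget e j a b l -> uniq [:: i; c; j; l; u; v; a; b] ->
  e i c -> e i j -> e c j -> e c l -> e j l -> False.
Proof.
move=> gad1 gad2 uq8 ic ij cj cl jl; have [k_eq di] := gadget_ends gad1.
have [_ dc] := gadget_ends (gadget_swap gad1); have gad1' := gadget_flip gad1.
have [_ dj] := gadget_ends gad2; have [_ dl] := gadget_ends (gadget_swap gad2).
have gad2' := gadget_flip gad2.
have [uq1 uv ui uc vi vc du dv] := gad1; have [uq2 ab aj al bj bl da db] := gad2.
have [[nuj nvj nac nbc] [nua nub nva nvb]] : [/\ ~~ e u j, ~~ e v j, ~~ e a c & ~~ e b c] /\
    [/\ ~~ e u a, ~~ e u b, ~~ e v a & ~~ e v b].
  move: uq8; rewrite /= !inE !negb_or => /and5P[].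
  move=> /and5P[ic' ij' il' iu' /and3P[iv' ia' ib']] /and5P[cj' cl' cu' cv' /andP[ca' cb']].
  move=> /and5P[jl' ju' jv' ja' jb'] /and4P[lu' lv' la' lb'] /and4P[].
  move=> /and3P[uv' ua' ub'] /andP[va' vb'] ab' _.
  by split; split; rewrite ?(gadget_nonadj gad1) ?(gadget_nonadj gad1') ?(gadget_nonadj gad2)
     ?(gadget_nonadj gad2') // !inE !negb_or ?[j == _]eq_sym ?[a == _]eq_sym ?[b == _]eq_sym;
     rewrite ?[c == l]eq_sym ?[c == j]eq_sym; apply/and3P; split=> //; rewrite eq_sym.
apply: (@reducible6 i _
  [:: (4, 5); (0, 4); (1, 4); (0, 5); (1, 5); (0, 1); (1, 2); (1, 3); (0, 2); (2, 3);
      (6, 7); (2, 6); (2, 7); (3, 6); (3, 7)]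
  [:: (1, 6); (1, 7); (2, 4); (2, 5); (4, 6); (4, 7); (5, 6); (5, 7)]
  [:: (4, 4); (5, 5); (4, 5); (0, 4); (0, 5); (0, 1); (1, 4); (1, 5); (1, 1); (0, 2); (1, 2);
      (2, 2); (6, 6); (2, 6); (7, 7); (6, 7); (3, 6); (3, 7); (1, 3); (2, 3); (2, 7)]
  [:: 2; 4; 5; 3; 0; 2; 5; 5; 3; 3; 5; 2; 4; 5; 3; 5; 3; 3; 3; 3; 5]
  [:: 5; 5; 5; 5; 3; 3; 3; 3] k_eq uq8).
- by rewrite /= uv ic ij cj cl jl ab ![e i _]e_sym ![e c _]e_sym ui uc vi vc
    ![e j _]e_sym ![e l _]e_sym aj al bj bl.
- by rewrite /= ![e j _]e_sym ![e c _]e_sym nuj nvj nac nbc nua nub nva nvb.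
- by rewrite /= di dc dj dl du dv da db.
- by vm_compute.
Qed.

Lemma crossing_2vertices i c j l w1 w2 w3 : uniq [:: i; c; j; l; w1; w2; w3] ->
  e i c -> e i j -> e c j -> e c l -> e j l ->
  e w1 i -> e w1 c -> e w2 c -> e w2 j -> e w3 j -> e w3 l ->
  deg e w1 = 2 -> deg e w2 = 2 -> deg e w3 = 2 -> deg e c <= 5 -> False.
Proof.
move=> uq7 ic ij cj cl jl w1i w1c w2c w2j w3j w3l d1 d2 d3 dc.
have k_eq : k = 6.
  by have := edge_deg w1c; rewrite d1 => /(_ isT); have := k6; clear - dc; lia.
have n22 x y : deg e x = 2 -> deg e y = 2 -> ~~ e x y.
  by move=> dx dy; apply/negP => /edge_deg2; rewrite dx dy => /(_ isT).
have [n1j n3c] : ~~ e w1 j /\ ~~ e w3 c.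
  move: uq7; rewrite /= !inE !negb_or => /and5P[].
  move=> /and5P[ic' ij' il' _ _] /and5P[cj' cl' _ _ _] /and4P[jl' _ _ _] _ _; split; apply/negP.
    by move/(nbr2 d1 ic' w1i w1c); rewrite !inE ![j == _]eq_sym (negPf ij') (negPf cj').
  by move/(nbr2 d3 jl' w3j w3l); rewrite !inE (negPf cj') (negPf cl').
apply: (@reducible6 i _
  [:: (0, 4); (1, 4); (1, 5); (2, 5); (2, 6); (3, 6); (0, 1); (1, 2); (1, 3); (0, 2); (2, 3)]
  [:: (1, 6); (2, 4); (4, 5); (4, 6); (5, 6)]
  [:: (4, 4); (0, 4); (0, 1); (1, 4); (1, 5); (5, 5); (1, 1); (0, 2); (2, 5); (1, 2); (1, 3);
      (2, 3); (6, 6); (3, 6); (2, 6); (2, 2)]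
  [:: 3; 2; 0; 5; 5; 4; 3; 2; 5; 4; 2; 2; 3; 2; 5; 3]
  [:: 5; 5; 5; 5; 2; 2; 2] k_eq uq7).
- by rewrite /= ic ij cj cl jl ![e i w1]e_sym ![e c w1]e_sym ![e c w2]e_sym ![e j w2]e_sym
   ![e j w3]e_sym ![e l w3]e_sym w1i w1c w2c w2j w3j w3l.
- by rewrite /= (e_sym c) (e_sym j) n3c n1j !n22.
- by rewrite /= d1 d2 d3 !deg_le5.
- by vm_compute.
Qed.

End Reductions.

(** * A gadget between two adjacent crossing vertices *)

Ltac all_neq :=
  rewrite /= ?inE ?negb_or ?andbT; do ?[apply/andP; split]; do ?split;
  rewrite /= ?inE ?negb_or ?andbT; do ?[apply/andP; split];
  solve [assumption | rewrite eq_sym; assumption].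

Section GadgetLists.
Variable C : eqType.
Implicit Types (Lu Lv Lw Rcu Rcv Rju Rjv A : seq C) (c j m x : C).

(* The gadget on c and j with inner vertices u and v is coloured by u, v, w, cu,
   cv, ju, jv, where w is the colour of the edge uv; m is the colour of the
   edge cj. *)
Definition gadget_solution Lu Lv Lw Rcu Rcv Rju Rjv c j m := exists u v w cu cv ju jv,
  [/\ u \in Lu, v \in Lv, w \in Lw & [/\ cu \in Rcu, cv \in Rcv, ju \in Rju & jv \in Rjv]] /\
  [/\ uniq [:: c; m; cu; cv], uniq [:: j; m; ju; jv], uniq [:: u; w; cu; ju],
      uniq [:: v; w; cv; jv] & uniq [:: c; u; v] && uniq [:: j; u; v]].

Lemma gadget_solution_swap Lu Lv Lw Rcu Rcv Rju Rjv c j m :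
  gadget_solution Lu Lv Lw Rju Rjv Rcu Rcv j c m ->
  gadget_solution Lu Lv Lw Rcu Rcv Rju Rjv c j m.
Proof.
move=> [u [v [w [cu [cv [ju [jv [[uL vL wL [cuL cvL juL jvL]] [u1 u2 u3 u4 u5]]]]]]]]].
exists u, v, w, ju, jv, cu, cv; do 2![split=> //]; last by rewrite andbC.
  by move: u3; rewrite /= !inE !(eq_sym ju) => /and4P[]; rewrite !negb_or (eq_sym cu) => /and3P[-> -> ->] /andP[-> ->] ->.
by move: u4; rewrite /= !inE !(eq_sym jv) => /and4P[]; rewrite !negb_or (eq_sym cv) => /and3P[-> -> ->] /andP[-> ->] ->.
Qed.

Lemma gadget_solution_flip Lu Lv Lw Rcu Rcv Rju Rjv c j m :
  gadget_solution Lv Lu Lw Rcv Rcu Rjv Rju c j m ->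
  gadget_solution Lu Lv Lw Rcu Rcv Rju Rjv c j m.
Proof.
move=> [u [v [w [cu [cv [ju [jv [[uL vL wL [cuL cvL juL jvL]] [u1 u2 u3 u4 u5]]]]]]]]].
exists v, u, w, cv, cu, jv, ju; do 2![split=> //].
- by move: u1; rewrite /= !inE !negb_or (eq_sym cv) => /and4P[/and3P[-> -> ->] /andP[-> ->] ->].
- by move: u2; rewrite /= !inE !negb_or (eq_sym jv) => /and4P[/and3P[-> -> ->] /andP[-> ->] ->].
- move: u5; rewrite /= !inE !negb_or (eq_sym v).
  by case/andP=> /and3P[/andP[-> ->] -> _] /and3P[/andP[-> ->] _ _].
Qed.

Definition avoid A (s : seq C) := [seq x <- undup A | x \notin s].

Lemma mem_avoid A s x : (x \in avoid A s) = (x \notin s) && (x \in A).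
Proof. by rewrite mem_filter mem_undup. Qed.

Lemma size_avoid A s : size (undup A) <= size (undup (avoid A s)) + count (mem A) s.
Proof.
rewrite -[X in _ <= _ + X]size_filter -size_cat; apply: uniq_leq_size => [|x]; first exact: undup_uniq.
rewrite mem_undup mem_cat mem_undup mem_avoid mem_filter => xA.
by rewrite /= xA andbT; case: (x \in s).
Qed.

Lemma avoid_size A s n : n + size s < size (undup A) -> n < size (undup (avoid A s)).
Proof.
by move=> lt; have := size_avoid A s; have := count_size (mem A) s; lia.
Qed.

Lemma avoid_size_notin A s x n : x \notin A -> n + size s < size (undup A) ->
  n < size (undup (avoid A (x :: s))).
Proof.
by move=> /negPf xA lt; have := size_avoid A (x :: s); have := count_size (mem A) s;
   rewrite /= xA; lia.
Qed.

Lemma pick_avoid A s : size s < size (undup A) -> exists2 x, x \in A & x \notin s.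
Proof.
move=> /(@avoid_size A s 0); case E: (avoid A s) => [//|x l] _; exists x;
by have := mem_avoid A s x; rewrite E mem_head => /esym/andP[].
Qed.

Definition choosable (E : seq (nat * nat)) (t : seq nat) : bool :=
  [&& 0 < size t, all (fun p => (p.1 < size t) && (p.2 < size t)) E,
      sumn t == size E & expand E [:: (t, 1%R)] != 0%R].

Lemma choosableP E t (l : seq (seq C)) : choosable E t ->
  (forall i, i < size t -> nth 0 t i < size (undup (nth [::] l i))) ->
  exists s : nat -> C, (forall i, i < size t -> s i \in nth [::] l i) /\
    all (fun p => s p.1 != s p.2) E.
Proof.
case/and4P => t_gt0 E_lt /eqP E_size; rewrite expand_coef => coef l_size.
have [s [s_in s_E]] := list_coloring t_gt0 E_lt E_size coef l_size.
by exists s; split=> //; apply/allP => p /s_E/eqP.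
Qed.

(** The conflicts among cu, cv, jv, ju, u, v, w in this order; the first four indices form the
    4-cycle of edges. *)
Definition gadget_graph :=
  [:: (0, 1); (0, 3); (0, 4); (0, 6); (1, 2); (1, 5); (1, 6); (2, 3); (2, 5); (2, 6);
      (3, 4); (3, 6); (4, 5); (4, 6); (5, 6)].

Section Unsolvable.
Variables (Lu Lv Lw Rcu Rcv Rju Rjv : seq C).
Hypotheses (sz_u : 5 < size (undup Lu)) (sz_v : 5 < size (undup Lv))
  (sz_w : 5 < size (undup Lw)) (sz_cu : 3 < size (undup Rcu))
  (sz_cv : 3 < size (undup Rcv)) (sz_ju : 3 < size (undup Rju))
  (sz_jv : 3 < size (undup Rjv)).
Variables (c j m : C).
Hypothesis cjm : uniq [:: c; j; m].

Let solution := gadget_solution Lu Lv Lw Rcu Rcv Rju Rjv c j m.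
Let lists := [:: avoid Rcu [:: c; m]; avoid Rcv [:: c; m]; avoid Rjv [:: j; m];
                 avoid Rju [:: j; m]; avoid Lu [:: c; j]; avoid Lv [:: c; j]; Lw].

Lemma gadget_solutionI (s : nat -> C) :
  (forall i, i < 7 -> s i \in nth [::] lists i) ->
  all (fun p => s p.1 != s p.2) gadget_graph -> solution.
Proof.
move=> s_in; rewrite /= andbT => /and5P[e01 e03 e04 e06 /and5P[e12 e15 e16 e23 /and5P[e25 e26 e34 e36]]].
move=> /and3P[e45 e46 e56].
have /= := s_in 0 isT; rewrite mem_avoid !inE negb_or => /andP[/andP[c0 m0] cuL].
have /= := s_in 1 isT; rewrite mem_avoid !inE negb_or => /andP[/andP[c1 m1] cvL].
have /= := s_in 2 isT; rewrite mem_avoid !inE negb_or => /andP[/andP[j2 m2] jvL].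
have /= := s_in 3 isT; rewrite mem_avoid !inE negb_or => /andP[/andP[j3 m3] juL].
have /= := s_in 4 isT; rewrite mem_avoid !inE negb_or => /andP[/andP[c4 j4] uL].
have /= := s_in 5 isT; rewrite mem_avoid !inE negb_or => /andP[/andP[c5 j5] vL].
have /= wL := s_in 6 isT.
move: cjm; rewrite /= !inE !negb_or andbT => /andP[/andP[cj cm] jm].
exists (s 4), (s 5), (s 6), (s 0), (s 1), (s 3), (s 2); split; first by split.
rewrite /= !inE !negb_or !andbT ![c == s _]eq_sym ![j == s _]eq_sym ![m == s _]eq_sym.
rewrite ![s 4 == s 0]eq_sym ![s 4 == s 3]eq_sym ![s 6 == s _]eq_sym ![s 5 == s 1]eq_sym.
rewrite ![s 5 == s 2]eq_sym [s 3 == s 2]eq_sym.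
by rewrite c0 m0 c1 m1 j2 m2 j3 m3 c4 j4 c5 j5 e01 e03 e04 e06 e12 e15 e16 e23 e25 e26
   e34 e36 e45 e46 e56 cm jm.
Qed.

Hypothesis unsolvable : ~ solution.

(** Once c, j and m are fixed, the lists are only known to have 2, 2, 2, 2, 4, 4, 6 colours, which
    allows a single monomial of degree 15. Exchanging u and v fixes this monomial but reverses three
    of the differences (cu and cv, ju and jv, u and v), so its coefficient is 0. One extra colour,
    here at u, admits an asymmetric monomial. *)
Lemma unsolvable_u : c \in Lu.
Proof.
apply/negPn/negP => cL; apply: unsolvable.
have ok : choosable gadget_graph [:: 1; 1; 1; 1; 4; 2; 5] by vm_compute.
have [|s [s_in s_E]] := choosableP (l := lists) ok.
  case=> [|[|[|[|[|[|[|//]]]]]]] _ /=; last exact: sz_w.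
  - exact: (@avoid_size _ [:: _; _] 1 sz_cu).
  - exact: (@avoid_size _ [:: _; _] 1 sz_cv).
  - exact: (@avoid_size _ [:: _; _] 1 sz_jv).
  - exact: (@avoid_size _ [:: _; _] 1 sz_ju).
  - exact: (@avoid_size_notin _ [:: _] _ 4 cL sz_u).
  - exact: (@avoid_size _ [:: _; _] 2 (ltnW sz_v)).
exact: gadget_solutionI s_E.
Qed.

Lemma unsolvable_cu : c \in Rcu.
Proof.
apply/negPn/negP => cL; apply: unsolvable.
have ok : choosable gadget_graph [:: 2; 1; 1; 1; 3; 3; 4] by vm_compute.
have [|s [s_in s_E]] := choosableP (l := lists) ok.
  case=> [|[|[|[|[|[|[|//]]]]]]] _ /=; last exact: ltnW sz_w.
  - exact: (@avoid_size_notin _ [:: _] _ 2 cL sz_cu).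
  - exact: (@avoid_size _ [:: _; _] 1 sz_cv).
  - exact: (@avoid_size _ [:: _; _] 1 sz_jv).
  - exact: (@avoid_size _ [:: _; _] 1 sz_ju).
  - exact: (@avoid_size _ [:: _; _] 3 sz_u).
  - exact: (@avoid_size _ [:: _; _] 3 sz_v).
exact: gadget_solutionI s_E.
Qed.

Lemma four_cycle (A0 A1 A2 A3 : seq C) : 1 < size (undup A0) -> 1 < size (undup A1) ->
  1 < size (undup A2) -> 1 < size (undup A3) ->
  exists x0 x1 x2 x3, [/\ x0 \in A0, x1 \in A1, x2 \in A2 & x3 \in A3] /\
    [/\ x0 != x1, x1 != x2, x2 != x3 & x0 != x3].
Proof.
move=> s0 s1 s2 s3.
have ok : choosable [:: (0, 1); (1, 2); (2, 3); (0, 3)] [:: 1; 1; 1; 1] by vm_compute.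
have [|s [s_in /= /and5P[e01 e12 e23 e03 _]]] := choosableP (l := [:: A0; A1; A2; A3]) ok.
  by case=> [|[|[|[|//]]]].
by exists (s 0), (s 1), (s 2), (s 3); split; split=> //; [exact: (s_in 0) | exact: (s_in 1)
  | exact: (s_in 2) | exact: (s_in 3)].
Qed.

(* Otherwise the edge cu can take the colour of j, which none of u, ju and jv
   can use. *)
Lemma unsolvable_j_cu : j \notin Rcu.
Proof.
apply/negP => jL; apply: unsolvable.
move: (cjm); rewrite /= !inE !negb_or andbT => /andP[/andP[cj cm] jm].
have [cv cvA] : exists2 x, x \in Rcv & x \notin [:: c; m; j] by apply: pick_avoid.
rewrite !inE !negb_or => /and3P[cv_c cv_m cv_j].
have [jv jvA] : exists2 x, x \in Rjv & x \notin [:: j; m; cv] by apply: pick_avoid.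
rewrite !inE !negb_or => /and3P[jv_j jv_m jv_cv].
have [ju juA] : exists2 x, x \in Rju & x \notin [:: j; m; jv] by apply: pick_avoid.
rewrite !inE !negb_or => /and3P[ju_j ju_m ju_jv].
have [v vA] : exists2 x, x \in Lv & x \notin [:: c; j; cv; jv] by apply: pick_avoid; apply: ltnW.
rewrite !inE !negb_or => /and4P[v_c v_j v_cv v_jv].
have [w wA] : exists2 x, x \in Lw & x \notin [:: j; cv; ju; jv; v] by apply: pick_avoid.
rewrite !inE !negb_or => /and5P[w_j w_cv w_ju w_jv w_v].
have [u uA] : exists2 x, x \in Lu & x \notin [:: c; j; ju; v; w] by apply: pick_avoid.
rewrite !inE !negb_or => /and5P[u_c u_j u_ju u_v u_w].
exists u, v, w, j, cv, ju, jv; split; first by split.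
all_neq.
Qed.

End Unsolvable.

Lemma unsolvable_in Lu Lv Lw Rcu Rcv Rju Rjv c j m :
  5 < size (undup Lu) -> 5 < size (undup Lv) -> 5 < size (undup Lw) ->
  3 < size (undup Rcu) -> 3 < size (undup Rcv) ->
  3 < size (undup Rju) -> 3 < size (undup Rjv) -> uniq [:: c; j; m] ->
  ~ gadget_solution Lu Lv Lw Rcu Rcv Rju Rjv c j m ->
  [/\ c \in Lu, c \in Lv, c \in Rcu & c \in Rcv] /\ (c \notin Rju /\ c \notin Rjv).
Proof.
move=> su sv sw scu scv sju sjv cjm nosol.
have jcm : uniq [:: j; c; m].
  by move: cjm; rewrite /= !inE !negb_or !andbT (eq_sym j c) => /andP[/andP[-> ->] ->].
have nosol_flip : ~ gadget_solution Lv Lu Lw Rcv Rcu Rjv Rju c j m.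
  by move=> /gadget_solution_flip.
have nosol_swap : ~ gadget_solution Lu Lv Lw Rju Rjv Rcu Rcv j c m.
  by move=> /gadget_solution_swap.
have nosol_both : ~ gadget_solution Lv Lu Lw Rjv Rju Rcv Rcu j c m.
  by move=> /gadget_solution_flip.
split; split; [exact: unsolvable_u nosol | exact: unsolvable_u nosol_flip
  | exact: unsolvable_cu nosol | exact: unsolvable_cu nosol_flip
  | exact: unsolvable_j_cu nosol_swap | exact: unsolvable_j_cu nosol_both].
Qed.

(** Otherwise the edge uv takes the colour c: ju and jv cannot have it, and cu, cv, u, v avoid it
    anyway. Then u and v see four and five colours. *)
Lemma unsolvable_c_w Lu Lv Lw Rcu Rcv Rju Rjv c j m :
  5 < size (undup Lu) -> 5 < size (undup Lv) -> 5 < size (undup Lw) ->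
  3 < size (undup Rcu) -> 3 < size (undup Rcv) ->
  3 < size (undup Rju) -> 3 < size (undup Rjv) -> uniq [:: c; j; m] ->
  ~ gadget_solution Lu Lv Lw Rcu Rcv Rju Rjv c j m -> c \notin Lw.
Proof.
move=> sz_u sz_v sz_w sz_cu sz_cv sz_ju sz_jv cjm nosol; apply/negP => cL; apply: (nosol).
have [_ [cju cjv]] := unsolvable_in sz_u sz_v sz_w sz_cu sz_cv sz_ju sz_jv cjm nosol.
have [cu [cv [jv [ju [[]]]]]] := four_cycle (@avoid_size _ [:: c; m] 1 sz_cu)
  (@avoid_size _ [:: c; m] 1 sz_cv) (@avoid_size _ [:: j; m] 1 sz_jv)
  (@avoid_size _ [:: j; m] 1 sz_ju).
rewrite !mem_avoid !inE !negb_or => /andP[/andP[cu_c cu_m] cuL] /andP[/andP[cv_c cv_m] cvL].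
move=> /andP[/andP[jv_j jv_m] jvL] /andP[/andP[ju_j ju_m] juL] [cu_cv cv_jv jv_ju cu_ju].
have jv_c : jv != c by apply: contraNneq cjv => <-.
have ju_c : ju != c by apply: contraNneq cju => <-.
have [u uL] : exists2 x, x \in Lu & x \notin [:: c; j; cu; ju] by apply: pick_avoid; apply: ltnW.
rewrite !inE !negb_or => /and4P[u_c u_j u_cu u_ju].
have [v vL] : exists2 x, x \in Lv & x \notin [:: c; j; cv; jv; u] by apply: pick_avoid.
rewrite !inE !negb_or => /and5P[v_c v_j v_cv v_jv v_u].
move: (cjm); rewrite /= !inE !negb_or andbT => /andP[/andP[cj cm] jm].
exists u, v, c, cu, cv, ju, jv; split; first by split.
all_neq.
Qed.

Section TwoTriples.
Variables (Lu Lv Lw Rcu Rcv Rju Rjv : seq C).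
Hypotheses (sz_u : 5 < size (undup Lu)) (sz_v : 5 < size (undup Lv))
  (sz_w : 5 < size (undup Lw)) (sz_cu : 3 < size (undup Rcu))
  (sz_cv : 3 < size (undup Rcv)) (sz_ju : 3 < size (undup Rju))
  (sz_jv : 3 < size (undup Rjv)).

Let solution c j m := gadget_solution Lu Lv Lw Rcu Rcv Rju Rjv c j m.

(* Colour the 4-cycle of edges first; as x is missing at c and at the edge uv,
   one of u and v can take the colour x. *)
Lemma two_triples c j m c' x m' : uniq [:: c; j; m] -> uniq [:: c'; x; m'] ->
  x \notin [:: c; j] -> ~ solution c j m -> ~ solution c' x m' -> False.
Proof.
move=> cjm cxm; rewrite !inE negb_or => /andP[xc xj] nosol nosol'.
have xcm : uniq [:: x; c'; m'].
  by move: cxm; rewrite /= !inE !negb_or !andbT (eq_sym x c') => /andP[/andP[-> ->] ->].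
have nosol'_swap : ~ gadget_solution Lu Lv Lw Rju Rjv Rcu Rcv x c' m'.
  by move=> /gadget_solution_swap.
have [[xLu xLv _ _] [xcu xcv]] :=
  unsolvable_in sz_u sz_v sz_w sz_ju sz_jv sz_cu sz_cv xcm nosol'_swap.
have xw := unsolvable_c_w sz_u sz_v sz_w sz_ju sz_jv sz_cu sz_cv xcm nosol'_swap.
apply: nosol; move: (cjm); rewrite /= !inE !negb_or andbT => /andP[/andP[cj cm] jm].
have [cu [cv [jv [ju [[]]]]]] := four_cycle (@avoid_size _ [:: c; m] 1 sz_cu)
  (@avoid_size _ [:: c; m] 1 sz_cv) (@avoid_size _ [:: j; m] 1 sz_jv)
  (@avoid_size _ [:: j; m] 1 sz_ju).
rewrite !mem_avoid !inE !negb_or => /andP[/andP[cu_c cu_m] cuL] /andP[/andP[cv_c cv_m] cvL].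
move=> /andP[/andP[jv_j jv_m] jvL] /andP[/andP[ju_j ju_m] juL] [cu_cv cv_jv jv_ju cu_ju].
have cu_x : cu != x by apply: contraNneq xcu => <-.
have cv_x : cv != x by apply: contraNneq xcv => <-.
have [ju_x|ju_x] := eqVneq ju x.
  have jv_x : jv != x by rewrite -ju_x.
  have [u uL] : exists2 u, u \in Lu & u \notin [:: c; j; x; cu] by apply: pick_avoid; apply: ltnW.
  rewrite !inE !negb_or => /and4P[u_c u_j u_x u_cu].
  have u_ju : u != ju by rewrite ju_x.
  have [w wL] : exists2 w, w \in Lw & w \notin [:: u; cu; cv; ju; jv] by apply: pick_avoid.
  rewrite !inE !negb_or => /and5P[w_u w_cu w_cv w_ju w_jv].
  have w_x : w != x by apply: contraNneq xw => <-.
  by exists u, x, w, cu, cv, ju, jv; split; [by split | all_neq].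
have [v vL] : exists2 v, v \in Lv & v \notin [:: c; j; x; cv; jv] by apply: pick_avoid.
rewrite !inE !negb_or => /and5P[v_c v_j v_x v_cv v_jv].
have [w wL] : exists2 w, w \in Lw & w \notin [:: v; cu; cv; ju; jv] by apply: pick_avoid.
rewrite !inE !negb_or => /and5P[w_v w_cu w_cv w_ju w_jv].
have w_x : w != x by apply: contraNneq xw => <-.
by exists x, v, w, cu, cv, ju, jv; split; [by split | all_neq].
Qed.

End TwoTriples.

(** [K], [J], [M] are the colours available for c, j and the edge cj. If no triple worked,
    [two_triples] would confine the colours of c and j in every proper triple to d1 and d2; the new
    colour x breaks this. *)
Lemma recolour_triple Lu Lv Lw Rcu Rcv Rju Rjv (K J M : seq C) d1 d2 m x :
  5 < size (undup Lu) -> 5 < size (undup Lv) -> 5 < size (undup Lw) ->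
  3 < size (undup Rcu) -> 3 < size (undup Rcv) ->
  3 < size (undup Rju) -> 3 < size (undup Rjv) ->
  1 < size (undup J) -> 1 < size (undup M) ->
  uniq [:: d1; d2; m] -> d1 \in K -> d2 \in J -> m \in M ->
  x \in K -> x \notin [:: d1; d2] ->
  exists c j m', [/\ c \in K, j \in J, m' \in M & uniq [:: c; j; m']] /\
    gadget_solution Lu Lv Lw Rcu Rcv Rju Rjv c j m'.
Proof.
move=> su sv sw scu scv sju sjv sJ sM dm dK dJ mM xK x_new.
have uniq_swap a b c : uniq [:: a; b; c] -> uniq [:: b; a; c].
  by rewrite /= !inE !negb_or !andbT (eq_sym b a) => /andP[/andP[-> ->] ->].
move: (dm) (x_new); rewrite /= !inE !negb_or andbT => /andP[/andP[d12 d1m] d2m] /andP[xd1 xd2].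
apply: contrapT => none.
have no c j m' : c \in K -> j \in J -> m' \in M -> uniq [:: c; j; m'] ->
    ~ gadget_solution Lu Lv Lw Rcu Rcv Rju Rjv c j m'.
  by move=> cK jJ m'M u_ sol; apply: none; exists c, j, m'.
have no_j j' c' m' : c' \in K -> j' \in J -> m' \in M -> uniq [:: c'; j'; m'] ->
    j' \notin [:: d1; d2] -> False.
  move=> cK jJ m'M u_ j_new.
  exact: (two_triples su sv sw scu scv sju sjv dm u_ j_new (no _ _ _ dK dJ mM dm) (no _ _ _ cK jJ m'M u_)).
have no_c c' j' m' : c' \in K -> j' \in J -> m' \in M -> uniq [:: c'; j'; m'] ->
    c' \notin [:: d1; d2] -> False.
  move=> cK jJ m'M u_ c_new'.
  have c_new : c' \notin [:: d2; d1] by move: c_new'; rewrite !inE orbC.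
  apply: (two_triples su sv sw sju sjv scu scv (uniq_swap _ _ _ dm) (uniq_swap _ _ _ u_) c_new).
    by move=> /gadget_solution_swap; apply: no.
  by move=> /gadget_solution_swap; apply: no.
(* If x = m, the edge needs another colour m'. If that is d2, then j moves to some other j'. In
   every branch c or j receives a colour different from d1 and d2. *)
have [xm|xm] := eqVneq x m; last first.
  by apply: (no_c x d2 m) => //; all_neq.
have [m' m'M] : exists2 y, y \in M & y \notin [:: m] by apply: pick_avoid.
rewrite inE => m'm.
have [m'd2|m'd2] := eqVneq m' d2; last first.
  by apply: (no_c x d2 m') => //; rewrite xm; rewrite xm in xd2; all_neq.
have [j' j'J] : exists2 y, y \in J & y \notin [:: d2] by apply: pick_avoid.
rewrite inE => j'd2.
have [j'm|j'm] := eqVneq j' m.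
  apply: (no_j j' d1 d2); rewrite -?m'd2 // j'm ?m'd2; first by all_neq.
  by rewrite -xm.
apply: (no_c x j' d2); rewrite -?m'd2 // xm ?m'd2; first by all_neq.
by rewrite -xm.
Qed.

(** If neither [K] nor [J] offers a new colour, both contain d1 and d2, so these can be exchanged.
    By [unsolvable_in], failure of (d1, d2, m) keeps d1 out of [Rju], while failure of (d2, d1, m)
    puts it there. *)
Lemma nested_gadget_solution Lu Lv Lw Rcu Rcv Rju Rjv (K J M : seq C) d1 d2 m :
  5 < size (undup Lu) -> 5 < size (undup Lv) -> 5 < size (undup Lw) ->
  3 < size (undup Rcu) -> 3 < size (undup Rcv) ->
  3 < size (undup Rju) -> 3 < size (undup Rjv) ->
  1 < size (undup K) -> 1 < size (undup J) -> 1 < size (undup M) ->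
  uniq [:: d1; d2; m] -> d1 \in K -> d2 \in J -> m \in M ->
  exists c j m', [/\ c \in K, j \in J, m' \in M & uniq [:: c; j; m']] /\
    gadget_solution Lu Lv Lw Rcu Rcv Rju Rjv c j m'.
Proof.
move=> su sv sw scu scv sju sjv sK sJ sM dm dK dJ mM.
have dm' : uniq [:: d2; d1; m].
  by move: dm; rewrite /= !inE !negb_or !andbT (eq_sym d2 d1) => /andP[/andP[-> ->] ->].
case: (boolP (has (fun x => x \notin [:: d1; d2]) K)) => [/hasP[x xK x_new]|K_sub].
  exact: (recolour_triple su sv sw scu scv sju sjv sJ sM dm dK dJ mM xK x_new).
case: (boolP (has (fun x => x \notin [:: d2; d1]) J)) => [/hasP[x xJ x_new]|J_sub].
  have [j [c [m' [[jJ cK m'M u_] sol]]]] :=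
    recolour_triple su sv sw sju sjv scu scv sK sM dm' dJ dK mM xJ x_new.
  exists c, j, m'; split; last exact: gadget_solution_swap.
  by split=> //; move: u_; rewrite /= !inE !negb_or !andbT (eq_sym j) => /andP[/andP[-> ->] ->].
have d2K : d2 \in K.
  have [x xK] : exists2 x, x \in K & x \notin [:: d1] by apply: pick_avoid.
  rewrite inE => xd1; move/hasPn/(_ x xK): K_sub.
  by rewrite negbK !inE (negPf xd1) => /eqP <-.
have d1J : d1 \in J.
  have [x xJ] : exists2 x, x \in J & x \notin [:: d2] by apply: pick_avoid.
  rewrite inE => xd2; move/hasPn/(_ x xJ): J_sub.
  by rewrite negbK !inE (negPf xd2) => /eqP <-.
case: (pselect (gadget_solution Lu Lv Lw Rcu Rcv Rju Rjv d1 d2 m)) => [sol|nosol].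
  by exists d1, d2, m.
exists d2, d1, m; split=> //; apply: contrapT => nosol'.
have [_ [d1ju _]] := unsolvable_in su sv sw scu scv sju sjv dm nosol.
have nosol'_swap : ~ gadget_solution Lu Lv Lw Rju Rjv Rcu Rcv d1 d2 m.
  by move=> /gadget_solution_swap.
have [[_ _ d1ju' _] _] := unsolvable_in su sv sw sju sjv scu scv dm nosol'_swap.
by rewrite d1ju' in d1ju.
Qed.

End GadgetLists.

Section Nested.
Variables (T : finType) (C : eqType).
Variables (e : rel T) (L : {set T} -> seq C) (k : nat).
Hypothesis crit : critical e L k.
Let e_sym : symmetric e := crit_sym crit.
Let e_irr : irreflexive e := crit_irr crit.

(* The colouring of the graph without u and v is kept outside c, j and cj, and
   these three elements are recoloured together with the gadget. *)
Lemma crossing_inner_gadget i c j l u v :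
  gadget e c u v j -> uniq [:: i; c; j; l; u; v] ->
  e i c -> e i j -> e c j -> e c l -> e j l -> False.
Proof.
move=> gad uq6 ic ij cj cl jl; have [k_eq dc] := gadget_ends crit gad.
have [_ dj] := gadget_ends crit (gadget_swap gad).
have [_ uv uc uj vc vj du dv] := gad.
(* [U1] is the gadget without its ends; [U2] also contains c, j and cj. Only [U1] is missing from
   the colouring [phi], so c, j and cj start with proper colours. *)
pose U1 := [:: (4, 4); (5, 5); (4, 5); (1, 4); (1, 5); (2, 4); (2, 5)].
pose U2 := [:: (1, 1); (2, 2); (1, 2)] ++ U1.
pose adj := [:: (0, 1); (0, 2); (1, 2); (1, 3); (2, 3); (4, 5); (1, 4); (2, 4); (1, 5); (2, 5)].
pose vs := [:: i; c; j; l; u; v].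
have adj_e : all (fun p => e (nth i vs p.1) (nth i vs p.2)) adj.
  by rewrite /= ic ij cj cl jl uv ![e c _]e_sym ![e j _]e_sym uc uj vc vj.
have nonadj_e : all (fun p => ~~ e (nth i vs p.1) (nth i vs p.2)) [::] by [].
have conf1 : symb_config (size vs) adj [::] U1 by vm_compute.
have conf2 : symb_config (size vs) adj [::] U2 by vm_compute.
pose el := config_elem i vs.
pose D1 := [set A in map el U1]; pose D2 := [set A in map el U2].
have [phi [phiL phiN]] := config_coloring crit adj_e conf1.
have sub A : A \notin D2 -> A \notin D1.
  by rewrite !finset.in_set; apply: contra; rewrite /U2 map_cat mem_cat orbC => ->.
have phi_part : partial_coloring e L D2 phi.
  by split=> [A Ae /sub|A B Ae Be /sub AD /sub BD]; [exact: phiL | exact: phiN].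
pose R p := residual e L D2 phi (el p).
have R_size p : p \in U2 -> 6 + symb_deg adj U2 p <=
    size (undup (R p)) + (deg e (nth i vs p.1) + deg e (nth i vs p.2)).
  move=> pU; have := config_residual crit uq6 adj_e nonadj_e conf2 phi pU.
  by rewrite {1}k_eq.
have el_notin p : p \in [:: (1, 1); (2, 2); (1, 2)] -> el p \notin D1.
  move=> pU; rewrite finset.in_set; apply/mapP => -[q qU1 eq].
  have pU2 : p \in U2 by rewrite mem_cat pU.
  have qU2 : q \in U2 by rewrite mem_cat qU1 orbT.
  have := config_elem_inj uq6 conf2 pU2 qU2 eq => pq; rewrite -{q qU2 eq}pq in qU1.
  by move: pU qU1; rewrite !inE => /or3P[]/eqP ->.
have el_element p : p \in [:: (1, 1); (2, 2); (1, 2)] -> el p \in elements e.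
  move=> pU; have : [|| p == (1, 1), p == (2, 2) | p == (1, 2)] by move: pU; rewrite !inE.
  case/or3P => /eqP ->; [exact: (vertex_element e c) | exact: (vertex_element e j) |].
  exact: (edge_element cj).
have R_phi p : p \in [:: (1, 1); (2, 2); (1, 2)] -> phi (el p) \in R p.
  move=> pU; apply/residualP; split=> [|B Be BD AB]; first by rewrite phiL ?el_element ?el_notin.
  by apply: phiN; rewrite ?el_element ?el_notin ?sub // clashC.
have phi_neq p q : p \in [:: (1, 1); (2, 2); (1, 2)] -> q \in [:: (1, 1); (2, 2); (1, 2)] ->
    symb_clash adj p q -> phi (el p) != phi (el q).
  move=> pU qU pq; apply/eqP; apply: phiN; rewrite ?el_element ?el_notin //.
  by rewrite (config_clash crit uq6 adj_e nonadj_e conf2) // mem_cat ?pU ?qU.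
have d_uniq : uniq [:: phi (el (1, 1)); phi (el (2, 2)); phi (el (1, 2))].
  by rewrite /= !inE negb_or !phi_neq.
have R_lt p n d : p \in U2 -> deg e (nth i vs p.1) + deg e (nth i vs p.2) = d ->
    n + d < 6 + symb_deg adj U2 p -> n < size (undup (R p)).
  move=> pU d_eq lt; have := R_size p pU; rewrite d_eq => le.
  by rewrite -(ltn_add2r d); apply: leq_trans lt le.
have [|||||||||||||| c' [j' [m [[c'R j'R mR u0] [x [y [w [cu [cv [ju [jv [[xR yR wR [cuR cvR juR jvR]]
   [u1 u2 u3 u4 /andP[u5 u6]]]]]]]]]]]]]] :=
  @nested_gadget_solution C (R (4, 4)) (R (5, 5)) (R (4, 5)) (R (1, 4)) (R (1, 5))
  (R (2, 4)) (R (2, 5)) (R (1, 1)) (R (2, 2)) (R (1, 2)) (phi (el (1, 1))) (phi (el (2, 2)))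
  (phi (el (1, 2))).
- by apply: (R_lt (4, 4) 5 6) => //; rewrite /= du.
- by apply: (R_lt (5, 5) 5 6) => //; rewrite /= dv.
- by apply: (R_lt (4, 5) 5 6) => //; rewrite /= du dv.
- by apply: (R_lt (1, 4) 3 8) => //; rewrite /= du dc.
- by apply: (R_lt (1, 5) 3 8) => //; rewrite /= dv dc.
- by apply: (R_lt (2, 4) 3 8) => //; rewrite /= du dj.
- by apply: (R_lt (2, 5) 3 8) => //; rewrite /= dv dj.
- by apply: (R_lt (1, 1) 1 10) => //; rewrite /= dc.
- by apply: (R_lt (2, 2) 1 10) => //; rewrite /= dj.
- by apply: (R_lt (1, 2) 1 10) => //; rewrite /= dc dj.
- exact: d_uniq.
- exact: R_phi.
- exact: R_phi.
- exact: R_phi.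
pose s := [:: c'; j'; m; x; y; w; cu; cv; ju; jv].
apply: (crit_not crit).
apply: (@extend_selection _ _ e L phi (map el U2) (nth c' s)).
- exact: config_uniq uq6 conf2.
- exact: phi_part.
- by case=> [|[|[|[|[|[|[|[|[|[|//]]]]]]]]]].
- have s_neq : all (fun p => nth c' s p.1 != nth c' s p.2) (symb_edges adj U2).
    have -> : symb_edges adj U2 =
        [:: (0, 1); (0, 2); (0, 3); (0, 4); (0, 6); (0, 7); (1, 2); (1, 3); (1, 4); (1, 8);
            (1, 9); (2, 6); (2, 7); (2, 8); (2, 9); (3, 4); (3, 5); (3, 6); (3, 8); (4, 5);
            (4, 7); (4, 9); (5, 6); (5, 7); (5, 8); (5, 9); (6, 7); (6, 8); (7, 9); (8, 9)].
      by vm_compute.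
    clear - u0 u1 u2 u3 u4 u5 u6.
    move: u0 u1 u2 u3 u4 u5 u6; rewrite /= !inE !negb_or !andbT.
    move=> /andP[/andP[? ?] ?] /and3P[/and3P[? ? ?] /andP[? ?] ?] /and3P[/and3P[? ? ?] /andP[? ?] ?].
    move=> /and3P[/and3P[? ? ?] /andP[? ?] ?] /and3P[/and3P[? ? ?] /andP[? ?] ?].
    by move=> /andP[/andP[? ?] ?] /andP[/andP[? ?] _]; all_neq.
  move=> a b ab clash_ab; apply/eqP.
  exact: (allP s_neq _ (clash_symb_edges crit uq6 adj_e nonadj_e conf2 ab clash_ab)).
Qed.

End Nested.

(** * Crossings in a minimal counterexample *)

Section Crossing.
Variables (T : finType) (C : eqType).
Variables (e : rel T) (L : {set T} -> seq C) (k : nat).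
Hypothesis crit : critical e L k.
Let e_sym : symmetric e := crit_sym crit.
Let e_irr : irreflexive e := crit_irr crit.
Implicit Types (i c j l s u v w p : T).

(** What a vertex s in the gap between two consecutive ends p and c of a crossing can be; [Q] lists
    the four ends. *)
Definition link (Q : seq T) s p c :=
  [/\ deg e s = 2, e s p & e s c] \/
  exists v, [/\ gadget e p s v c, s \notin Q & v \notin Q].

Lemma deg_size (s : seq T) c : (forall w, e c w -> w \in s) -> deg e c <= size (undup s).
Proof.
move=> sub; rewrite /deg cardE; apply: uniq_leq_size; first exact: enum_uniq.
by move=> w; rewrite mem_enum finset.in_set mem_undup; apply: sub.
Qed.

Lemma deg_eq_size (s : seq T) c : (forall w, e c w -> w \in s) -> deg e c = size s ->
  forall w, w \in s -> e c w.
Proof.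
move=> sub d w ws.
have sub' : [set y | e c y] \subset [set y in s].
  by apply/fintype.subsetP => y; rewrite !finset.in_set; apply: sub.
have /eqP/setP/(_ w) : [set y | e c y] == [set y in s].
  by rewrite eqEcard sub' -/(deg e c) d cardsE card_size.
by rewrite !finset.in_set ws.
Qed.

Section Ends.
Variables (Q : seq T) (i c j l : T).
Hypothesis Q_uniq : uniq [:: i; c; j; l].
Hypothesis nbr_c : forall s, e c s ->
  [\/ s \in [:: i; j; l], link Q s i c | link Q s c j].

(** A 2-vertex next to c forces d(c) to be at least 5 and forbids gadgets at c. Besides i, j, l
    there is at most one 2-vertex towards i and one towards j, so all five candidates are
    neighbours. *)
Lemma ends_2vertices w : e c w -> deg e w = 2 ->
  exists w1 w2, [/\ deg e w1 = 2, e w1 i, e w1 c, deg e w2 = 2 & e w2 c /\ e w2 j] /\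
    [/\ e c i, e c j & deg e c <= 5].
Proof.
move=> cw dw.
have no_gadget p u v : ~ gadget e c u v p by move=> gad; exact: (gadget_no_2nbr crit gad cw dw).
have dc : 5 <= deg e c by apply: (edge_deg2 crit (u := w)); rewrite ?dw // e_sym.
pose W p := [pred s | [&& deg e s == 2, e s p & e s c]].
have sub s : e c s -> [|| s \in [:: i; j; l], W i s | W j s].
  move=> /nbr_c [->//|[[d si sc]|[v [/gadget_swap/no_gadget//]]]|[[d sc sj]|[v [/no_gadget//]]]].
    by rewrite /W /= d si sc orbT.
  by rewrite /W /= d sj sc !orbT.
have W_uniq p s s' : p != c -> W p s -> W p s' -> s = s'.
  move=> pc /and3P[/eqP d sp sc] /and3P[/eqP d' s'p s'c]; apply/eqP/negPn/negP => ss'.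
  exact: (no_double_2path crit ss' pc sp sc s'p s'c d d').
have [ic [jc lc]] : i != c /\ j != c /\ l != c.
  by move: Q_uniq; rewrite /= !inE !negb_or !(eq_sym _ c) (eq_sym c i) => /and4P[/and3P[-> _ _] /andP[-> ->]].
have [a aP] : exists a, forall s, W i s -> s = a.
  case: (pickP (W i)) => [a Wa|none]; first by exists a => s Ws; apply: W_uniq Wa.
  by exists c => s; rewrite none.
have [b bP] : exists b, forall s, W j s -> s = b.
  case: (pickP (W j)) => [b Wb|none]; first by exists b => s Ws; apply: W_uniq Wb.
  by exists c => s; rewrite none.
have sub5 s : e c s -> s \in [:: i; j; l; a; b].
  move=> /sub; rewrite !inE => /or3P[/or3P[]/eqP ->|/aP ->|/bP ->]; rewrite eqxx ?orbT //.
have d5 : deg e c = 5.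
  apply/eqP; rewrite eqn_leq dc andbT; apply: leq_trans (deg_size sub5) _.
  exact: size_undup.
have all5 := deg_eq_size sub5 d5.
have uq5 : uniq [:: i; j; l; a; b].
  have := ltn_size_undup [:: i; j; l; a; b].
  by have := deg_size sub5; rewrite d5; case: (uniq _) => //= + lt; rewrite leqNgt lt.
move: (uq5); rewrite /= !inE !negb_or => /and5P[/and4P[_ _ ia ib] /and3P[_ ja jb] /andP[la lb] ab _].
have Wa : W i a.
  have /all5/sub/or3P[|//|/bP aE] : a \in [:: i; j; l; a; b] by rewrite !inE eqxx ?orbT.
    by rewrite !inE ![a == _]eq_sym (negPf ia) (negPf ja) (negPf la).
  by rewrite aE eqxx in ab.
have Wb : W j b.
  have /all5/sub/or3P[|/aP bE|//] : b \in [:: i; j; l; a; b] by rewrite !inE eqxx ?orbT.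
    by rewrite !inE ![b == _]eq_sym (negPf ib) (negPf jb) (negPf lb).
  by rewrite bE eqxx in ab.
case/and3P: Wa => /eqP da ai ac; case/and3P: Wb => /eqP db bj bc.
by exists a, b; split; split; rewrite ?d5 ?all5 ?inE ?eqxx ?orbT.
Qed.

End Ends.

(** The gadgets share the end c and hence a middle, whose only neighbours are the other middle, p
    and c. So j has to be p. *)
Lemma gadget_third_nbr p u v c u' v' j : gadget e p u v c -> gadget e c u' v' j ->
  j != p -> False.
Proof.
move=> gad gad' jp.
have [_ dj] := gadget_ends crit (gadget_swap gad').
have := gadget_end_unique crit (gadget_swap gad) gad'.
have [_ _ _ u'j _ _ _ _] := gad'.
have [uq _ _ _ _ _ du dv] := gad.
have uj w w' : gadget e p w w' c -> e w j -> False.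
  move=> gw /(gadget_nbr gw); have [_ _ _ _ _ _ _ dw'] := gw.
  have [_ _ _ _ _ _ du' _] := gad'.
  rewrite !inE (negPf jp) /= => /orP[/eqP jw'|/eqP jc].
    by rewrite jw' dw' in dj.
  by have [] := gad'; rewrite jc /= !inE eqxx ?orbT ?andbF.
rewrite !inE => /orP[/eqP E|/eqP E]; rewrite E in u'j; first exact: (uj _ _ gad u'j).
exact: (uj _ _ (gadget_flip crit gad) u'j).
Qed.

Section EndGadget.
Variables (Q : seq T) (i c j l : T).
Hypothesis Q_mem : Q =i [:: i; c; j; l].
Hypothesis Q_uniq : uniq [:: i; c; j; l].
Hypotheses (ij : e i j) (cl : e c l).
Hypothesis nbr_c : forall s, e c s ->
  [\/ s \in [:: i; j; l], link Q s i c | link Q s c j].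
Hypothesis nbr_j : forall s, e j s ->
  [\/ s \in [:: i; c; l], link Q s c j | link Q s j l].
Hypothesis no2_c : forall w, e c w -> deg e w != 2.
Hypothesis no2_j : forall w, e j w -> deg e w != 2.

Let i_c : i != c. Proof. by move: Q_uniq; rewrite /= !inE !negb_or => /and4P[/and3P[]]. Qed.
Let i_j : i != j. Proof. by move: Q_uniq; rewrite /= !inE !negb_or => /and4P[/and3P[]]. Qed.
Let i_l : i != l. Proof. by move: Q_uniq; rewrite /= !inE !negb_or => /and4P[/and3P[]]. Qed.
Let c_j : c != j. Proof. by move: Q_uniq; rewrite /= !inE !negb_or => /and4P[_ /andP[]]. Qed.
Let c_l : c != l. Proof. by move: Q_uniq; rewrite /= !inE !negb_or => /and4P[_ /andP[]]. Qed.
Let j_l : j != l. Proof. by move: Q_uniq; rewrite /= !inE !negb_or => /and4P[]. Qed.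

(* A gadget at the crossing vertex c exhausts the degree 5 of c. *)
Lemma end_gadget_all p u v : gadget e c u v p -> p \in [:: i; j] ->
  forall w, w \in [:: i; j; l; u; v] -> e c w.
Proof.
move=> gad p_ij; have [_ dc] := gadget_ends crit gad.
apply: deg_eq_size; last by rewrite dc.
have uniq_end a b z : gadget e c a b z -> a \in [:: i; j; l; u; v].
  by move=> /(gadget_end_unique crit gad); rewrite !inE => ->; rewrite ?orbT.
move=> s cs; case: (nbr_c cs) => [|[[ds _ _]|[b [gs _ _]]]|[[ds _ _]|[b [gs _ _]]]].
- by rewrite !inE => /or3P[] ->; rewrite ?orbT.
- by have := no2_c cs; rewrite ds.
- exact: uniq_end (gadget_swap gs).
- by have := no2_c cs; rewrite ds.
- exact: uniq_end gs.
Qed.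

(** The gadget makes c adjacent to i and j. Next to j there is then either a gadget on the side of
    l, which gives two opposite gadgets, or nothing but i, c, l, in which case d(j) = 3. *)
Lemma crossing_side_gadget u v : gadget e i u v c -> u \notin Q -> v \notin Q -> False.
Proof.
move=> gad uQ vQ; have gad' := gadget_swap gad.
have all_c := @end_gadget_all i u v gad'.
have cj : e c j by apply: all_c; rewrite !inE eqxx ?orbT.
have ci : e c i by apply: all_c; rewrite !inE eqxx ?orbT.
have jc : e j c by rewrite e_sym.
have ic : e i c by rewrite e_sym.
move: (uQ) (vQ); rewrite !Q_mem !inE !negb_or => /and4P[ui uc uj ul] /and4P[vi vc vj vl].
have uv : u != v by have [] := gad; rewrite /= !inE !negb_or => /and4P[/and3P[]].
have no_cj s b : ~ gadget e c s b j.
  by move=> gs; apply: (gadget_third_nbr gad gs); rewrite eq_sym.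
have [_ di] := gadget_ends crit gad; have [_ dc] := gadget_ends crit gad'.
have [_ _ _ _ _ _ du dv] := gad.
have sub_j s : e j s -> s \in [:: i; c; l] \/ link Q s j l.
  move=> js; case: (nbr_j js) => [|[[ds _ _]|[b [gs _ _]]]|]; [by left | | | by right].
    by have := no2_j js; rewrite ds.
  by case: (no_cj _ _ gs).
case: (pselect (exists s, e j s /\ link Q s j l)) => [[a [ja lnk]]|none].
  case: lnk => [[da _ _]|[b [gab aQ bQ]]]; first by have := no2_j ja; rewrite da.
  have [_ dj] := gadget_ends crit gab; have [_ dl] := gadget_ends crit (gadget_swap gab).
  have [_ ab aj al bj bl da db] := gab.
  have jl : e j l.
    apply: (deg_eq_size (s := [:: i; c; l; a; b])); last by rewrite !inE eqxx ?orbT.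
      move=> s /sub_j[|[[ds sj _]|[b' [/(gadget_end_unique crit gab)]]]].
      - by rewrite !inE => /or3P[] ->; rewrite ?orbT.
      - by have := no2_j (w := s); rewrite ds e_sym => /(_ sj).
      - by rewrite !inE => ->; rewrite ?orbT.
    by rewrite dj.
  have deg35 y z : deg e y = 5 -> deg e z = 3 -> z != y.
    by move=> dy dz; apply: (deg_neq (e := e)); rewrite dy dz.
  have nab w w' z : gadget e i w w' c -> e z j -> z != w.
    move=> gw zj; apply/eqP => E; rewrite E in zj; have := gadget_nbr gw zj.
    have [_ _ _ _ _ _ _ dw'] := gw; rewrite !inE.
    by rewrite (negPf (_ : j != w')) 1?eq_sym ?deg35 // ![j == _]eq_sym (negPf i_j) (negPf c_j).
  suff uq8 : uniq ([:: i; c; j; l] ++ [:: u; v; a; b]).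
    exact: (crossing_two_gadgets crit gad gab uq8).
  apply: (@uniq_deg_cat _ e _ _ 5 3); rewrite //= ?di ?dc ?dj ?dl ?du ?dv ?da ?db //.
  have bj' : e b j by []. have aj' : e a j by [].
  rewrite !inE !negb_or uv ![u == _]eq_sym ![v == _]eq_sym.
  rewrite (nab _ _ _ gad aj') (nab _ _ _ gad bj') (nab _ _ _ (gadget_flip crit gad) aj').
  by rewrite (nab _ _ _ (gadget_flip crit gad) bj') (edge_neq crit ab).
have {}sub_j s : e j s -> s \in [:: i; c; l].
  by move=> js; case: (sub_j s js) => // lnk; case: none; exists s.
have dj : deg e j = 3.
  apply/eqP; rewrite eqn_leq; apply/andP; split.
    by apply: leq_trans (deg_size sub_j) _; apply: size_undup.
  by rewrite ltn_neqAle eq_sym no2_c // (edge_deg_ge2 crit jc).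
have jl : e j l by apply: (deg_eq_size sub_j); rewrite ?dj // !inE eqxx ?orbT.
suff uq6 : uniq ([:: i; c; j; l] ++ [:: u; v]) by exact: (crossing_gadget crit gad uq6).
rewrite cat_uniq Q_uniq /= !inE !negb_or.
by rewrite ui uc uj ul vi vc vj vl uv.
Qed.

Lemma crossing_middle_gadget u v : gadget e c u v j -> u \notin Q -> v \notin Q ->
  (forall w, w \in [:: c; i; l; u; v] -> e j w) -> False.
Proof.
move=> gad uQ vQ all_j; have all_c := @end_gadget_all j u v gad.
have uq6 : uniq ([:: i; c; j; l] ++ [:: u; v]).
  move: (uQ) (vQ); rewrite !Q_mem !inE !negb_or => /and4P[ui uc uj ul] /and4P[vi vc vj vl].
  have uv : u != v by have [] := gad; rewrite /= !inE !negb_or => /and4P[/and3P[]].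
  rewrite cat_uniq Q_uniq /= !inE !negb_or.
  by rewrite ui uc uj ul vi vc vj vl uv.
apply: (crossing_inner_gadget crit gad uq6) => //.
- by rewrite e_sym all_c // !inE eqxx ?orbT.
- by rewrite all_c // !inE eqxx ?orbT.
- by rewrite all_j // !inE eqxx ?orbT.
Qed.

End EndGadget.

(** Reversing the line exchanges i with l and c with j, so every exclusion at c holds at j as well.
    Once all gaps are excluded, the neighbours of c and j lie among the four ends. *)
Lemma crossing_is_gadget (Q : seq T) i c j l : Q =i [:: i; c; j; l] ->
  uniq [:: i; c; j; l] -> e i j -> e c l ->
  (forall s, e c s -> [\/ s \in [:: i; j; l], link Q s i c | link Q s c j]) ->
  (forall s, e j s -> [\/ s \in [:: i; c; l], link Q s c j | link Q s j l]) ->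
  gadget e i c j l.
Proof.
move=> Q_mem uq ij cl nbr_c nbr_j.
have link_sym s p q : link Q s p q -> link Q s q p.
  case=> [[ds sp sq]|[v [/gadget_swap gad sQ vQ]]]; first by left.
  by right; exists v.
have uq' : uniq [:: l; j; c; i] by rewrite -rev_uniq.
have Q_mem' : Q =i [:: l; j; c; i] by move=> s; rewrite Q_mem -mem_rev.
have nbr_c' s : e c s -> [\/ s \in [:: l; j; i], link Q s j c | link Q s c i].
  case/nbr_c => [|/link_sym lnk|/link_sym lnk]; [|by constructor 3|by constructor 2].
  by move=> H; constructor 1; move: H; rewrite !inE => /or3P[] ->; rewrite ?orbT.
have nbr_j' s : e j s -> [\/ s \in [:: l; c; i], link Q s l j | link Q s j c].
  case/nbr_j => [|/link_sym lnk|/link_sym lnk]; [|by constructor 3|by constructor 2].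
  by move=> H; constructor 1; move: H; rewrite !inE => /or3P[] ->; rewrite ?orbT.
have ji : e j i by rewrite e_sym.
have lc : e l c by rewrite e_sym.
move: (uq); rewrite /= !inE !negb_or => /and4P[/and3P[i_c i_j i_l] /andP[c_j c_l] j_l _].
have no2_c w : e c w -> deg e w != 2.
  move=> cw; apply/eqP => dw.
  have [w1 [w2 [[d1 w1i w1c d2 [w2c w2j]] [ci cj dc]]]] := ends_2vertices uq nbr_c cw dw.
  have jw2 : e j w2 by rewrite e_sym.
  have [w3 [_ [[d3 w3l w3j _ _] [jl _ _]]]] := ends_2vertices uq' nbr_j' jw2 d2.
  (* A 2-vertex at c forces one in each of the first two gaps; the one between c and j is adjacent
     to j and forces a third beyond j. *)
  suff uq7 : uniq ([:: i; c; j; l] ++ [:: w1; w2; w3]).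
    by apply: (crossing_2vertices crit uq7) => //; rewrite e_sym.
  have deg5 x w' : e w' x -> deg e w' = 2 -> deg e x != 2.
    by move=> w'x d; have := edge_deg2 crit w'x; rewrite d => /(_ isT); case: eqP => // ->.
  rewrite cat_uniq uq andTb; apply/andP; split.
    have notin w' : deg e w' = 2 -> w' \notin [:: i; c; j; l].
      move=> d; rewrite !inE !negb_or; apply/and4P; split; apply: (deg_neq (e := e)); rewrite d eq_sym.
      - exact: deg5 w1i d1.
      - exact: deg5 w1c d1.
      - exact: deg5 w2j d2.
      - exact: deg5 w3l d3.
    apply/hasPn => w' w'_in; apply: notin.
    by move: w'_in; rewrite !inE => /or3P[]/eqP ->.
  rewrite /= !inE negb_or andbT; apply/andP; split; [apply/andP; split|];
    apply: contraNneq i_j => E.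
  - have := nbr2 d1 i_c w1i w1c (_ : e w1 j); rewrite E => /(_ w2j).
    by rewrite !inE ![j == _]eq_sym (negPf c_j) orbF.
  - have := nbr2 d1 i_c w1i w1c (_ : e w1 j); rewrite E => /(_ w3j).
    by rewrite !inE ![j == _]eq_sym (negPf c_j) orbF.
  - have := nbr2 d2 c_j w2c w2j (_ : e w2 l); rewrite E => /(_ w3l).
    by rewrite !inE ![l == _]eq_sym (negPf c_l) (negPf j_l).
have no2_j w : e j w -> deg e w != 2.
  move=> jw; apply/eqP => dw.
  have [_ [w2 [[_ _ _ d2 [_ w2c]] _]]] := ends_2vertices uq' nbr_j' jw dw.
  by have := no2_c w2; rewrite e_sym d2 => /(_ w2c).
have no_side_c s : ~ link Q s i c.
  case=> [[ds _ sc]|[v [gad sQ vQ]]]; first by have := no2_c s; rewrite e_sym ds => /(_ sc).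
  exact: (crossing_side_gadget Q_mem uq ij cl nbr_c nbr_j no2_c no2_j gad).
have no_side_j s : ~ link Q s l j.
  case=> [[ds _ sc]|[v [gad sQ vQ]]]; first by have := no2_j s; rewrite e_sym ds => /(_ sc).
  exact: (crossing_side_gadget Q_mem' uq' lc ji nbr_j' nbr_c' no2_j no2_c gad).
have no_mid s : ~ link Q s c j.
  case=> [[ds sc _]|[v [gad sQ vQ]]]; first by have := no2_c s; rewrite e_sym ds => /(_ sc).
  apply: (crossing_middle_gadget Q_mem uq ij cl nbr_c no2_c gad sQ vQ) => w w_in.
  apply: (end_gadget_all (i := l) (l := i) nbr_j' no2_j (gadget_swap gad)).
    by rewrite !inE eqxx ?orbT.
  by move: w_in; rewrite !inE => /or4P[|||/orP[]] ->; rewrite ?orbT.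
have sub_c s : e c s -> s \in [:: i; j; l].
  by case/nbr_c => // [/no_side_c|/no_mid].
have sub_j s : e j s -> s \in [:: i; c; l].
  by case/nbr_j => // [/no_mid|/link_sym/no_side_j].
have ge2_c := edge_deg_ge2 crit cl; have ge2_j := edge_deg_ge2 crit ji.
have le3_c : deg e c <= 3 by apply: leq_trans (deg_size sub_c) _; apply: size_undup.
have le3_j : deg e j <= 3 by apply: leq_trans (deg_size sub_j) _; apply: size_undup.
(* If c and j are adjacent they are the middles of a gadget with ends i and l; otherwise they are
   two 2-vertices with the same neighbours. *)
have [cj|ncj] := boolP (e c j).
  have dc : deg e c = 3.
    apply/eqP; rewrite eqn_leq le3_c ltn_neqAle ge2_c andbT eq_sym.
    by apply: no2_j; rewrite e_sym.
  have dj : deg e j = 3.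
    by apply/eqP; rewrite eqn_leq le3_j ltn_neqAle ge2_j andbT eq_sym no2_c.
  have all_c := deg_eq_size sub_c dc; have all_j := deg_eq_size sub_j dj.
  split=> //; try by [apply: all_c; rewrite !inE eqxx ?orbT | apply: all_j; rewrite !inE eqxx ?orbT].
  rewrite /= !inE !negb_or c_j c_l j_l i_l ![_ == i]eq_sym.
  by rewrite i_c i_j.
have sub2_c s : e c s -> s \in [:: i; l].
  move=> cs; have := sub_c s cs; rewrite !inE => /or3P[->|/eqP sj|->]; rewrite ?orbT //.
  by rewrite -sj cs in ncj.
have sub2_j s : e j s -> s \in [:: i; l].
  move=> js; have := sub_j s js; rewrite !inE => /or3P[->|/eqP sc|->]; rewrite ?orbT //.
  by rewrite -sc e_sym js in ncj.
have dc : deg e c = 2.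
  by apply/eqP; rewrite eqn_leq ge2_c andbT; apply: leq_trans (deg_size sub2_c) _; apply: size_undup.
have dj : deg e j = 2.
  by apply/eqP; rewrite eqn_leq ge2_j andbT; apply: leq_trans (deg_size sub2_j) _; apply: size_undup.
have all_c := deg_eq_size sub2_c dc; have all_j := deg_eq_size sub2_j dj.
by case: (no_double_2path crit c_j i_l _ _ _ _ dc dj);
  [apply: all_c | apply: all_c | apply: all_j | apply: all_j]; rewrite !inE eqxx ?orbT.
Qed.

End Crossing.

(** * One-planar orders *)

Definition between (a b c : nat) := (a < c < b) || (b < c < a).
Definition outside (a b c : nat) := (c < a) && (c < b) || (a < c) && (b < c).
Definition crossing (a b c d : nat) :=
  between a b c && outside a b d || between a b d && outside a b c.

(* The vertices are placed on a line by [x]; equivalently on a circle, since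
   [crossing] does not change under cyclic rotations. *)
Definition one_planar_order (T : finType) (e : rel T) (x : T -> nat) :=
  forall a b c d c' d', e a b -> e c d -> e c' d' ->
    crossing (x a) (x b) (x c) (x d) -> crossing (x a) (x b) (x c') (x d') ->
    [set c; d]%SET = [set c'; d']%SET.

Lemma between_crossing a b c d : between a b c -> outside a b d -> crossing a b c d.
Proof. by rewrite /crossing => -> ->. Qed.

Section Structure.
Variables (T : finType) (C : eqType).
Variables (e : rel T) (L : {set T} -> seq C) (k : nat).
Hypothesis crit : critical e L k.
Variable x : T -> nat.
Hypothesis x_inj : injective x.
Hypothesis x_1p : one_planar_order e x.
Let e_sym : symmetric e := crit_sym crit.
Let e_irr : irreflexive e := crit_irr crit.
Implicit Types (i c j l s t u v w p q r z : T) (a b : nat).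

Definition ordered_gadget i u v j := gadget e i u v j /\ x i < x u < x v /\ x v < x j.

(** The positions matter: both middles lie between the ends, so that the edges iv and uj cross; the
    two cases are mirror images. *)
Definition inner_gadget u :=
  exists i v j, gadget e i u v j /\ ((x i < x u < x v /\ x v < x j) \/
                                     (x j < x v < x u /\ x u < x i)).

Definition regular t := 3 <= deg e t /\ ~ inner_gadget t.

Definition enclosed a b := forall t s, a < x t < b -> e t s -> a <= x s <= b.

Definition gadget_crossings a b := forall p q r s, a < x p < b -> e p q -> e r s ->
  crossing (x p) (x q) (x r) (x s) ->
  exists i u v j, ordered_gadget i u v j /\
    ((elem p q = elem i v /\ elem r s = elem u j) \/
     (elem p q = elem u j /\ elem r s = elem i v)).

Lemma inner_gadget_left i u v j : ordered_gadget i u v j -> inner_gadget u.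
Proof. by move=> [gad ord]; exists i, v, j; split=> //; left. Qed.

Lemma inner_gadget_right i u v j : ordered_gadget i u v j -> inner_gadget v.
Proof.
move=> [gad ord]; exists j, u, i; split; last by right.
exact/(gadget_flip crit)/gadget_swap.
Qed.

Lemma inner_gadget_deg u : inner_gadget u -> deg e u = 3.
Proof. by move=> [i [v [j [[]]]]]. Qed.

Lemma deg_regular t : 5 <= deg e t -> regular t.
Proof.
move=> d5; split; first by apply: leq_trans d5.
by move=> /inner_gadget_deg d3; rewrite d3 in d5.
Qed.

Lemma inner_gadget_nbr s t : inner_gadget s -> e s t ->
  inner_gadget t \/ exists v y, gadget e t s v y.
Proof.
move=> [i [v [j [gad ord]]]] st; have := gadget_nbr gad st; rewrite !inE.
case/or3P => /eqP ->; last by right; exists v, i; apply: gadget_swap.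
  left; exists j, s, i; split; last by case: ord; [right | left].
  exact/(gadget_flip crit)/gadget_swap.
by right; exists v, j.
Qed.

Section Interval.
Variables (a b : nat).
Hypotheses (encl : enclosed a b) (gcr : gadget_crossings a b).

(** The vertices whose joining chord to a regular vertex t closes off a smaller enclosed
    interval. *)
Definition anchor s := a <= x s <= b /\ (regular s \/ x s = a \/ x s = b).

(** An edge that leaves the interval crosses ts, so both belong to a gadget. As t is not a middle, s
    is one, hence an end of the interval; but then the crossing edge runs past it and contradicts
    [encl]. *)
Lemma enclosed_edge t s : a < x t < b -> regular t -> e t s -> anchor s ->
  enclosed (minn (x t) (x s)) (maxn (x t) (x s)).
Proof.
move=> t_in t_reg ts [s_in s_anch] p q p_in pq; apply: contrapT => q_out.
have cr : crossing (x t) (x s) (x p) (x q).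
  by apply: between_crossing; move: p_in q_out; clear; rewrite /between /outside; lia.
have [i [u [v [j [og [[E1 E2]|[E1 E2]]]]]]] := gcr t_in ts pq cr.
  have [gad ord] := og; have [_ uv ui uj vi vj _ _] := gad.
  case: (elem_inj E1) => -[tE sE]; last first.
    by case: t_reg => _ []; rewrite tE; apply: inner_gadget_right og.
  have sb : x s = b.
    case: s_anch => [[_ []]|]; first by rewrite sE; apply: inner_gadget_right og.
    by move: t_in ord; rewrite -tE -sE; clear; lia.
  have := encl (t := u) (s := j) _ uj; move: t_in ord; rewrite -tE -sE sb.
  clear => t_in ord H; have {}H : a <= x j <= b by apply: H; lia.
  by lia.
have [gad ord] := og; have [_ uv ui uj vi vj _ _] := gad.
case: (elem_inj E1) => -[tE sE].
  by case: t_reg => _ []; rewrite tE; apply: inner_gadget_left og.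
have sa : x s = a.
  case: s_anch => [[_ []]|]; first by rewrite sE; apply: inner_gadget_left og.
  by move: t_in ord; rewrite -tE -sE; clear; lia.
have := encl (t := v) (s := i) _ vi; move: t_in ord; rewrite -tE -sE sa.
clear => t_in ord H; have {}H : a <= x i <= b by apply: H; lia.
by lia.
Qed.

Lemma deg2_not_gadget w p i u v j : deg e w = 2 -> ordered_gadget i u v j ->
  elem w p = elem i v \/ elem w p = elem u j -> False.
Proof.
move=> dw [gad _]; have [_ di] := gadget_ends crit gad.
have [_ dj] := gadget_ends crit (gadget_swap gad); have [_ _ _ _ _ _ du dv] := gad.
by case=> /elem_inj [] [wE _]; rewrite wE ?di ?dj ?du ?dv in dw.
Qed.

(** The path t w z acts as a chord: an edge that separates t from z crosses one of its two edges.
    That crossing would lie in a gadget, whose vertices have degree 3 or 5. *)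
Lemma enclosed_2path t w z : a < x w < b -> deg e w = 2 -> e w t -> e w z -> t != z ->
  enclosed (minn (x t) (x z)) (maxn (x t) (x z)).
Proof.
move=> w_in dw wt wz tz p q p_in pq; apply: contrapT => q_out.
have nbr_w s : e w s -> s = t \/ s = z.
  by move/(nbr2 dw tz wt wz); rewrite !inE => /orP[]/eqP; [left|right].
have wp : x w <> x p.
  move=> /x_inj E; rewrite -E in pq; move: q_out.
  by case: (nbr_w _ pq) => ->; clear; lia.
have wq : x w <> x q.
  move=> /x_inj E; rewrite -E e_sym in pq; move: p_in.
  by case: (nbr_w _ pq) => ->; clear; lia.
have w_t : x w <> x t by move=> /x_inj E; rewrite E e_irr in wt.
have w_z : x w <> x z by move=> /x_inj E; rewrite E e_irr in wz.
have [cr|cr] : crossing (x w) (x t) (x p) (x q) \/ crossing (x w) (x z) (x p) (x q).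
- move: p_in q_out wp wq w_t w_z; clear; rewrite /crossing /between /outside.
  move: (x w) (x t) (x z) (x p) (x q) => W Tt Z P Q.
  by case: (leqP Tt Z) => ?; case: (ltngtP W P) => // ?; lia.
- have [i [u [v [j [og [[E1 E2]|[E1 E2]]]]]]] := gcr w_in wt pq cr;
  by apply: (deg2_not_gadget dw og); first [left; exact: E1 | right; exact: E1].
- have [i [u [v [j [og [[E1 E2]|[E1 E2]]]]]]] := gcr w_in wz pq cr;
  by apply: (deg2_not_gadget dw og); first [left; exact: E1 | right; exact: E1].
Qed.

Lemma enclosed_sub a' b' : a <= a' -> b' <= b -> gadget_crossings a' b'.
Proof.
by move=> aa' bb' p q r s p_in; apply: gcr; move: p_in aa' bb'; clear; lia.
Qed.

End Interval.

Lemma deg2_other w t : 2 <= deg e w -> exists2 z, e w z & z != t.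
Proof.
move=> dw; have [z] : exists z, z \in [set s | e w s] :\ t.
  apply/set0Pn; rewrite -card_gt0; move: dw; rewrite /deg (cardsD1 t).
  by case: (_ \in _); clear; lia.
by rewrite !finset.inE => /andP[zt wz]; exists z.
Qed.

(** By induction on the length of the interval, no regular vertex lies strictly below a chord or
    2-path that closes off a smaller interval at t. Hence t has at most one partner on each side,
    and its degree can be counted. *)
Lemma no_regular n a b : b - a <= n -> enclosed a b -> gadget_crossings a b ->
  forall t, a < x t < b -> ~ regular t.
Proof.
elim: n a b => [|n IH] a b n_ge encl gcr t t_in t_reg.
  by move: n_ge t_in; clear; lia.
pose linked z := [/\ anchor a b z, z != t & enclosed (minn (x t) (x z)) (maxn (x t) (x z))].
have gap z1 z2 : linked z1 -> anchor a b z2 ->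
    minn (x t) (x z1) < x z2 < maxn (x t) (x z1) -> False.
  move=> [[z1_in _] _ encl1] [z2_in z2_anch] z2_bt.
  have z2_reg : regular z2.
    by case: z2_anch => // H; move: H t_in z1_in z2_bt; clear; lia.
  apply: (IH _ _ _ encl1 _ z2 z2_bt z2_reg).
    by move: n_ge t_in z1_in; clear; lia.
  by apply: (enclosed_sub gcr); move: t_in z1_in; clear; lia.
(* Of two partners on the same side, the nearer one would be a regular vertex inside the smaller
   interval. *)
have side z1 z2 : linked z1 -> linked z2 -> (x z1 < x t) = (x z2 < x t) -> z1 = z2.
  move=> l1 l2 eq_side; apply/x_inj/eqP/negPn/negP => neq.
  have [a1 t1 _] := l1; have [a2 t2 _] := l2.
  have {}t1 : x z1 <> x t by move=> /x_inj E; rewrite E eqxx in t1.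
  have {}t2 : x z2 <> x t by move=> /x_inj E; rewrite E eqxx in t2.
  have [H|H] : (minn (x t) (x z1) < x z2 < maxn (x t) (x z1)) \/
               (minn (x t) (x z2) < x z1 < maxn (x t) (x z2)).
  - by move: eq_side neq t1 t2; clear; lia.
  - exact: gap H.
  - exact: gap H.
have card2 (S : {set T}) (f : T -> T) : (forall s, s \in S -> linked (f s)) ->
    {in S &, injective f} -> #|S| <= 2.
  move=> f_linked f_inj; rewrite -card_bool.
  rewrite -(card_in_imset (f := fun s => x (f s) < x t) (D := mem S)).
    exact: max_card.
  by move=> s s' sS s'S eq; apply: (f_inj s s' sS s'S); apply: side eq; apply: f_linked.
pose in2 s := (a < x s < b) && (deg e s == 2).
have nbr_t s : e t s -> [\/ in2 s, linked s | exists v y, gadget e t s v y].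
  move=> ts; have s_in := encl _ _ t_in ts; have st : e s t by rewrite e_sym.
  have s_t : s != t by rewrite (edge_neq crit).
  case: (boolP (in2 s)) => [|not2]; first by constructor 1.
  have to_linked : anchor a b s -> linked s by move=> s_anch; split=> //; exact: (enclosed_edge encl gcr t_in t_reg ts s_anch).
  case: (boolP (a < x s < b)) => [s_int|s_bd]; last first.
    constructor 2; apply: to_linked; split=> //; right.
    by move: s_in s_bd; clear; lia.
  have s3 : 3 <= deg e s.
    rewrite ltn_neqAle (edge_deg_ge2 crit st) andbT eq_sym.
    by move: not2; rewrite /in2 s_int.
  case: (pselect (inner_gadget s)) => [|s_ng]; last by constructor 2; apply: to_linked; split=> //; left.
  by move=> /inner_gadget_nbr /(_ st) [/(proj2 t_reg)//|]; constructor 3.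
pose N := [set s | e t s].
(* A gadget at t gives d(t) = 5, but only two middles and at most two linked vertices are
   available. *)
case: (pselect (exists s v y, gadget e t s v y)) => [[u [v [y gad]]]|none].
  have [_ dt] := gadget_ends crit gad.
  have : #|N :\: [set u; v]| <= 2.
    apply: (card2 _ id) => // s; rewrite !finset.inE negb_or => /andP[/andP[su sv] ts].
    case: (nbr_t s ts) => // [/andP[_ /eqP ds]|[v' [y' gad']]].
      by case: (gadget_no_2nbr crit gad ts ds).
    by have := gadget_end_unique crit gad gad'; rewrite !inE (negPf su) (negPf sv).
  have := cardsID [set u; v] N; rewrite -/(deg e t) dt.
  have : #|N :&: [set u; v]| <= 2.
    by apply: leq_trans (subset_leq_card (finset.subsetIr _ _)) _; rewrite cards2; case: eqP.
  by clear; lia.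
have linked_N s : e t s -> ~~ in2 s -> linked s.
  move=> ts s2; case: (nbr_t s ts) => // [|[v [y gad]]]; first by rewrite (negPf s2).
  by case: none; exists s, v, y.
pose S := [set s in N | in2 s].
have card1 : #|N :\: S| <= 2.
  apply: (card2 _ id) => // s; rewrite !finset.inE => /andP[s2 ts].
  by apply: linked_N => //; rewrite ts /= in s2.
have := cardsID S N; rewrite -/(deg e t) (finset.setIidPr _); last first.
  by apply/fintype.subsetP => s; rewrite finset.inE => /andP[].
have [S0|[w]] := set_0Vmem S.
  by rewrite S0 cards0; move: card1 (proj1 t_reg); rewrite S0; clear; lia.
rewrite !finset.inE => /andP[tw /andP[_ /eqP dw]].
have dt : 5 <= deg e t by apply: (edge_deg2 crit (u := w)); rewrite ?dw // e_sym.
(* A 2-vertex next to t is charged to its second neighbour, a linked vertex; [no_double_2path] makes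
   this injective. So t has at most two such neighbours and degree at most 4, against [dt]. *)
have other s : {z | 2 <= deg e s -> e s z /\ z != t}.
  apply: cid; case: (boolP (2 <= deg e s)) => [/(deg2_other t)[z]|_]; last by exists s.
  by exists z.
have card_S : #|S| <= 2.
  have sP s : s \in S -> [/\ e s t, e s (sval (other s)), sval (other s) != t, deg e s = 2 & a < x s < b].
    rewrite !finset.inE => /andP[ts /andP[s_in /eqP ds]].
    by case: (other s) => z /=; rewrite ds => /(_ isT) [sz zt]; split=> //; rewrite e_sym.
  apply: (card2 _ (fun s => sval (other s))) => [s sS|s s' sS s'S eq].
    have [st sz zt ds s_in] := sP s sS; split=> //; last by apply: (enclosed_2path gcr s_in) => //; rewrite eq_sym.
    split; first exact: encl s_in sz.
    by left; apply: deg_regular; apply: (edge_deg2 crit sz); rewrite ds.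
  have [st sz zt ds _] := sP s sS; have [s't s'z _ ds' _] := sP s' s'S.
  rewrite -eq in s'z; apply/eqP/negPn/negP => ss'; rewrite eq_sym in zt.
  exact: (no_double_2path crit ss' zt st sz s't s'z ds ds').
by move: card1 card_S dt; clear; lia.
Qed.

(** A vertex in the gap is not regular, so it has degree 2 or is a middle of a gadget. Its
    neighbours other than a second middle have degree at least 5, hence are regular and can only be
    [p] and [q]. *)
Lemma gap_nbr p q : enclosed (x p) (x q) -> gadget_crossings (x p) (x q) ->
  forall s t, x p < x s < x q -> e s t ->
  [/\ deg e s = 2, e s p & e s q] \/
  exists v, gadget e p s v q /\ x p < x v < x q.
Proof.
move=> encl gcr s t s_in st.
have no_reg := no_regular (leqnn _) encl gcr.
have at_end y z : x p < x y < x q -> e y z -> 5 <= deg e z -> z = p \/ z = q.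
  move=> y_in yz z5; have z_in := encl _ _ y_in yz.
  have : ~ x p < x z < x q by move=> /no_reg[]; apply: deg_regular.
  move=> H; have [E|E] : x z = x p \/ x z = x q by move: z_in H; clear; lia.
    by left; apply: x_inj.
  by right; apply: x_inj.
case: (ltngtP (deg e s) 2) => [s2|s3|s2]; first by have := edge_deg_ge2 crit st; rewrite leqNgt s2.
  case: (pselect (inner_gadget s)) => [|s_ng]; last by case: (no_reg s s_in).
  move=> [i [v [j [gad _]]]]; right; exists v.
  have [_ di] := gadget_ends crit gad; have [_ dj] := gadget_ends crit (gadget_swap gad).
  have [uq sv si sj vi vj ds dv] := gad.
  have vin z : deg e z = 5 -> v != z.
    by move=> dz; apply: (deg_neq (e := e)); rewrite dv dz.
  have ij : i != j by move: uq; rewrite /= !inE => /and4P[].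
  have pq_ends : (i = p /\ j = q) \/ (i = q /\ j = p).
    case: (at_end _ _ s_in si) => [|iE|iE]; first by rewrite di.
      case: (at_end _ _ s_in sj) => [|jE|jE]; first by rewrite dj.
        by rewrite iE jE eqxx in ij.
      by left.
    case: (at_end _ _ s_in sj) => [|jE|jE]; first by rewrite dj.
      by right.
    by rewrite iE jE eqxx in ij.
  have v_in := encl _ _ s_in sv.
  have v_bd z : deg e z = 5 -> x v <> x z by move=> /vin vz /x_inj E; rewrite E eqxx in vz.
  have [vi' vj'] := (v_bd _ di, v_bd _ dj).
  case: pq_ends => -[iE jE]; rewrite iE jE in gad vi' vj'; split;
    try (by move: v_in vi' vj'; clear; lia); first exact: gad.
  exact: gadget_swap.
left; have [y sy yt] := deg2_other t (eq_leq (esym s2)).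
have [t5 y5] : 5 <= deg e t /\ 5 <= deg e y.
  by split; apply: (edge_deg2 crit (u := s)); rewrite ?s2.
by case: (at_end _ _ s_in st t5) (at_end _ _ s_in sy y5) => tE [] yE; split=> //;
   rewrite -?tE -?yE //; rewrite tE yE eqxx in yt.
Qed.

Lemma crossing_sorted p q r s : e p q -> e r s -> crossing (x p) (x q) (x r) (x s) ->
  exists i c j l, [/\ x i < x c < x j, x j < x l, e i j, e c l &
    (elem p q = elem i j /\ elem r s = elem c l) \/
    (elem p q = elem c l /\ elem r s = elem i j)].
Proof.
wlog pq_lt : p q / x p < x q.
  move=> IH pq rs cr; case: (ltngtP (x p) (x q)) => [lt|lt|eq]; first exact: IH.
    rewrite elemC; apply: IH => //; first by rewrite e_sym.
    by move: cr; rewrite /crossing /between /outside; clear; lia.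
  by move: cr; rewrite eq /crossing /between /outside; clear; lia.
wlog rs_lt : r s / x r < x s.
  move=> IH pq rs cr; case: (ltngtP (x r) (x s)) => [lt|lt|eq]; first exact: IH.
    rewrite [elem r s]elemC; apply: IH => //; first by rewrite e_sym.
    by move: cr; rewrite /crossing /between /outside; clear; lia.
  by move: cr; rewrite eq /crossing /between /outside; clear; lia.
move=> pq rs cr; have [H|H] : (x p < x r < x q /\ x q < x s) \/ (x r < x p < x s /\ x s < x q).
- by move: cr pq_lt rs_lt; rewrite /crossing /between /outside; clear; lia.
- by exists p, r, q, s; case: H => H1 H2; split=> //; left.
- by exists r, p, s, q; case: H => H1 H2; split=> //; right.
Qed.

(** Induction on the span of the crossing. Since ij and cl cross only each other, edges from inside
    a gap stay there; crossings within a gap have smaller span and lie in gadgets, so [gap_nbr]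
    describes all three gaps. *)
Lemma all_crossings_gadget n i c j l : x l - x i <= n -> x i < x c < x j -> x j < x l ->
  e i j -> e c l -> gadget e i c j l.
Proof.
elim: n i c j l => [|n IH] i c j l n_ge icj jl ij cl.
  by move: n_ge icj jl; clear; lia.
have gap_crossings a b : x i <= a -> b <= x l -> b - a < x l - x i -> enclosed a b ->
    gadget_crossings a b.
  move=> ia bl ab encl p q r s p_in pq rs cr.
  have q_in := encl _ _ p_in pq.
  have [r_in s_in] : a <= x r <= b /\ a <= x s <= b.
    have [r_int|s_int] : a < x r < b \/ a < x s < b.
    - by move: cr p_in q_in; rewrite /crossing /between /outside; clear; lia.
    - by split; [move: r_int; clear; lia | exact: encl r_int rs].
    - split; last by move: s_int; clear; lia.
      by apply: encl s_int _; rewrite e_sym.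
  have [i' [c' [j' [l' [ord1 ord2 ij' cl' eqs]]]]] := crossing_sorted pq rs cr.
  exists i', c', j', l'; split=> //; split=> //.
  have ends z : z \in elem p q \/ z \in elem r s -> a <= x z <= b.
    by rewrite !elem_in => -[]/orP[]/eqP -> //; move: p_in; clear; lia.
  have i'_in : a <= x i' <= b.
    by apply: ends; case: eqs => -[-> ->]; rewrite !elem_in !eqxx; [left|right].
  have l'_in : a <= x l' <= b.
    by apply: ends; case: eqs => -[-> ->]; rewrite !elem_in !eqxx ?orbT; [right|left].
  apply: IH => //; move: n_ge ab i'_in l'_in ord1 ord2; clear; lia.
have x_c : crossing (x i) (x j) (x c) (x l).
  by move: icj jl; rewrite /crossing /between /outside; clear; lia.
have x_c' : crossing (x c) (x l) (x i) (x j).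
  by move: icj jl; rewrite /crossing /between /outside; clear; lia.
have only_ij t s : e t s -> crossing (x i) (x j) (x t) (x s) -> t \in elem c l.
  by move=> ts cr; rewrite -[elem c l](x_1p ij ts cl cr x_c) elem_in eqxx.
have only_cl t s : e t s -> crossing (x c) (x l) (x t) (x s) -> t \in elem i j.
  by move=> ts cr; rewrite -[elem i j](x_1p cl ts ij cr x_c') elem_in eqxx.
have encl_gap a b : (forall t, a < x t < b -> x t <> x i /\ x t <> x c /\ x t <> x j /\ x t <> x l) ->
    (forall t s : nat, a < t < b -> ~ (a <= s <= b) -> crossing (x i) (x j) t s \/ crossing (x c) (x l) t s) ->
    enclosed a b.
  move=> t_neq cr t s t_in ts; apply: contrapT => s_out.
  have [ti [tc [tj tl]]] := t_neq t t_in.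
  case: (cr _ _ t_in s_out) => [/(only_ij _ _ ts)|/(only_cl _ _ ts)];
  by rewrite elem_in => /orP[]/eqP E; rewrite E in ti tc tj tl.
have encl1 : enclosed (x i) (x c).
  apply: encl_gap => [t|t s]; move: icj jl; rewrite /crossing /between /outside; clear; lia.
have encl2 : enclosed (x c) (x j).
  apply: encl_gap => [t|t s]; move: icj jl; rewrite /crossing /between /outside; clear; lia.
have encl3 : enclosed (x j) (x l).
  apply: encl_gap => [t|t s]; move: icj jl; rewrite /crossing /between /outside; clear; lia.
have gcr1 : gadget_crossings (x i) (x c).
  by apply: gap_crossings encl1; move: icj jl; clear; lia.
have gcr2 : gadget_crossings (x c) (x j).
  by apply: gap_crossings encl2; move: icj jl; clear; lia.
have gcr3 : gadget_crossings (x j) (x l).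
  by apply: gap_crossings encl3; move: icj jl; clear; lia.
pose Q := [:: i; c; j; l].
have not_Q a b s : (a, b) \in [:: (x i, x c); (x c, x j); (x j, x l)] -> a < x s < b -> s \notin Q.
  move=> ab s_in; apply/negP; rewrite !inE => /or4P[]/eqP E; rewrite E in s_in;
  move: ab s_in icj jl; rewrite !inE => /or3P[]/eqP[-> ->]; clear; lia.
have gap_link p q s t : (x p, x q) \in [:: (x i, x c); (x c, x j); (x j, x l)] ->
    enclosed (x p) (x q) -> gadget_crossings (x p) (x q) -> x p < x s < x q -> e s t ->
    link e Q s p q.
  move=> pq encl gcr s_in st; case: (gap_nbr encl gcr s_in st) => [|[v [gad v_in]]]; first by left.
  by right; exists v; split=> //; apply: not_Q pq _.
have uq : uniq Q.
  have neq p q : x p <> x q -> p != q by move=> H; apply/eqP => E; rewrite E in H.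
  by rewrite /= !inE !negb_or !neq //; move: icj jl; clear; lia.
apply: (crossing_is_gadget crit (Q := Q)) => // s.
  move=> cs; have sc : e s c by rewrite e_sym.
  have s_c : x s <> x c by move=> /x_inj E; rewrite E e_irr in cs.
  have [|[|[|[|[|]]]]] : x i < x s < x c \/ x c < x s < x j \/ x s = x i \/ x s = x j \/ x s = x l \/
     crossing (x i) (x j) (x s) (x c) /\ x s <> x l.
  - by move: s_c icj jl; rewrite /crossing /between /outside; clear; lia.
  - by move=> s_in; constructor 2; apply: gap_link sc; rewrite // !inE eqxx ?orbT.
  - by move=> s_in; constructor 3; apply: gap_link sc; rewrite // !inE eqxx ?orbT.
  - by move/x_inj ->; constructor 1; rewrite !inE eqxx.
  - by move/x_inj ->; constructor 1; rewrite !inE eqxx ?orbT.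
  - by move/x_inj ->; constructor 1; rewrite !inE eqxx ?orbT.
  - by move=> [/(only_ij _ _ sc) + sl]; rewrite elem_in => /orP[]/eqP E; rewrite E in s_c sl.
move=> js; have sj : e s j by rewrite e_sym.
have s_j : x s <> x j by move=> /x_inj E; rewrite E e_irr in js.
have [|[|[|[|[|]]]]] : x c < x s < x j \/ x j < x s < x l \/ x s = x i \/ x s = x c \/ x s = x l \/
   crossing (x c) (x l) (x s) (x j) /\ x s <> x i.
- by move: s_j icj jl; rewrite /crossing /between /outside; clear; lia.
- by move=> s_in; constructor 2; apply: gap_link sj; rewrite // !inE eqxx ?orbT.
- by move=> s_in; constructor 3; apply: gap_link sj; rewrite // !inE eqxx ?orbT.
- by move/x_inj ->; constructor 1; rewrite !inE eqxx.
- by move/x_inj ->; constructor 1; rewrite !inE eqxx ?orbT.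
- by move/x_inj ->; constructor 1; rewrite !inE eqxx ?orbT.
- by move=> [/(only_cl _ _ sj) + si]; rewrite elem_in => /orP[]/eqP E; rewrite E in s_j si.
Qed.

(* Edges exist in a critical graph; an end of high degree of one of them would
   be regular. *)
Lemma order_not_critical : (exists u v, e u v) -> (forall t, 0 < x t) -> False.
Proof.
move=> [u [v uv]] x_gt0; pose M := (\max_t x t).+1.
have in_M t : 0 < x t < M by rewrite x_gt0 ltnS; apply: leq_bigmax.
have encl : enclosed 0 M by move=> t s _ _; have := in_M s; clear; lia.
have gcr : gadget_crossings 0 M.
  move=> p q r s _ pq rs cr.
  have [i [c [j [l [ord1 ord2 ij cl eqs]]]]] := crossing_sorted pq rs cr.
  exists i, c, j, l; split=> //; split=> //.
  exact: all_crossings_gadget (leqnn _) ord1 ord2 ij cl.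
have no_reg t : ~ regular t := no_regular (leqnn _) encl gcr (in_M t).
have no5 t : 5 <= deg e t -> False by move=> /deg_regular; apply: no_reg.
case: (ltngtP (deg e u) 2) => [u2|u3|u2]; first by have := edge_deg_ge2 crit uv; rewrite leqNgt u2.
  case: (pselect (inner_gadget u)) => [|u_ng]; last by case: (no_reg u).
  move=> [i [w [j [gad _]]]]; have [_ di] := gadget_ends crit gad.
  by apply: (no5 i); rewrite di.
by apply: (no5 v); apply: (edge_deg2 crit uv); rewrite u2.
Qed.

End Structure.

Lemma edgeless_colorable (T : finType) (C : eqType) (e : rel T) (L : {set T} -> seq C) (t0 : T) :
  symmetric e -> (forall u v, ~~ e u v) ->
  (forall A, A \in elements e -> 0 < size (L A)) -> colorable e L.
Proof.
move=> e_sym e0 L_gt0.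
have [c0 _] : exists c, c \in L (elem t0 t0).
  by have := L_gt0 _ (vertex_element e t0); case: (L _) => // c l _; exists c; rewrite mem_head.
exists (fun A => head c0 (L A)); split=> [A /L_gt0|A B].
  by case: (L A) => //= c l _ _; rewrite mem_head.
case/elementsP => a [b [ab ->]]; case/elementsP => c [d [cd ->]] _ _ clash_AB.
have {}ab : a = b by move: ab; rewrite (negPf (e0 a b)) orbF => /eqP.
have {}cd : c = d by move: cd; rewrite (negPf (e0 c d)) orbF => /eqP.
have := clash_cases e_sym clash_AB; rewrite ab cd (negPf (e0 _ _)) !andbF orbF !orbb => /eqP bd.
by move: clash_AB; rewrite ab cd bd /clash eqxx.
Qed.

Lemma ordered_colorable (T : finType) (C : eqType) (e : rel T) (L : {set T} -> seq C)
    (x : T -> nat) (k : nat) (t0 : T) :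
  symmetric e -> irreflexive e -> injective x -> one_planar_order e x ->
  6 <= k -> (forall u, deg e u < k) ->
  (forall A, A \in elements e -> k <= size (undup (L A))) -> colorable e L.
Proof.
move=> + + x_inj + k6.
have [n] := ubnP #|[set p : T * T | e p.1 p.2]|; elim: n e => // n IH e e_card e_sym e_irr x_1p deg_lt L_size.
have L_gt0 A : A \in elements e -> 0 < size (L A).
  by move=> /L_size le; apply: leq_trans (size_undup _); apply: leq_trans le; apply: leq_trans k6.
case: (pselect (exists u v, e u v)) => [has_edge|none]; last first.
  apply: (edgeless_colorable t0 e_sym) => // u v; apply/negP => uv.
  by apply: none; exists u, v.
apply: contrapT => not_col.
have crit : critical e L k.
  split=> // e' e'_sym sub [u [v /andP[uv nuv]]]; apply: IH => //.
  - rewrite ltnS in e_card; apply: (leq_trans _ e_card); apply: proper_card; apply/properP; split.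
      by apply/fintype.subsetP => p; rewrite !finset.inE => /sub.
    by exists (u, v); rewrite finset.inE.
  - by move=> w; apply/negP => /sub; rewrite e_irr.
  - by move=> a b c d c' d' /sub ab /sub cd /sub cd'; apply: x_1p.
  - move=> w; apply: leq_ltn_trans (deg_lt w); apply: subset_leq_card.
    by apply/fintype.subsetP => z; rewrite !finset.inE => /sub.
  - move=> A /elementsP[a [b [ab ->]]]; apply: L_size; apply/elementsP; exists a, b; split=> //.
    by case/orP: ab => [->//|/sub ->]; rewrite orbT.
(* The shift by one puts all vertices strictly inside an interval that starts at 0. *)
apply: (order_not_critical (x := fun t => (x t).+1) crit) => //.
- by move=> a b [] /x_inj.
Qed.

(** * Gluing orders at cut vertices *)

Definition rotate (N p m : nat) := if m < p then m + N else m.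

Lemma ltn_rotate N p a b : a < N -> b < N ->
  (rotate N p a < rotate N p b) = if (a < p) == (b < p) then a < b else b < p.
Proof.
rewrite /rotate => aN bN; case: (ltnP a p) => ap; case: (ltnP b p) => bp //=.
- by rewrite ltn_add2r.
- by rewrite ltnNge ltnW // ltn_addl.
- by rewrite ltn_addl.
Qed.

(** In this form each comparison depends on the sides of [p], as in [ltn_rotate], so
    [crossing_rotate] reduces to sixteen propositional cases. *)
Lemma ltn_split p a b : (a < b) = if (a < p) == (b < p) then a < b else a < p.
Proof.
case: (ltnP a p) => ap; case: (ltnP b p) => bp //=; first exact: leq_trans bp.
by rewrite ltnNge ltnW // (leq_trans bp).
Qed.

Lemma crossing_rotate N p a b c d : a < N -> b < N -> c < N -> d < N ->
  crossing (rotate N p a) (rotate N p b) (rotate N p c) (rotate N p d) = crossing a b c d.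
Proof.
rewrite /crossing /between /outside => aN bN cN dN; rewrite !ltn_rotate //.
rewrite (ltn_split p a c) (ltn_split p c a) (ltn_split p b c) (ltn_split p c b).
rewrite (ltn_split p a d) (ltn_split p d a) (ltn_split p b d) (ltn_split p d b).
by case: (a < p); case: (b < p); case: (c < p); case: (d < p) => //=;
  rewrite ?andbT ?andbF ?orbF //= 1?orbC; congr (_ || _); rewrite andbC.
Qed.

Section Glue.
Variables (T : finType) (e : rel T).
Hypothesis e_sym : symmetric e.
Implicit Types (X Y Z B : {set T}) (u v w : T).

Definition ordered_on B := exists x : T -> nat,
  {in B &, injective x} /\ one_planar_order (induced e B) x.

Lemma ordered_on_sub B X : X \subset B -> ordered_on B -> ordered_on X.
Proof.
move=> /fintype.subsetP sub [x [x_inj x_1p]]; exists x; split.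
  by move=> u v /sub uB /sub vB; apply: x_inj.
have ind a b : induced e X a b -> induced e B a b.
  by case/and3P => /sub aB /sub bB ab; rewrite /induced /= aB bB.
by move=> a b c d c' d' /ind ab /ind cd /ind cd'; apply: x_1p.
Qed.

Lemma order_bound (x : T -> nat) : exists N, forall w, x w < N.
Proof. by exists (\max_w x w).+1 => w; rewrite ltnS; apply: leq_bigmax. Qed.

Lemma rotate_last B v : v \in B -> ordered_on B -> exists x : T -> nat,
  [/\ {in B &, injective x}, one_planar_order (induced e B) x &
      {in B, forall w, x w <= x v}].
Proof.
move=> vB [x [x_inj x_1p]]; have [N N_gt] := order_bound x.
exists (rotate N (x v).+1 \o x); split=> /=.
- move=> a b aB bB E; apply: x_inj => //; move: E (N_gt a) (N_gt b).
  rewrite /rotate; clear.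
  by case: (ltnP (x a) _) => ?; case: (ltnP (x b) _) => ?; lia.
- by move=> a b c d c' d' ab cd cd'; rewrite !crossing_rotate //; apply: x_1p.
- move=> w wB; rewrite /rotate leqnn !ltnS; case: (leqP (x w) (x v)) => [le|_]; first by rewrite leq_add2r.
  by rewrite (leq_trans (ltnW (N_gt w))) ?leq_addl.
Qed.

Lemma rotate_first B v : v \in B -> ordered_on B -> exists x : T -> nat,
  [/\ {in B &, injective x}, one_planar_order (induced e B) x &
      {in B, forall w, x v <= x w}].
Proof.
move=> vB [x [x_inj x_1p]]; have [N N_gt] := order_bound x.
exists (rotate N (x v) \o x); split=> /=.
- move=> a b aB bB E; apply: x_inj => //; move: E (N_gt a) (N_gt b).
  rewrite /rotate; clear.
  by case: (ltnP (x a) (x v)) => ?; case: (ltnP (x b) (x v)) => ?; lia.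
- by move=> a b c d c' d' ab cd cd'; rewrite !crossing_rotate //; apply: x_1p.
- move=> w wB; rewrite /rotate ltnn; case: (ltnP (x w) (x v)) => // _.
  by rewrite (leq_trans (ltnW (N_gt v))) ?leq_addl.
Qed.

(** With v last in Y and first in Z, no vertex of Y comes after a vertex of Z, so edges of different
    parts never cross. The vertex v may be absent from a part, which covers disjoint unions. *)
Lemma glue_orders X Y Z v :
  X \subset Y :|: Z -> Y :&: Z \subset [set v] ->
  (forall a b, a \in X -> b \in X -> e a b ->
     (a \in Y) && (b \in Y) || (a \in Z) && (b \in Z)) ->
  ordered_on Y -> ordered_on Z -> ordered_on X.
Proof.
move=> /fintype.subsetP XYZ /fintype.subsetP YZv X_edges oY oZ.
have YZ w : w \in Y -> w \in Z -> w = v.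
  by move=> wY wZ; apply/eqP; rewrite -finset.in_set1 YZv // finset.inE wY.
have [y [y_inj y_1p y_last]] : exists y : T -> nat,
    [/\ {in Y &, injective y}, one_planar_order (induced e Y) y &
        v \in Y -> {in Y, forall w, y w <= y v}].
  case vY: (v \in Y); first by have [y [? ? ?]] := rotate_last vY oY; exists y.
  by have [y [? ?]] := oY; exists y.
have [z [z_inj z_1p z_first]] : exists z : T -> nat,
    [/\ {in Z &, injective z}, one_planar_order (induced e Z) z &
        v \in Z -> {in Z, forall w, z v <= z w}].
  case vZ: (v \in Z); first by have [z [? ? ?]] := rotate_first vZ oZ; exists z.
  by have [z [? ?]] := oZ; exists z.
have [N N_gt] := order_bound y.
(* A shared vertex v keeps its position from Y; it precedes the rest of Z, where it was first
   anyway. *)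
pose x w := if w \in Y then y w else N + z w.
have xY w : w \in Y -> x w = y w by rewrite /x => ->.
have x_Z w w' : w \in Z -> w' \in Z -> (x w < x w') = (z w < z w').
  move=> wZ w'Z; rewrite /x; case: ifP => wY; case: ifP => w'Y.
  - by rewrite (YZ _ wY wZ) (YZ _ w'Y w'Z) !ltnn.
  - have wv := YZ _ wY wZ; rewrite wv in wY wZ *; rewrite ltn_addr //.
    rewrite ltn_neqAle z_first // andbT; apply/esym/eqP => /z_inj E.
    by rewrite -E // wY in w'Y.
  - have wv := YZ _ w'Y w'Z; rewrite wv in w'Y w'Z *.
    by apply/idP/idP; have := z_first w'Z w wZ; have := N_gt v; clear; lia.
  - by rewrite ltn_add2l.
have cr_Z a b c d : a \in Z -> b \in Z -> c \in Z -> d \in Z ->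
    crossing (x a) (x b) (x c) (x d) = crossing (z a) (z b) (z c) (z d).
  by move=> aZ bZ cZ dZ; rewrite /crossing /between /outside !x_Z.
have no_cr a b c d : a \in Y -> b \in Y -> c \in Z -> d \in Z ->
    crossing (x a) (x b) (x c) (x d) = false.
  have ge w w' : w \in Y -> w' \in Z -> x w <= x w'.
    move=> wY w'Z; rewrite /x wY; case: ifP => [w'Y|_].
      by have w'v := YZ _ w'Y w'Z; rewrite w'v; apply: y_last; rewrite -?w'v.
    by have := N_gt w; clear; lia.
  move=> aY bY cZ dZ; move: (ge a c aY cZ) (ge b c bY cZ) (ge a d aY dZ) (ge b d bY dZ).
  by rewrite /crossing /between /outside; clear; lia.
have crC a b c d : crossing a b c d = crossing c d a b.
  by rewrite /crossing /between /outside; clear; lia.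
exists x; split.
  move=> a b aX bX; rewrite /x; case: ifP => aY; case: ifP => bY.
  - exact: y_inj.
  - by have := N_gt a; clear; lia.
  - by have := N_gt b; clear; lia.
  - move/addnI; apply: z_inj.
      by have := XYZ a aX; rewrite finset.inE aY.
    by have := XYZ b bX; rewrite finset.inE bY.
have side a b : induced e X a b -> induced e Y a b \/ induced e Z a b.
  by case/and3P => aX bX ab; case/orP: (X_edges a b aX bX ab) => /andP[aE bE]; [left|right];
    rewrite /induced /= aE bE.
move=> a b c d c' d' /side[/and3P[aY bY ab]|/and3P[aZ bZ ab]] /side cd /side cd' cr cr'.
  have inY p q : induced e Y p q \/ induced e Z p q -> crossing (x a) (x b) (x p) (x q) ->
      induced e Y p q.
    by case=> // /and3P[pZ qZ _]; rewrite no_cr.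
  have cdY := inY _ _ cd cr; have cdY' := inY _ _ cd' cr'.
  have abY : induced e Y a b by rewrite /induced /= aY bY.
  have [/and3P[cY dY _] /and3P[cY' dY' _]] := (cdY, cdY').
  by rewrite !xY // in cr cr'; apply: y_1p cr cr'.
have inZ p q : induced e Y p q \/ induced e Z p q -> crossing (x a) (x b) (x p) (x q) ->
    induced e Z p q.
  by case=> // /and3P[pY qY _]; rewrite crC no_cr.
have cdZ := inZ _ _ cd cr; have cdZ' := inZ _ _ cd' cr'.
have abZ : induced e Z a b by rewrite /induced /= aZ bZ.
have [/and3P[cZ dZ _] /and3P[cZ' dZ' _]] := (cdZ, cdZ').
by rewrite !cr_Z // in cr cr'; apply: z_1p cr cr'.
Qed.

Lemma disconnected_split X : ~~ connected_on e X -> exists Y,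
  [/\ Y \subset X, Y != finset.set0, Y != X &
      forall a b, a \in Y -> b \in X -> e a b -> b \in Y].
Proof.
case/forall_inPn => u uX /forall_inPn[w wX nuw].
exists [set t in X | connect (induced e X) u t]; split.
- by apply/fintype.subsetP => t; rewrite finset.inE => /andP[].
- by apply/set0Pn; exists u; rewrite finset.inE uX connect0.
- by apply/eqP => /setP/(_ w); rewrite finset.inE wX (negPf nuw).
- move=> a b; rewrite !finset.inE => /andP[aX ua] bX ab; rewrite bX /=.
  by apply: connect_trans ua _; apply: connect1; rewrite /induced /= aX bX.
Qed.

Lemma ordered_on_all : (forall B, nonseparable e B -> ordered_on B) ->
  forall X, ordered_on X.
Proof.
move=> blocks X; have [n] := ubnP #|X|; elim: n X => // n IH X X_card; rewrite ltnS in X_card.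
have [->|X0] := eqVneq X finset.set0.
  by exists (fun=> 0); split=> [a b|a b c d c' d' /and3P[]]; rewrite finset.inE.
have smaller Y : Y \proper X -> ordered_on Y.
  by move=> /proper_card lt; apply: IH; apply: leq_trans lt X_card.
case: (boolP (nonseparable e X)) => [/blocks//|].
rewrite /nonseparable X0 /= negb_and.
case/orP => [/disconnected_split|/forall_inPn[v vX /disconnected_split]].
  move=> [Y [YX Y0 YneqX Y_closed]]; have [u uY] := set0Pn _ Y0.
  have Y_prop : Y \proper X by rewrite finset.properEneq YneqX.
  have D_prop : X :\: Y \proper X.
    apply/properP; split; first exact: finset.subsetDl.
    by exists u; rewrite ?finset.inE ?uY // (fintype.subsetP YX).
  (* The two parts are disjoint; [u] only stands in for the shared vertex. *)
  apply: (@glue_orders X Y (X :\: Y) u); try exact: smaller.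
  - by apply/fintype.subsetP => z zX; rewrite !finset.inE zX; case: (z \in Y).
  - by apply/fintype.subsetP => z; rewrite !finset.inE; case: (z \in Y).
  - move=> a b aX bX ab; rewrite !finset.inE aX bX !andbT.
    case aY: (a \in Y); first by rewrite (Y_closed a).
    by case bY: (b \in Y) => //; rewrite (Y_closed b) // e_sym in aY.
move=> [Y [YX Y0 YneqX Y_closed]]; have [u uY] := set0Pn _ Y0.
have YX' z : z \in Y -> z != v /\ z \in X.
  by move=> zY; have := fintype.subsetP YX z zY; rewrite !finset.inE => /andP.
have [w wX wY] : exists2 w, w \in X :\ v & w \notin Y.
  have : Y \proper X :\ v by rewrite finset.properEneq YneqX.
  by case/properP => _ [w wX wY]; exists w.
have [wv {}wX] : w != v /\ w \in X by move: wX; rewrite !finset.inE => /andP.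
(* Y is separated from the rest once v is removed; v itself belongs to both parts. *)
apply: (@glue_orders X (v |: Y) (X :\: Y) v); try apply: smaller.
- by apply/fintype.subsetP => z zX; rewrite !finset.inE zX; case: (z \in Y); rewrite ?orbT.
- apply/fintype.subsetP => z; rewrite !finset.inE.
  by case: (z \in Y); rewrite ?andbF ?orbF //= => /andP[].
- move=> a b aX bX ab; rewrite !finset.inE aX bX !andbT.
  have in_Xv z : z != v -> z \in X -> z \in X :\ v by rewrite !finset.inE => -> ->.
  have vY : v \notin Y by apply/negP => /YX'; rewrite eqxx => -[].
  have [->|av] := eqVneq a v; have [->|bv] := eqVneq b v => //=; rewrite ?(negPf vY) ?andbT ?orbT //=.
  + by case: (b \in Y).
  + by case: (a \in Y).
  + case aY: (a \in Y); first by rewrite (Y_closed a) // in_Xv.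
    by case bY: (b \in Y) => //; rewrite (Y_closed b) ?in_Xv // e_sym in aY.
- apply/properP; split; first by rewrite finset.subUset finset.sub1set vX; apply/fintype.subsetP => z /YX'[].
  by exists w => //; rewrite !finset.inE negb_or wv.
- apply/properP; split; first exact: finset.subsetDl.
  by exists u; rewrite ?finset.inE ?uY //; case: (YX' u uY).
Qed.

End Glue.

(** * Crossing paths in a square *)

Section Labelling.
Import Order.TTheory GRing.Theory Num.Theory.
Local Open Scope ring_scope.

Inductive direction := East | North | West | South.

Definition opposite (a b : direction) : bool :=
  match a, b with
  | East, West | West, East | North, South | South, North => true
  | _, _ => false
  end.

(* Signed number of quarter turns from [a] to [b]. *)
Definition turn (a b : direction) : int :=
  match a, b with
  | East, North | North, West | West, South | South, East => 1
  | North, East | West, North | South, West | East, South => -1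
  | _, _ => 0
  end.

(** Without opposite pairs the four labels take at most two values, neighbouring directions, so
    every turn is a difference of angles. *)
Lemma turn_cell a b c d :
  ~~ opposite a b -> ~~ opposite a c -> ~~ opposite a d ->
  ~~ opposite b c -> ~~ opposite b d -> ~~ opposite c d ->
  turn a b + turn b d = turn a c + turn c d.
Proof. by case: a; case: b; case: c; case: d. Qed.

Lemma turn_path (n : nat) (f : nat -> direction) (h : direction -> int) :
  (forall i, (i < n)%N -> turn (f i) (f i.+1) = h (f i.+1) - h (f i)) ->
  \sum_(0 <= i < n) turn (f i) (f i.+1) = h (f n) - h (f 0%N).
Proof.
move=> turn_h; rewrite -(telescope_sumr (fun i => h (f i))) //.
by rewrite !big_nat; apply: eq_bigr => i /andP[_ /turn_h].
Qed.

(* The total turn along the boundary of the grid vanishes because it does so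
   around each cell, but the boundary conditions make it a full turn. *)
Lemma no_grid_labelling (n : nat) (f : nat -> nat -> direction) :
  (forall i j, (i < n)%N -> (j < n)%N -> forall (a b c d : bool),
     ~~ opposite (f (i + a) (j + b))%N (f (i + c) (j + d))%N) ->
  (0 < n)%N ->
  (forall j, (j <= n)%N -> f 0%N j <> East) -> (forall j, (j <= n)%N -> f n j <> West) ->
  (forall i, (i <= n)%N -> f i 0%N <> South) -> (forall i, (i <= n)%N -> f i n <> North) ->
  False.
Proof.
move=> adj n_gt0 left right bottom top.
have cell i j : (i < n)%N -> (j < n)%N ->
    turn (f i j) (f i.+1 j) + turn (f i.+1 j) (f i.+1 j.+1) =
    turn (f i j) (f i j.+1) + turn (f i j.+1) (f i.+1 j.+1).
  move=> i_lt j_lt; have := adj i j i_lt j_lt => A.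
  have := (A false false true false, A false false false true, A false false true true,
           A true false false true, A true false true true, A false true true true).
  by rewrite !addn0 !addn1 => -[[[[[? ?] ?] ?] ?] ?]; apply: turn_cell.
pose H j := \sum_(0 <= i < n) turn (f i j) (f i.+1 j).
have row j : (j < n)%N ->
    H j + turn (f n j) (f n j.+1) = turn (f 0%N j) (f 0%N j.+1) + H j.+1.
  move=> j_lt; rewrite /H.
  suff row_m m : (m <= n)%N ->
      \sum_(0 <= i < m) turn (f i j) (f i.+1 j) + turn (f m j) (f m j.+1) =
      turn (f 0%N j) (f 0%N j.+1) + \sum_(0 <= i < m) turn (f i j.+1) (f i.+1 j.+1).
    exact: row_m.
  elim: m => [|m IH] m_le; first by rewrite !big_geq // add0r addr0.
  rewrite !big_nat_recr //= addrA -IH ?(ltnW m_le) // -!addrA; congr (_ + _).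
  exact: cell.
have total : H 0%N + \sum_(0 <= j < n) turn (f n j) (f n j.+1) =
    \sum_(0 <= j < n) turn (f 0%N j) (f 0%N j.+1) + H n.
  suff tot m : (m <= n)%N -> H 0%N + \sum_(0 <= j < m) turn (f n j) (f n j.+1) =
      \sum_(0 <= j < m) turn (f 0%N j) (f 0%N j.+1) + H m by exact: tot.
  elim: m => [|m IH] m_le; first by rewrite !big_geq // add0r addr0.
  by rewrite !big_nat_recr //= addrA IH ?(ltnW m_le) // -!addrA row.
have adjh i j : (i < n)%N -> (j <= n)%N -> ~~ opposite (f i j) (f i.+1 j).
  move=> i_lt; case: j => [|j] j_le.
    by have := adj i 0%N i_lt n_gt0 false false true false; rewrite !addn0 addn1.
  by have := adj i j i_lt j_le false true true true; rewrite !addn1 addn0.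
have adjv i j : (i <= n)%N -> (j < n)%N -> ~~ opposite (f i j) (f i j.+1).
  case: i => [|i] i_le j_lt.
    by have := adj 0%N j n_gt0 j_lt false false false true; rewrite !addn0 addn1.
  by have := adj i j i_le j_lt true false true true; rewrite !addn1 addn0.
(* On each side one direction is excluded, so the other three lift to angles in quarter turns; the
   value at the excluded one is a dummy. The lifts for bottom, right, top and left agree at three
   corners and differ by 4 at the corner (n, n). *)
pose hb d : int := match d with East => 0 | North => 1 | West => 2 | South => 0 end.
pose hr d : int := match d with South => -1 | East => 0 | North => 1 | West => 0 end.
pose ht d : int := match d with West => 2 | South => 3 | East => 4 | North => 0 end.
pose hl d : int := match d with North => 1 | West => 2 | South => 3 | East => 0 end.
move: total; rewrite /H.
rewrite (@turn_path n (fun i => f i 0%N) hb) => [|i i_lt]; last first.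
  move: (adjh i 0%N i_lt isT) (bottom i (ltnW i_lt)) (bottom _ i_lt).
  by case: (f i 0%N); case: (f i.+1 0%N).
rewrite (@turn_path n (f n) hr) => [|j j_lt]; last first.
  move: (adjv n j (leqnn n) j_lt) (right j (ltnW j_lt)) (right _ j_lt).
  by case: (f n j); case: (f n j.+1).
rewrite (@turn_path n (f 0%N) hl) => [|j j_lt]; last first.
  move: (adjv 0%N j (leq0n n) j_lt) (left j (ltnW j_lt)) (left _ j_lt).
  by case: (f 0%N j); case: (f 0%N j.+1).
rewrite (@turn_path n (fun i => f i n) ht) => [|i i_lt]; last first.
  move: (adjh i n i_lt (leqnn n)) (top i (ltnW i_lt)) (top _ i_lt).
  by case: (f i n); case: (f i.+1 n).
move: (left 0%N isT) (bottom 0%N isT) (right 0%N isT) (bottom n (leqnn n)).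
move: (left n (leqnn n)) (top 0%N isT) (right n (leqnn n)) (top n (leqnn n)).
by case: (f 0%N 0%N) => //; case: (f 0%N n) => //; case: (f n 0%N) => //; case: (f n n).
Qed.

End Labelling.

Section Paths.
Import Order.TTheory GRing.Theory Num.Theory numFieldNormedType.Exports.
Local Open Scope classical_set_scope.
Local Open Scope ring_scope.
Variable R : realType.
Implicit Types (f u v p q : R -> R) (s t : R) (z : R * R).

Let square : set (R * R) := `[0, 1] `*` `[0, 1].

Let squareP z : square z <-> (0 <= z.1 <= 1) /\ (0 <= z.2 <= 1).
Proof. by rewrite /square /= !in_itv. Qed.

Let square_compact : compact square.
Proof. by apply: compact_setX; apply: segment_compact. Qed.

Let continuous_diff u v : continuous u -> continuous v ->
  continuous (fun z => `|u z.1 - v z.2|).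
Proof.
move=> cu cv z; apply: cvg_norm; apply: cvgB.
  by apply: (@cvg_comp _ _ _ fst u); [exact: cvg_fst | exact: cu].
by apply: (@cvg_comp _ _ _ snd v); [exact: cvg_snd | exact: cv].
Qed.

(** Among the pairs whose values differ by at least [eps], a compact set, the distance |s - t|
    attains a minimum, and this is positive. *)
Lemma unif_continuous_segment f (eps : R) : continuous f -> 0 < eps ->
  exists N : nat, forall n : nat, (N <= n)%N -> forall s t, 0 <= s <= 1 -> 0 <= t <= 1 ->
    `|s - t| <= n%:R^-1 -> `|f s - f t| < eps.
Proof.
move=> cf eps_gt0.
pose K := square `&` [set z | eps <= `|f z.1 - f z.2|].
have K_compact : compact K.
  apply: compact_closedI square_compact _.
  apply: (@closed_comp _ _ (fun z : R * R => `|f z.1 - f z.2|) [set x | eps <= x]).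
    by move=> z _; apply: continuous_diff.
  exact: closed_ge.
have [K0|K0] := eqVneq K set0.
  exists 0%N => n _ s t s01 t01 _; rewrite ltNge; apply/negP => ge.
  have : K (s, t) by split=> //; apply/squareP.
  by rewrite K0.
have diff_cont : {within K, continuous (fun z : R * R => `|z.1 - z.2|)}.
  by apply: continuous_subspaceT; apply: (continuous_diff (u := id) (v := id)) => ?; exact: cvg_id.
have [z] := compact_EVT_min (proj1 (set0P _) K0) K_compact diff_cont.
rewrite inE => -[z_sq /= z_ge] z_min.
have d_gt0 : 0 < `|z.1 - z.2|.
  rewrite normr_gt0 subr_eq0; apply/eqP => E; move: z_ge.
  by rewrite E subrr normr0 leNgt eps_gt0.
exists (Num.bound (`|z.1 - z.2|^-1)) => n n_ge s t s01 t01 st.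
rewrite ltNge; apply/negP => ge.
have : `|z.1 - z.2| <= `|s - t|.
  by apply: (z_min (s, t)); rewrite inE; split=> //; apply/squareP.
have bound_gt : `|z.1 - z.2|^-1 < n%:R.
  apply: (@lt_le_trans _ _ (Num.bound (`|z.1 - z.2|^-1))%:R); last by rewrite ler_nat.
  by apply: archi_boundP; rewrite invr_ge0.
rewrite leNgt => /negP; apply; apply: le_lt_trans st _.
by rewrite invf_plt ?posrE // (lt_trans _ bound_gt) // invr_gt0.
Qed.

(** If the paths (u, p) and (v, q) never met, the difference of their points would stay away from 0
    on the square of parameters (s, t), and its direction would label a fine grid against
    [no_grid_labelling]. *)
Lemma paths_meet u p v q :
  continuous u -> continuous p -> continuous v -> continuous q ->
  (forall t, 0 <= t <= 1 -> u 0 <= v t <= u 1) ->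
  (forall s, 0 <= s <= 1 -> q 0 <= p s <= q 1) ->
  exists s t, [/\ 0 <= s <= 1, 0 <= t <= 1, u s = v t & p s = q t].
Proof.
move=> cu cp cv cq v_in p_in; apply: contrapT => none.
have square0 : square !=set0 by exists (0, 0); apply/squareP; rewrite lexx ler01.
have [|c] := @compact_EVT_min _ R (fun z => `|u z.1 - v z.2| + `|p z.1 - q z.2|)
  square square0 square_compact.
  apply: continuous_subspaceT => z.
  by apply: cvgD; apply: continuous_diff.
rewrite inE => /squareP[c1 c2] c_min.
(* Half of the minimum, so that one of the two coordinates always has absolute value at least
   [eps]. *)
pose eps := (`|u c.1 - v c.2| + `|p c.1 - q c.2|) / 2.
have eps_gt0 : 0 < eps.
  rewrite divr_gt0 // lt_neqAle addr_ge0 // andbT eq_sym paddr_eq0 // !normr_eq0 !subr_eq0.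
  by apply/negP => /andP[/eqP E1 /eqP E2]; apply: none; exists c.1, c.2.
have far s t : 0 <= s <= 1 -> 0 <= t <= 1 ->
    eps <= `|u s - v t| \/ eps <= `|p s - q t|.
  move=> s01 t01; have := c_min (s, t); rewrite inE => /(_ _)/= H.
  have {}H := H (proj2 (squareP (s, t)) (conj s01 t01)).
  case: (leP eps `|u s - v t|) => [|lt1]; first by left.
  by right; rewrite /eps in lt1 *; lra.
have [Nu unif_u] := unif_continuous_segment cu eps_gt0.
have [Nv unif_v] := unif_continuous_segment cv eps_gt0.
have [Np unif_p] := unif_continuous_segment cp eps_gt0.
have [Nq unif_q] := unif_continuous_segment cq eps_gt0.
pose n := (maxn (maxn Nu Nv) (maxn Np Nq)).+1.
have [nu nv np nq] : [/\ Nu <= n, Nv <= n, Np <= n & Nq <= n]%N.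
  by rewrite /n; split; apply: leqW; rewrite !leq_max leqnn ?orbT.
pose x i : R := i%:R / n%:R.
have n_gt0 : 0 < n%:R :> R by rewrite ltr0n.
have x01 i : (i <= n)%N -> 0 <= x i <= 1.
  by move=> i_le; rewrite divr_ge0 //= ler_pdivrMr // mul1r ler_nat.
have x0 : x 0%N = 0 by rewrite /x mul0r.
have xn : x n = 1 by rewrite /x divff // gt_eqF.
have x_near i (a b : bool) : `|x (i + a)%N - x (i + b)%N| <= n%:R^-1.
  rewrite /x -mulrBl normrM [X in _ * X]ger0_norm ?invr_ge0 ?ler0n //.
  rewrite -[leRHS]mul1r ler_pM2r ?invr_gt0 //.
  by rewrite !natrD opprD addrACA subrr add0r; case: a; case: b;
    rewrite ?subrr ?subr0 ?sub0r ?normrN ?normr0 ?normr1.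
pose lab i j := let F := u (x i) - v (x j) in let G := p (x i) - q (x j) in
  if eps <= F then East else if F <= - eps then West else if eps <= G then North else South.
pose F i j := u (x i) - v (x j); pose G i j := p (x i) - q (x j).
have lab_spec i j : (i <= n)%N -> (j <= n)%N ->
    match lab i j with
    | East => eps <= F i j | West => F i j <= - eps
    | North => eps <= G i j | South => G i j <= - eps
    end.
  move=> i_le j_le; rewrite /lab -/(F i j) -/(G i j).
  case: leP => // F_lt; case: leP => // F_gt; case: leP => // G_lt.
  have := far _ _ (x01 i i_le) (x01 j j_le); rewrite !ler_normr -/(F i j) -/(G i j).
  by case=> /orP[]; lra.
have near f N : (forall n : nat, (N <= n)%N -> forall s t, 0 <= s <= 1 -> 0 <= t <= 1 ->
    `|s - t| <= n%:R^-1 -> `|f s - f t| < eps) -> (N <= n)%N ->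
    forall i (a b : bool), (i < n)%N -> - eps < f (x (i + a)%N) - f (x (i + b)%N) < eps.
  move=> unif_f N_le i a b i_lt; rewrite -ltr_norml; apply: (unif_f n) => //.
  - by apply: x01; case: a; rewrite ?addn1 // addn0 ltnW.
  - by apply: x01; case: b; rewrite ?addn1 // addn0 ltnW.
(* Opposite labels differ by 2 [eps] in a coordinate, while within a cell each of the two functions
   in it changes by less than [eps]. *)
apply: (@no_grid_labelling n lab) => // [i j i_lt j_lt a b c' d|j j_le|j j_le|i i_le|i i_le].
- have le i' (e : bool) : (i' < n)%N -> (i' + e <= n)%N.
    by case: e; rewrite ?addn1 // addn0 => /ltnW.
  have := lab_spec (i + a)%N (j + b)%N (le _ _ i_lt) (le _ _ j_lt).
  have := lab_spec (i + c')%N (j + d)%N (le _ _ i_lt) (le _ _ j_lt).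
  move: (near _ _ unif_u nu i a c' i_lt) (near _ _ unif_v nv j b d j_lt).
  move: (near _ _ unif_p np i a c' i_lt) (near _ _ unif_q nq j b d j_lt).
  by rewrite /F /G; case: (lab _ _); case: (lab _ _) => //=; lra.
- move=> E; have := lab_spec 0%N j (leq0n _) j_le; rewrite E /F x0.
  by have := v_in _ (x01 j j_le); lra.
- move=> E; have := lab_spec n j (leqnn _) j_le; rewrite E /F xn.
  by have := v_in _ (x01 j j_le); lra.
- move=> E; have := lab_spec i 0%N i_le (leq0n _); rewrite E /G x0.
  by have := p_in _ (x01 i i_le); lra.
- move=> E; have := lab_spec i n i_le (leqnn _); rewrite E /G xn.
  by have := p_in _ (x01 i i_le); lra.
Qed.

End Paths.

(** * Crossing arcs in a disk *)

Section Disk.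
Import Order.TTheory GRing.Theory Num.Theory numFieldNormedType.Exports.
Local Open Scope classical_set_scope.
Local Open Scope ring_scope.
Variable R : realType.
Implicit Types (a b c d s t x : R) (z w : R * R).

(** The half-angle parametrization of the circle without (-1, 0), which turns the cyclic order into
    the order of the reals. *)
Definition circle_point x : R * R := ((1 - x ^+ 2) / (1 + x ^+ 2), x *+ 2 / (1 + x ^+ 2)).

(* Up to a positive factor, the distance from z to the tangent of the circle at
   [circle_point x]. *)
Definition tangent_form x z : R := (1 - z.1) - x * z.2 *+ 2 + x ^+ 2 * (1 + z.1).

Lemma tangent_form_point x : tangent_form x (circle_point x) = 0.
Proof.
rewrite /tangent_form /circle_point /=.
have : 1 + x ^+ 2 != 0 by rewrite gt_eqF // ltr_wpDr // sqr_ge0.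
by move=> nz; field.
Qed.

Lemma tangent_form_gt0 a c z : z.1 ^+ 2 + z.2 ^+ 2 <= 1 -> a < c ->
  [/\ 0 <= tangent_form a z, 0 <= tangent_form c z & 0 < tangent_form a z + tangent_form c z].
Proof.
rewrite /tangent_form; case: z => z1 z2 /= disk ac.
have z1_ge : -1 <= z1 by nra.
have z1_le : z1 <= 1 by nra.
(* Times 1 + z1, the form is the defect of z from the circle plus a square. The squares for a and c
   cannot both vanish. *)
have form x : (1 + z1) * ((1 - z1) - x * z2 *+ 2 + x ^+ 2 * (1 + z1)) =
   (1 - z1 ^+ 2 - z2 ^+ 2) + (z2 - x * (1 + z1)) ^+ 2 by ring.
have [z1E|z1_neq] := eqVneq z1 (-1).
  have z2E : z2 = 0.
    by apply/eqP; rewrite -sqrf_eq0 eq_le sqr_ge0 andbT; move: disk; rewrite z1E; nra.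
  by rewrite z1E z2E; split; nra.
have z1_gt : 0 < 1 + z1 by move: z1_neq; rewrite neq_lt => /orP[]; lra.
have ge0 x : 0 <= (1 - z1) - x * z2 *+ 2 + x ^+ 2 * (1 + z1).
  by rewrite -(pmulr_rge0 _ z1_gt) form addr_ge0 ?sqr_ge0 //; lra.
split=> //; rewrite lt_neqAle addr_ge0 // andbT eq_sym paddr_eq0 //.
apply/negP => /andP[/eqP E1 /eqP E2].
have := form a; have := form c; rewrite E1 E2 !mulr0 => /esym F2 /esym F1.
have sq1 : (z2 - a * (1 + z1)) ^+ 2 = 0 by have := sqr_ge0 (z2 - a * (1 + z1)); lra.
have sq2 : (z2 - c * (1 + z1)) ^+ 2 = 0 by have := sqr_ge0 (z2 - c * (1 + z1)); lra.
move/eqP: sq1; move/eqP: sq2; rewrite !sqrf_eq0 => /eqP H2 /eqP H1.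
by nra.
Qed.

(** The equations say that the roots of n1 + 2 m x + n3 x^2 are harmonic to a, c and to b, d.
    Interleaved pairs have no real common harmonic pair, so the polynomial is 0. *)
Lemma apolar_interleaved a b c d (n1 m n3 : R) : a < b -> b < c -> c < d ->
  n1 + (a + c) * m + a * c * n3 = 0 -> n1 + (b + d) * m + b * d * n3 = 0 ->
  0 <= m ^+ 2 - n1 * n3 -> [/\ n1 = 0, m = 0 & n3 = 0].
Proof.
move=> ab bc cd e1 e2.
have -> : m ^+ 2 - n1 * n3 = (m + a * n3) * (m + c * n3).
  have E1 : n1 = - (a + c) * m - a * c * n3 by lra.
  by rewrite E1; ring.
move=> disc_ge0.
have eq_ac_bd : (m + a * n3) * (m + c * n3) = (m + b * n3) * (m + d * n3).
  have E1 : n1 = - (a + c) * m - a * c * n3 by lra.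
  have E2 : n1 * n3 = (- (b + d) * m - b * d * n3) * n3 by congr (_ * _); lra.
  have E3 : n1 * n3 = (- (a + c) * m - a * c * n3) * n3 by rewrite E1.
  by rewrite E2 in E3; lra.
have [n30|n3_neq] := eqVneq n3 0.
  have m0 : m * ((b + d) - (a + c)) = 0 by rewrite n30 in e1 e2; lra.
  have {}m0 : m = 0 by move/eqP: m0; rewrite mulf_eq0 => /orP[/eqP//|/eqP]; lra.
  by split=> //; move: e1; rewrite n30 m0; lra.
(* The midpoint of the two roots; it would have the same nonnegative power with respect to both
   pairs. *)
pose s := - m / n3.
have ms : m = - s * n3 by rewrite /s; field.
have sq : 0 < n3 ^+ 2 by rewrite lt_neqAle sqr_ge0 eq_sym sqrf_eq0 n3_neq.
have fact x y : (m + x * n3) * (m + y * n3) = n3 ^+ 2 * ((s - x) * (s - y)).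
  by rewrite ms; ring.
rewrite !fact in disc_ge0 eq_ac_bd.
have {}eq_ac_bd : (s - a) * (s - c) = (s - b) * (s - d).
  by apply: (mulfI (_ : n3 ^+ 2 != 0)) => //; rewrite gt_eqF.
have {}disc_ge0 : 0 <= (s - a) * (s - c) by rewrite -(pmulr_rge0 _ sq).
exfalso; have [sa|sa] := leP s a; first by nra.
have [ds|ds] := leP d s; first by nra.
have [cs|cs] := leP c s; nra.
Qed.

(* The plane spanned by two points of the cone a c >= b ^ 2 over the disk meets
   the cone, so its normal (n1, 2 m, n3) has nonnegative discriminant. *)
Lemma cone_normal_disc (x y z n1 m n3 : R) : 0 <= x -> 0 <= z -> 0 < x + z ->
  y ^+ 2 <= x * z -> n1 * x + m * y *+ 2 + n3 * z = 0 -> 0 <= m ^+ 2 - n1 * n3.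
Proof.
move=> x_ge0 z_ge0 xz_gt0 cone normal; rewrite leNgt; apply/negP => disc.
have sq : (n1 * x + n3 * z) ^+ 2 = 4 * m ^+ 2 * y ^+ 2.
  have -> : n1 * x + n3 * z = - (m * y *+ 2) by lra.
  by ring.
have le1 : 4 * m ^+ 2 * y ^+ 2 <= 4 * m ^+ 2 * (x * z).
  by apply: ler_wpM2l => //; have := sqr_ge0 m; lra.
have ge1 : 4 * (n1 * n3) * (x * z) <= (n1 * x + n3 * z) ^+ 2.
  by have := sqr_ge0 (n1 * x - n3 * z); nra.
have [xz0|xz_neq] := eqVneq (x * z) 0.
  have sq0 : (n1 * x + n3 * z) ^+ 2 = 0.
    by apply/eqP; rewrite eq_le sqr_ge0 andbT sq; move: le1; rewrite xz0 mulr0.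
  move/eqP: sq0; rewrite sqrf_eq0 => /eqP lin.
  move/eqP: xz0; rewrite mulf_eq0 => /orP[]/eqP E; rewrite E in lin xz_gt0.
    have n30 : n3 = 0.
      by move/eqP: lin; rewrite mulr0 add0r mulf_eq0 => /orP[/eqP//|/eqP]; lra.
    by rewrite n30 mulr0 subr0 in disc; have := sqr_ge0 m; lra.
  have n10 : n1 = 0.
    by move/eqP: lin; rewrite mulr0 addr0 mulf_eq0 => /orP[/eqP//|/eqP]; lra.
  by rewrite n10 mul0r subr0 in disc; have := sqr_ge0 m; lra.
have xz : 0 < x * z by rewrite lt_neqAle eq_sym xz_neq mulr_ge0.
have : 4 * m ^+ 2 * (x * z) < 4 * (n1 * n3) * (x * z) by rewrite ltr_pM2r //; lra.
by lra.
Qed.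

(* The two pencils of lines through the poles of the chords ac and bd separate
   the points of the disk, since the chords cross. *)
Lemma tangent_ratio_inj a b c d z w : a < b -> b < c -> c < d ->
  z.1 ^+ 2 + z.2 ^+ 2 <= 1 -> w.1 ^+ 2 + w.2 ^+ 2 <= 1 ->
  tangent_form a z * tangent_form c w = tangent_form c z * tangent_form a w ->
  tangent_form b z * tangent_form d w = tangent_form d z * tangent_form b w ->
  z = w.
Proof.
case: z => z1 z2; case: w => w1 w2 /= ab bc cd disk_z disk_w; rewrite /tangent_form /=.
move=> e_ac e_bd.
(* (n1, 2 m, n3) is the cross product of (1 + z1, z2, 1 - z1) and (1 + w1, w2, 1 - w1), the lifts of
   z and w to the cone. It vanishes only if z = w. *)
pose n1 := z2 * (1 - w1) - (1 - z1) * w2.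
pose m := ((1 - z1) * (1 + w1) - (1 + z1) * (1 - w1)) / 2.
pose n3 := (1 + z1) * w2 - z2 * (1 + w1).
have ac : c - a != 0 by rewrite subr_eq0 gt_eqF // (lt_trans ab).
have bd : d - b != 0 by rewrite subr_eq0 gt_eqF // (lt_trans bc).
pose Qz q := 1 - z1 - q * z2 *+ 2 + q ^+ 2 * (1 + z1).
pose Qw q := 1 - w1 - q * w2 *+ 2 + q ^+ 2 * (1 + w1).
have apolar p q : q - p != 0 -> Qz p * Qw q = Qz q * Qw p ->
    n1 + (p + q) * m + p * q * n3 = 0.
  move=> pq e_pq; apply: (mulfI pq); rewrite mulr0.
  have : 2 * ((q - p) * (n1 + (p + q) * m + p * q * n3)) = Qz p * Qw q - Qz q * Qw p.
    by rewrite /n1 /m /n3 /Qz /Qw; field.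
  by rewrite e_pq subrr; lra.
have disc : 0 <= m ^+ 2 - n1 * n3.
  apply: (@cone_normal_disc (1 + z1) z2 (1 - z1)); rewrite ?addrA; try nra.
  by rewrite /n1 /m /n3; field.
have [n10 m0 n30] := apolar_interleaved ab bc cd (apolar _ _ ac e_ac) (apolar _ _ bd e_bd) disc.
by congr pair; move: n10 m0 n30; rewrite /n1 /m /n3; lra.
Qed.

(** A retraction onto [0, 1], which turns arcs continuous on [0, 1] into the globally continuous
    maps that [paths_meet] expects. *)
Definition clamp t : R := Num.max 0 (Num.min 1 t).

Lemma clamp_in t : 0 <= clamp t <= 1.
Proof. by rewrite /clamp le_max lexx /= ge_max ler01 ge_min lexx. Qed.

Lemma clamp_id t : 0 <= t <= 1 -> clamp t = t.
Proof. by move=> /andP[t0 t1]; rewrite /clamp (min_idPr t1) (max_idPr t0). Qed.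

Lemma clamp_continuous : continuous clamp.
Proof.
move=> t; apply: continuous_max; first exact: cst_continuous.
by apply: continuous_min; [exact: cst_continuous | exact: cvg_id].
Qed.

Lemma clamp_comp_continuous (U : topologicalType) (f : R -> U) :
  {within `[0, 1], continuous f} -> continuous (f \o clamp).
Proof.
move=> /subspace_continuousP f_cont t.
have in01 s : [set` `[0, 1]] (clamp s) by rewrite /= in_itv; exact: clamp_in.
have t_in := in01 t.
apply: (@cvg_comp _ _ _ clamp f _ _ _ _ (f_cont _ t_in)) => A /= A_nbhs.
have near_t : nbhs t (fun s => [set` `[0, 1]] (clamp s) -> A (clamp s)).
  exact: clamp_continuous A_nbhs.
change (nbhs t (fun s => A (clamp s))).
by apply: filterS near_t => s; apply.
Qed.

(** The ratios for a, c and for b, d are coordinates that map the disk into the unit square. There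
    [f] runs from left to right and [g] from bottom to top, and by [tangent_ratio_inj] a common
    image is a common point. *)
Lemma ordered_arcs_meet (f g : R -> R * R) a b c d : a < b -> b < c -> c < d ->
  continuous f -> continuous g ->
  (forall t, (f t).1 ^+ 2 + (f t).2 ^+ 2 <= 1) ->
  (forall t, (g t).1 ^+ 2 + (g t).2 ^+ 2 <= 1) ->
  f 0 = circle_point a -> f 1 = circle_point c ->
  g 0 = circle_point b -> g 1 = circle_point d ->
  exists s t, [/\ 0 <= s <= 1, 0 <= t <= 1 & f s = g t].
Proof.
move=> ab bc cd f_cont g_cont f_disk g_disk f0 f1 g0 g1.
pose ratio p q z := tangent_form p z / (tangent_form p z + tangent_form q z).
have ratio_cont (h : R -> R * R) (p q : R) : p < q -> continuous h ->
    (forall t, (h t).1 ^+ 2 + (h t).2 ^+ 2 <= 1) -> continuous (fun t => ratio p q (h t)).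
  move=> pq h_cont h_disk t.
  have form_cont x : (fun t => tangent_form x (h t)) @ t --> tangent_form x (h t).
    have h1 : (fun t => (h t).1) @ t --> (h t).1.
      by apply: (@cvg_comp _ _ _ h fst); [exact: h_cont | exact: cvg_fst].
    have h2 : (fun t => (h t).2) @ t --> (h t).2.
      by apply: (@cvg_comp _ _ _ h snd); [exact: h_cont | exact: cvg_snd].
    rewrite /tangent_form; apply: cvgD; last first.
      by apply: cvgM; [exact: cvg_cst | apply: cvgD; [exact: cvg_cst | exact: h1]].
    apply: cvgB; first by apply: cvgB; [exact: cvg_cst | exact: h1].
    under eq_fun do rewrite -mulr_natr; rewrite -mulr_natr.
    by apply: cvgM; [apply: cvgM; [exact: cvg_cst | exact: h2] | exact: cvg_cst].
  have [_ _ pos] := tangent_form_gt0 (h_disk t) pq.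
  apply: cvgM; first exact: form_cont.
  by apply: cvgV; [rewrite gt_eqF | apply: cvgD; exact: form_cont].
have ac := lt_trans ab bc; have bd := lt_trans bc cd.
have ratio01 p q z : p < q -> z.1 ^+ 2 + z.2 ^+ 2 <= 1 -> 0 <= ratio p q z <= 1.
  move=> pq z_disk; have [p_ge q_ge pos] := tangent_form_gt0 z_disk pq.
  by rewrite divr_ge0 ?(ltW pos) //= ler_pdivrMr // mul1r lerDl.
have ratio0 p q : ratio p q (circle_point p) = 0 by rewrite /ratio tangent_form_point mul0r.
have ratio1 p q : p < q -> (circle_point q).1 ^+ 2 + (circle_point q).2 ^+ 2 <= 1 ->
    ratio p q (circle_point q) = 1.
  move=> pq q_disk; have [_ _] := tangent_form_gt0 q_disk pq.
  by rewrite /ratio tangent_form_point addr0 => pos; rewrite divff // gt_eqF.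
have ratio_eq p q z w : p < q -> z.1 ^+ 2 + z.2 ^+ 2 <= 1 -> w.1 ^+ 2 + w.2 ^+ 2 <= 1 ->
    ratio p q z = ratio p q w ->
    tangent_form p z * tangent_form q w = tangent_form q z * tangent_form p w.
  move=> pq z_disk w_disk /eqP; have [_ _ z_pos] := tangent_form_gt0 z_disk pq.
  have [_ _ w_pos] := tangent_form_gt0 w_disk pq.
  rewrite /ratio eqr_div; [|by rewrite gt_eqF|by rewrite gt_eqF].
  by move=> /eqP; lra.
have f1_disk := f_disk 1; rewrite f1 in f1_disk.
have g1_disk := g_disk 1; rewrite g1 in g1_disk.
have [||s [t [s01 t01 e_ac e_bd]]] := paths_meet (ratio_cont f a c ac f_cont f_disk)
  (ratio_cont f b d bd f_cont f_disk) (ratio_cont g a c ac g_cont g_disk)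
  (ratio_cont g b d bd g_cont g_disk).
- by move=> t _; rewrite f0 f1 ratio0 ratio1 // ratio01.
- by move=> t _; rewrite g0 g1 ratio0 ratio1 // ratio01.
by exists s, t; split=> //; apply: (tangent_ratio_inj ab bc cd) => //; apply: ratio_eq.
Qed.

Lemma reverse_continuous (f : R -> R * R) : continuous f -> continuous (fun t => f (1 - t)).
Proof.
move=> f_cont t; apply: (@cvg_comp _ _ _ (fun t => 1 - t) f); last exact: f_cont.
by apply: cvgB; [exact: cvg_cst | exact: cvg_id].
Qed.

Lemma arcs_meet (f g : R -> R * R) a b c d :
  (Num.min a c < Num.min b d < Num.max a c) && (Num.max a c < Num.max b d) ||
  (Num.min b d < Num.min a c < Num.max b d) && (Num.max b d < Num.max a c) ->
  continuous f -> continuous g ->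
  (forall t, (f t).1 ^+ 2 + (f t).2 ^+ 2 <= 1) ->
  (forall t, (g t).1 ^+ 2 + (g t).2 ^+ 2 <= 1) ->
  f 0 = circle_point a -> f 1 = circle_point c ->
  g 0 = circle_point b -> g 1 = circle_point d ->
  exists s t, [/\ 0 <= s <= 1, 0 <= t <= 1 & f s = g t].
Proof.
wlog ac : f a c / a < c.
  move=> IH cross f_cont g_cont f_disk g_disk f0 f1 g0 g1.
  case: (ltgtP a c) => [ac|ca|E]; first exact: (IH f a c).
    rewrite (minC a) (maxC a) in cross.
    have f0' : f (1 - 0) = circle_point c by rewrite subr0.
    have f1' : f (1 - 1) = circle_point a by rewrite subrr.
    have [s [t [s01 t01 st]]] := IH (fun t => f (1 - t)) c a ca cross
      (reverse_continuous f_cont) g_cont (fun t => f_disk (1 - t)) g_disk f0' f1' g0 g1.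
    by exists (1 - s), t; split=> //; lra.
  by move: cross; rewrite E minxx maxxx; lra.
wlog bd : g b d / b < d.
  move=> IH cross f_cont g_cont f_disk g_disk f0 f1 g0 g1.
  case: (ltgtP b d) => [bd|db|E]; first exact: (IH g b d).
    rewrite (minC b) (maxC b) in cross.
    have g0' : g (1 - 0) = circle_point d by rewrite subr0.
    have g1' : g (1 - 1) = circle_point b by rewrite subrr.
    have [s [t [s01 t01 st]]] := IH (fun t => g (1 - t)) d b db cross f_cont
      (reverse_continuous g_cont) f_disk (fun t => g_disk (1 - t)) f0 f1 g0' g1'.
    by exists s, (1 - t); split=> //; lra.
  by move: cross; rewrite E minxx maxxx; lra.
rewrite !min_l ?max_r ?ltW //.
case/orP => /andP[/andP[lt1 lt2] lt3] f_cont g_cont f_disk g_disk f0 f1 g0 g1.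
  exact: (ordered_arcs_meet lt1 lt2 lt3 f_cont g_cont f_disk g_disk f0 f1 g0 g1).
have [t [s [t01 s01 ts]]] :=
  ordered_arcs_meet lt1 lt2 lt3 g_cont f_cont g_disk f_disk g0 g1 f0 f1.
by exists s, t.
Qed.

Lemma circle_pointP z : z.1 ^+ 2 + z.2 ^+ 2 = 1 -> z.1 != -1 -> exists x, z = circle_point x.
Proof.
case: z => z1 z2 /= circ z1_neq; exists (z2 / (1 + z1)).
have nz : 1 + z1 != 0 by apply: contra z1_neq => /eqP E; apply/eqP; lra.
have z2E : z2 ^+ 2 = (1 - z1) * (1 + z1) by lra.
have sqE : (z2 / (1 + z1)) ^+ 2 = (1 - z1) / (1 + z1).
  by rewrite expr_div_n z2E expr2; field.
rewrite /circle_point sqE.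
have den : 1 + (1 - z1) / (1 + z1) = 2 / (1 + z1) by field.
by rewrite den; congr pair; field.
Qed.

Lemma circle_point_inj x y : circle_point x = circle_point y -> x = y.
Proof.
move=> E; have := tangent_form_point x; rewrite E /tangent_form /circle_point /=.
have pos : 0 < 1 + y ^+ 2 by rewrite ltr_wpDr // sqr_ge0.
have nz : 1 + y ^+ 2 != 0 by rewrite gt_eqF.
move=> H; apply/eqP; rewrite -subr_eq0 -sqrf_eq0; apply/eqP.
apply: (mulfI (_ : 2 / (1 + y ^+ 2) != 0)); first by rewrite mulf_neq0 // invr_neq0.
by rewrite mulr0 -[RHS]H; field.
Qed.

(* The rotation of the plane that takes the point w of the circle to (-1, 0). *)
Definition rotation w z : R * R := (- (w.1 * z.1 + w.2 * z.2), w.2 * z.1 - w.1 * z.2).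

Lemma rotation_norm w z : w.1 ^+ 2 + w.2 ^+ 2 = 1 ->
  (rotation w z).1 ^+ 2 + (rotation w z).2 ^+ 2 = z.1 ^+ 2 + z.2 ^+ 2.
Proof.
move=> w_circ; rewrite -[RHS]mul1r -w_circ /rotation /=; ring.
Qed.

Lemma rotation_inj w : w.1 ^+ 2 + w.2 ^+ 2 = 1 -> injective (rotation w).
Proof.
case: w => w1 w2 /= circ [z1 z2] [y1 y2] [] /= e1 e2.
have k1 : z1 = w1 * (w1 * z1 + w2 * z2) + w2 * (w2 * z1 - w1 * z2).
  by rewrite -[LHS]mul1r -circ; ring.
have k2 : z2 = w2 * (w1 * z1 + w2 * z2) - w1 * (w2 * z1 - w1 * z2).
  by rewrite -[LHS]mul1r -circ; ring.
have e1' : w1 * z1 + w2 * z2 = w1 * y1 + w2 * y2 by lra.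
congr pair; [rewrite k1 | rewrite k2]; rewrite e1' e2 -[RHS]mul1r -circ; ring.
Qed.

Lemma rotation_pole w z : w.1 ^+ 2 + w.2 ^+ 2 = 1 -> z.1 ^+ 2 + z.2 ^+ 2 = 1 ->
  (rotation w z).1 = -1 -> z = w.
Proof.
move=> w_circ z_circ pole; apply: (rotation_inj w_circ).
have := rotation_norm z w_circ; rewrite z_circ pole sqrrN expr1n => E.
have E2 : (rotation w z).2 = 0.
  by apply/eqP; rewrite -sqrf_eq0; apply/eqP; lra.
rewrite (surjective_pairing (rotation w z)) pole E2 /rotation.
by congr pair; [rewrite -w_circ; ring | ring].
Qed.

Lemma rotation_continuous w : continuous (rotation w).
Proof.
move=> z.
have h1 : (fun z : R * R => z.1) @ z --> z.1 by exact: cvg_fst.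
have h2 : (fun z : R * R => z.2) @ z --> z.2 by exact: cvg_snd.
have h c (f : R * R -> R) : f @ z --> f z -> (fun z => c * f z) @ z --> c * f z.
  by move=> fz; apply: cvgM; [exact: cvg_cst | exact: fz].
have r1 : (fun z => - (w.1 * z.1 + w.2 * z.2)) @ z --> (- (w.1 * z.1 + w.2 * z.2)).
  by apply: cvgN; apply: cvgD; apply: h.
have r2 : (fun z => w.2 * z.1 - w.1 * z.2) @ z --> w.2 * z.1 - w.1 * z.2.
  by apply: cvgB; apply: h.
exact: (cvg_pair r1 r2).
Qed.

Lemma circle_point_norm x : (circle_point x).1 ^+ 2 + (circle_point x).2 ^+ 2 = 1.
Proof.
rewrite /circle_point /=; have : 1 + x ^+ 2 != 0 by rewrite gt_eqF // ltr_wpDr // sqr_ge0.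
by move=> nz; field.
Qed.

(** A rotation will take [w] to (-1, 0), the point that [circle_point] misses. The pigeonhole
    principle provides [w] among #|T| + 1 points. *)
Lemma circle_avoid (T : finType) (f : T -> R * R) :
  exists2 w, w.1 ^+ 2 + w.2 ^+ 2 = 1 & forall v, f v <> w.
Proof.
pose g (i : 'I_#|T|.+1) := circle_point i%:R.
have g_inj : injective g.
  by move=> i j /circle_point_inj/eqP; rewrite eqr_nat => /eqP/val_inj.
have [i iP] : exists i, forall v, f v <> g i.
  apply: contrapT => none.
  have all_hit i : exists v, f v = g i.
    by apply: contrapT => no; apply: none; exists i => v E; apply: no; exists v.
  pose h i := projT1 (cid (all_hit i)).
  have h_inj : injective h.
    move=> i j; rewrite /h; case: cid => u uE; case: cid => v vE /= E.
    by apply: g_inj; rewrite -uE -vE E.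
  by have := leq_card h h_inj; rewrite card_ord ltnn.
by exists (g i) => //; exact: circle_point_norm.
Qed.

End Disk.

(** * From drawings to orders *)

Section Drawing.
Import Order.TTheory GRing.Theory Num.Theory numFieldNormedType.Exports.
Local Open Scope classical_set_scope.
Local Open Scope ring_scope.
Variables (R : realType) (T : finType) (e : rel T) (B : {set T}).

Lemma crossing_rank (xi : T -> R) (x : T -> nat) :
  {in B &, forall u v, (x u < x v)%N = (xi u < xi v)} ->
  forall a b c d, a \in B -> b \in B -> c \in B -> d \in B ->
  crossing (x a) (x b) (x c) (x d) ->
  (Num.min (xi a) (xi b) < Num.min (xi c) (xi d) < Num.max (xi a) (xi b)) &&
    (Num.max (xi a) (xi b) < Num.max (xi c) (xi d)) ||
  (Num.min (xi c) (xi d) < Num.min (xi a) (xi b) < Num.max (xi c) (xi d)) &&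
    (Num.max (xi c) (xi d) < Num.max (xi a) (xi b)).
Proof.
move=> mono a b c d aB bB cB dB; rewrite /crossing /between /outside.
by case: (ltP (xi a) (xi b)) => ab; case: (ltP (xi c) (xi d)) => cd;
   move: ab cd; rewrite ?leNgt -!mono //; clear; lia.
Qed.

Lemma drawing_order (pos : T -> R * R) (arc : edge (induced e B) -> R -> R * R) :
  circular_drawing B pos arc -> ordered_on e B.
Proof.
move=> draw; have [w w_circ w_avoid] := circle_avoid pos.
have [xi xiP] : exists xi : T -> R, {in B, forall v, rotation w (pos v) = circle_point (xi v)}.
  have pt v : exists x, v \in B -> rotation w (pos v) = circle_point x.
    case vB: (v \in B); last by exists 0.
    have v_circ := pos_circle draw vB.
    have [||x xP] := @circle_pointP _ (rotation w (pos v)); last by exists x.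
      by rewrite rotation_norm.
    by apply/eqP => /(rotation_pole w_circ v_circ); apply: w_avoid.
  by exists (fun v => projT1 (cid (pt v))) => v; apply: projT2 (cid (pt v)).
have xi_inj : {in B &, injective xi}.
  move=> u v uB vB E; apply: (pos_inj draw) => //; apply: (rotation_inj w_circ).
  by rewrite !xiP // E.
(* Ranks replace the real parameters by natural numbers in the same order. *)
pose x v := #|[set u in B | xi u < xi v]%SET|.
have x_mono : {in B &, forall u v, (x u < x v)%N = (xi u < xi v)}.
  have le u v : xi u <= xi v -> (x u <= x v)%N.
    move=> uv; apply/subset_leq_card/fintype.subsetP => t; rewrite !finset.inE.
    by case/andP => -> /lt_le_trans->.
  move=> u v uB vB; case: (leP (xi v) (xi u)) => [/le|uv]; first by rewrite ltnNge => ->.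
  apply/proper_card/properP; split.
    by apply/fintype.subsetP => t; rewrite !finset.inE => /andP[-> /lt_trans->].
  by exists u; rewrite !finset.inE uB ?ltxx.
exists x; split.
  move=> u v uB vB E; apply: xi_inj => //; apply/eqP; rewrite eq_le !leNgt.
  by rewrite -!x_mono // E ltnn.
have crosses_of a b c d (al ga : edge (induced e B)) :
    a \in B -> b \in B -> c \in B -> d \in B ->
    val al = [set a; b]%SET -> val ga = [set c; d]%SET ->
    crossing (x a) (x b) (x c) (x d) -> crosses arc al ga.
  move=> aB bB cB dB al_ab ga_cd cr_abcd.
  have [u [v [al_uv al0 al1]]] := arc_ends draw al.
  have [p [q [ga_pq ga0 ga1]]] := arc_ends draw ga.
  have [[uB vB pB qB] cr] : [/\ u \in B, v \in B, p \in B & q \in B] /\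
      crossing (x u) (x v) (x p) (x q).
    have crC1 k l m n : crossing k l m n = crossing l k m n.
      by rewrite /crossing /between /outside; clear; lia.
    have crC2 k l m n : crossing k l m n = crossing k l n m.
      by rewrite /crossing /between /outside; clear; lia.
    by case: (elem_inj (etrans (esym al_ab) al_uv)) => -[<- <-];
       case: (elem_inj (etrans (esym ga_cd) ga_pq)) => -[<- <-];
       split=> //; do ?[by []|by rewrite crC1|by rewrite crC2|by rewrite crC1 crC2].
  have distinct : [/\ u <> p, u <> q, v <> p & v <> q].
    by split=> E; move: cr; rewrite E /crossing /between /outside; clear; lia.
  have meet := crossing_rank x_mono uB vB pB qB cr.
  pose arcr (be : edge (induced e B)) := rotation w \o (arc be \o @clamp R).
  have arcr_cont be : continuous (arcr be).
    move=> t; apply: continuous_comp; last exact: rotation_continuous.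
    exact: (clamp_comp_continuous (@arc_continuous _ _ _ _ _ _ draw be)).
  have arcr_disk be t : (arcr be t).1 ^+ 2 + (arcr be t).2 ^+ 2 <= 1.
    by rewrite /arcr /= rotation_norm //; apply: (arc_disk draw); apply: clamp_in.
  have clamp0 : @clamp R 0 = 0 by rewrite clamp_id // lexx ler01.
  have clamp1 : @clamp R 1 = 1 by rewrite clamp_id // lexx ler01.
  have [||||s [t [s01 t01]]] :=
    arcs_meet meet (arcr_cont al) (arcr_cont ga) (arcr_disk al) (arcr_disk ga).
  - by rewrite /arcr /= clamp0 al0 xiP.
  - by rewrite /arcr /= clamp1 al1 xiP.
  - by rewrite /arcr /= clamp0 ga0 xiP.
  - by rewrite /arcr /= clamp1 ga1 xiP.
  rewrite /arcr /= !clamp_id // => /(rotation_inj w_circ) meet_st.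
  have [up uq vp vq] := distinct.
  have ends (r : R) : 0 <= r <= 1 -> [\/ r = 0, r = 1 | 0 < r < 1].
    case/andP; rewrite !le_eqVlt => /orP[/eqP<-|r0]; first by constructor 1.
    by case/orP => [/eqP->|r1]; [constructor 2 | constructor 3; rewrite r0].
  have no_end z1 z2 : z1 \in B -> z2 \in B -> z1 <> z2 -> pos z1 <> pos z2.
    by move=> z1B z2B neq /(pos_inj draw z1B z2B).
  (* A contact at an end of an arc would put a vertex inside another arc or identify two
     vertices. *)
  have s_in : 0 < s < 1.
    case: (ends s s01) => // sE; rewrite sE ?al0 ?al1 in meet_st; exfalso;
    case: (ends t t01) => tE; rewrite ?tE ?ga0 ?ga1 in meet_st;
    by [apply: no_end meet_st | apply: (arc_avoids draw tE _ (esym meet_st))].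
  have t_in : 0 < t < 1.
    case: (ends t t01) => // tE; rewrite tE ?ga0 ?ga1 in meet_st; exfalso;
    exact: (arc_avoids draw s_in _ meet_st).
  split; last by exists s, t.
  by move=> E; case: (elem_inj (etrans (esym al_uv) (etrans (congr1 val E) ga_pq))) => -[].
move=> a b c d c' d' ab cd cd' cr cr'.
have edge_of u v : induced e B u v ->
    exists2 al : edge (induced e B), val al = [set u; v]%SET & u \in B /\ v \in B.
  move=> uv; have [uB vB _] := and3P uv.
  have uvE : [set u; v]%SET \in edges (induced e B) by apply/edgesP; exists u, v.
  by exists (exist (fun A => A \in edges (induced e B)) _ uvE).
have [al alE [aB bB]] := edge_of _ _ ab.
have [ga gaE [cB dB]] := edge_of _ _ cd.
have [ga' gaE' [cB' dB']] := edge_of _ _ cd'.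
rewrite -gaE -gaE'; congr val; apply: (arc_crossing draw (a := al)).
  exact: (crosses_of a b c d).
exact: (crosses_of a b c' d').
Qed.

End Drawing.

Lemma pseudo_outerplanar_order (R : realType) (T : finType) (e : rel T) :
  symmetric e -> pseudo_outerplanar R e ->
  exists2 x : T -> nat, injective x & one_planar_order e x.
Proof.
move=> e_sym e_pop.
have nonsep B : nonseparable e B -> ordered_on e B.
  move=> /maxset_exists[B' B'_block BB']; apply: ordered_on_sub BB' _.
  by have [pos [arc draw]] := e_pop _ B'_block; apply: drawing_order draw.
have [x [x_inj x_1p]] := ordered_on_all e_sym nonsep [set: T]%SET.
have ind u v : e u v -> induced e [set: T]%SET u v by rewrite /induced /= !finset.in_setT.
exists x; first by move=> u v; apply: x_inj; rewrite finset.in_setT.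
by move=> a b c d c' d' /ind ab /ind cd /ind cd'; apply: x_1p.
Qed.

(** * From lists of arbitrary cardinality to finite lists, and the proof of the theorem *)

Lemma card_le_uniq (C : choiceType) (k : nat) (A : set C) :
  (`I_k #<= A)%card -> exists s : seq C, [/\ uniq s, size s = k & forall c, c \in s -> A c].
Proof.
move=> /card_leP[f]; have in_k (i : 'I_k) : (i : nat) \in `I_k by rewrite inE /= ltn_ord.
pose g (i : 'I_k) := val (f (SigSub (in_k i))).
exists (map g (enum 'I_k)); split=> [||c /mapP[i _ ->]].
- rewrite map_inj_uniq ?enum_uniq // => i j /val_inj/inj; rewrite !inE => /(_ I I) [].
  exact: val_inj.
- by rewrite size_map size_enum_ord.
- exact: set_valP.
Qed.

Theorem theorem3p1 (R : realType) (T : finType) (e : rel T)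
    (e_sym : symmetric e) (e_irr : irreflexive e)
    (e_pop : pseudo_outerplanar R e)
    (C : Type) (L : element e -> set C)
    (L_size : forall x : element e,
       (`I_(maxn 6 (max_degree e).+1) #<= L x)%card) :
  exists phi : element e -> C, list_total_coloring L phi.
Proof.
(* A vertex provides a default colour; without vertices there is nothing to colour. *)
have [[t0 _]|T_empty] := pselect (exists t : T, true); last first.
  have no (y : element e) : False.
    case: y => [u|[A /edgesP[u _]]]; by apply: T_empty; exists u.
  by exists (fun y => match no y with end); split=> y; case: (no y).
have [x x_inj x_1p] := pseudo_outerplanar_order e_sym e_pop.
set k := maxn _ _ in L_size.
have no_loop u : elem u u \notin edges e.
  apply/edgesP => -[v [w [vw /elem_inj[][uv uw]]]];
  by rewrite -uv -uw e_irr in vw.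
(* An element is determined by its vertex set, so lists can be indexed by sets; [{classic C}] equips
   [C] with decidable equality. *)
have listP A : exists l : seq {classic C},
    [/\ A \in elements e -> uniq l /\ size l = k,
        forall u, A = elem u u -> forall c, c \in l -> L (inl u) c &
        forall a : edge e, A = val a -> forall c, c \in l -> L (inr a) c].
  case: (boolP (A \in edges e)) => [A_edge|A_not_edge].
    pose a : edge e := exist (fun A => A \in edges e) A A_edge.
    have [l [l_uniq l_size lL]] := @card_le_uniq {classic C} k (L (inr a)) (L_size _).
    exists l; split.
    - by [].
    - by move=> u A_u; have := no_loop u; rewrite -A_u A_edge.
    - by move=> b A_b c; have -> : b = a by [apply/val_inj]; apply: lL.
  case: (pselect (exists u, A = elem u u)) => [[u A_u]|A_not_vertex].
    have [l [l_uniq l_size lL]] := @card_le_uniq {classic C} k (L (inl u)) (L_size _).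
    exists l; split=> [//|v|b E]; last by rewrite E (valP b) in A_not_edge.
    by rewrite A_u => /elem_inj[][<- _].
  exists [::]; split=> //; case/elementsP => u [v [/orP[/eqP <-|uv] A_uv]].
    by case: A_not_vertex; exists u.
  by case/negP: A_not_edge; apply/edgesP; exists u, v.
pose l A := projT1 (cid (listP A)).
have l_size A : A \in elements e -> k <= size (undup (l A)).
  by rewrite /l; case: cid => /= s [s_uniq _ _] /s_uniq[/undup_id -> ->].
have deg_lt u : deg e u < k.
  by rewrite leq_max; apply/orP; right; exact: (@leq_bigmax T (deg e) u).
have [psi [psi_l psi_clash]] :=
  ordered_colorable t0 e_sym e_irr x_inj x_1p (leq_maxl _ _) deg_lt l_size.
pose el (y : element e) := match y with inl u => elem u u | inr a => val a end.
have el_in y : el y \in elements e.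
  case: y => [u|a]; first exact: vertex_element.
  by rewrite /elements finset.inE (valP a).
have vertex_neq u (a : edge e) : elem u u != val a.
  by apply: contraNneq (no_loop u) => ->; apply: valP.
exists (fun y => psi (el y)); split=> [y z yz|y].
  apply: psi_clash; rewrite ?finset.in_set0 //.
  case: y z yz => [u|a] [v|b] /=.
  - exact: clash_adjacent.
  - by move=> ub; apply: (clash_share e _ _ ub); [exact: vertex_neq | rewrite elem_in eqxx].
  - move=> va; rewrite clashC.
    by apply: (clash_share e _ _ va); [exact: vertex_neq | rewrite elem_in eqxx].
  - case/andP => ab; rewrite -setI_eq0 => /set0Pn[w]; rewrite finset.inE => /andP[wa wb].
    exact: (clash_share e ab wa wb).
have {}psi_l : psi (el y) \in l (el y) by apply: psi_l; rewrite ?finset.in_set0.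
move: psi_l; rewrite /l; case: cid => s /= [_ sV sE].
by case: y sV sE => [u|a] sV sE s_psi; [exact: (sV u) | exact: (sE a)].
Qed.
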